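(* Let $\mathcal A$ be the family of planar convex bodies $S$ satisfying $B(1/2)\subset S\subset B(\sqrt3/3)$, and consider the problem \[ \max_{S\in\mathcal A}\ \tfrac12\operatorname{Per}(S)-A(S). \] This problem is solved by the regular hexagon $H$ inscribed in $B(\sqrt3/3)$ and circumscribed to $B(1/2)$, and the maximal value is $\sqrt3/2$. Moreover, the regular hexagon $H$ is also a solution of the problem \[ \max\Big\{\tfrac12\operatorname{Per}(S)-A(S)\ :\ S=\operatorname{conv}\{K,-K\},\ K \text{ a planar convex body of constant width } 1\Big\}. \]
   Context: $B(r)$ denotes the closed disk of radius $r$ centered at the origin of $\mathbb R^2$, $A(\cdot)$ is the area and $\operatorname{Per}(\cdot)$ is the perimeter. A planar convex body has constant width $1$ if the distance between any two distinct parallel supporting lines is $1$. $-K=\{-x:x\in K\}$ and $\operatorname{conv}\{K,-K\}$ is the convex hull of $K\cup(-K)$. *)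

(* Defs.v *)
From HB Require Import structures.
From mathcomp Require Import all_boot all_order all_algebra.
From mathcomp Require Import all_classical all_reals all_analysis.

Set Implicit Arguments.
Unset Strict Implicit.
Unset Printing Implicit Defensive.

Import Order.TTheory GRing.Theory Num.Theory.
Import numFieldNormedType.Exports.

Local Open Scope classical_set_scope.
Local Open Scope ring_scope.

(* [R^o] rather than [R] so that the plane is an [lmodType R].  Its topology is
   the usual one, but the library norm on it is the sup norm; the Euclidean norm
   is [enorm] below. *)
Notation plane R := (R^o * R^o)%type.

Section plane_geometry.
Context {R : realType}.
Implicit Types (S K H : set (plane R)) (u v a b c x : plane R).

Definition dot u v : R := u.1 * v.1 + u.2 * v.2.

Definition enorm u : R := Num.sqrt (dot u u).

Definition disk (r : R) : set (plane R) := [set x | enorm x <= r].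

Definition hull (A : set (plane R)) : set (plane R) :=
  smallest (@convex_set R (plane R)) A.

Definition convex_body K : Prop :=
  [/\ compact K, @convex_set R (plane R) K & K° !=set0].

Definition area S : \bar R :=
  ((@lebesgue_measure R) \x (@lebesgue_measure R))%E S.

(* Twice the signed area of the triangle [a b c]; positive iff it is a
   nondegenerate counterclockwise triangle. *)
Definition orient a b c : R :=
  (b - a).1 * (c - a).2 - (b - a).2 * (c - a).1.

(* [p 0, ..., p (n - 1)] are the vertices, in counterclockwise order, of a
   strictly convex [n]-gon whose vertices lie on the boundary of [S]. *)
Definition inscribed_polygon S (n : nat) (p : nat -> plane R) : Prop :=
  [/\ (2 < n)%N,
      forall i, (i < n)%N -> (closure S `\` S°) (p i)
    & forall i j k, (i < j)%N -> (j < k)%N -> (k < n)%N ->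
        0 < orient (p i) (p j) (p k)].

Definition polygon_length (n : nat) (p : nat -> plane R) : R :=
  \sum_(i < n) enorm (p (i.+1 %% n)%N - p i).

(* Length of the boundary curve of a convex body: the supremum of the lengths
   of the closed polygonal lines whose vertices are taken on the boundary, in
   the order in which the curve visits them.  For a convex curve this order is
   expressed by the orientation of triples.  It is strict, so that points on a
   common side cannot be visited back and forth; a polygonal line with
   intermediate vertices on a side is no longer than the one without them. *)
Definition perimeter S : \bar R :=
  ereal_sup [set l | exists n p,
    inscribed_polygon S n p /\ l = (polygon_length n p)%:E].

(* The line [dot u x = c], for a unit vector [u], supports [K]. *)
Definition supporting_line K u (c : R) : Prop :=
  (exists2 x, K x & dot u x = c) /\
  ((forall x, K x -> dot u x <= c) \/ (forall x, K x -> c <= dot u x)).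

(* [`|c1 - c2|] is the distance between the parallel lines [dot u x = c1] and
   [dot u x = c2], as [u] is a unit vector. *)
Definition constant_width (w : R) K : Prop :=
  forall u (c1 c2 : R), enorm u = 1 -> c1 <> c2 ->
    supporting_line K u c1 -> supporting_line K u c2 -> `|c1 - c2| = w.

Definition hexagon_vertex c (r t : R) (k : nat) : plane R :=
  c + (r * cos (t + k%:R * (pi / 3)), r * sin (t + k%:R * (pi / 3))).

Definition hexagon c (r t : R) : set (plane R) :=
  hull [set hexagon_vertex c r t k | k in `I_6].

(* [H] is a regular hexagon (center [c], circumradius [r], first vertex in
   direction [t]) inscribed in [disk rho] (all its vertices are on the circle
   of radius [rho]) and circumscribed to [disk s] (it contains this disk, which
   touches each of its sides). *)
Definition regular_hexagon_between (s rho : R) H : Prop :=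
  exists c (r t : R), let v := hexagon_vertex c r t in
  [/\ 0 < r, H = hexagon c r t,
      forall k, (k < 6)%N -> enorm (v k) = rho,
      disk s `<=` H
    & forall k, (k < 6)%N -> hull [set v k; v k.+1] `&` disk s !=set0].

Definition half_perimeter_minus_area S : \bar R :=
  ((2^-1)%:E * perimeter S - area S)%E.

Definition bodies_in_annulus : set (set (plane R)) :=
  [set S | [/\ convex_body S, disk (1 / 2) `<=` S
             & S `<=` disk (Num.sqrt 3 / 3)]].

Definition symmetrized_constant_width : set (set (plane R)) :=
  [set S | exists K, [/\ convex_body K, constant_width 1 K
                       & S = hull (K `|` (-%R @` K))]].

Definition maximizes (T : Type) (J : T -> \bar R) (F : set T) (x : T) : Prop :=
  F x /\ forall y, F y -> (J y <= J x)%E.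

End plane_geometry.

(* Main.v *)
Require Import Defs.
From mathcomp Require Import all_boot all_order all_algebra.
From mathcomp Require Import all_classical all_reals all_analysis.
From mathcomp Require Import ring lra zify.

Set Implicit Arguments.
Unset Strict Implicit.
Unset Printing Implicit Defensive.

Import Order.TTheory GRing.Theory Num.Theory.
Import numFieldNormedType.Exports.
Local Open Scope classical_set_scope.
Local Open Scope ring_scope.

(* For N = 4L equally spaced directions u_m let h_m be the support function of S
   and z_m a contact point of S with its support line of normal u_m.  Averaging
   |<e, u_m>| over m (Cauchy's formula) bounds half the length of a convex polygon
   in S by tan (pi / N) times the sum of the h_m, up to a relative error O(1 / N),
   and the area of S is at least that of the polygon of the z_m.  Up to
   O(1 / N), half the perimeter minus the area is thus at most a quadratic
   functional of f = h - 1/2, the discrete form of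
   1/2 int (1/4 - f^2 + f'^2).

   If 1/2 <= h and |z|^2 = h^2 + h'^2 <= 1/3, this integral is estimated by a
   calibration: an explicit function k with k(0) = 0 such that
   (1/4 - f^2 + f'^2) / 2 <= C + k'(f) f'^2 - k(f) (1/2 + f), with equality along
   the hexagon.  Convexity (h + h'' >= 0) and an integration by parts give
   int k'(f) f'^2 <= int k(f) h, so the integral is at most 2 pi C = sqrt 3 / 2.

   For K of constant width 1, the support function of the hull of K and -K is
   1/2 + |f| with f = h_K - 1/2, and the functional does not decrease when |f| is
   replaced by f.  Moreover f(-u) = - f(u), and the functional is invariant under
   translations of K, so by Jung's theorem K may be assumed to lie in the disk of
   radius 1 / sqrt 3; the same calibration, with k extended as an odd function, applies.

   The hexagon attains the bound; it is the hull of R and -R for the Reuleaux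
   triangle R on every other vertex. *)

(** Finitely many directions are used so that no regularity of the support function enters: contact
    points are arbitrary maximisers, integration by parts is an exact rearrangement of periodic
    sums, and convexity only says that a contact point lies below the support lines of the two
    neighbouring directions.

    The convexity inequality is multiplied by k, so k has to be nonnegative wherever only h + h'' >=
    0 is known; for constant width, where f also takes negative values, the reverse inequality comes
    from f(-u) = - f(u).

    The obstacle is the vertex of the hexagon: there the constraint is saturated, so a discrete step
    may overshoot it by O(1 / N), and the derivative of the arc cosine in k blows up. The
    calibration is therefore built for vertices at the slightly larger distance 1 / (2 cos w), with
    w > pi / 6 and C = tan w / (8 w); w tends to pi / 6 only after N has tended to infinity. *)

(** * Elementary trigonometric inequalities *)

Lemma mean_value_segment (R : realType) (f df : R -> R) (a b : R) : a <= b ->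
  (forall x, a <= x <= b -> is_derive x 1 f (df x)) ->
  exists2 c, a <= c <= b & f b - f a = df c * (b - a).
Proof.
move=> ab dfP; have [||c /itvP cI E] := @MVT_segment R f df a b ab.
- by move=> x /itvP xI; apply: dfP; rewrite !xI.
- apply: derivable_within_continuous => x /itvP xI.
  by have [] := dfP x; rewrite ?xI.
- by exists c; rewrite ?cI.
Qed.

Lemma sin_le (R : realType) (x : R) : 0 <= x -> sin x <= x.
Proof.
move=> x0; have [c /andP[c0 _]] := @mean_value_segment R sin cos 0 x x0 (fun _ _ => is_derive_sin _).
by rewrite sin0 !subr0 => ->; have := cos_le1 c; nra.
Qed.

Lemma normr_sin_le (R : realType) (x : R) : `|sin x| <= `|x|.
Proof.
wlog x0 : x / 0 <= x.
  move=> H; case: (leP 0 x) => [/H //|x0].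
  by rewrite -(normrN x) -(normrN (sin x)) -sinN; apply: H; lra.
rewrite (ger0_norm x0) ler_norml sin_le // andbT.
have := @sin_le _ x x0; case: (leP x 1) => x1.
  have : 0 <= sin x by apply: sin_ge0_pi; have := pi_ge2 R; lra.
  by lra.
by have := sin_geN1 x; lra.
Qed.

Lemma cos_ge (R : realType) (x : R) : 1 - x ^+ 2 / 2 <= cos x.
Proof.
have -> : cos x = 1 - 2 * sin (x / 2) ^+ 2.
  have {1}-> : x = (x / 2) *+ 2 by rewrite mulr2n; lra.
  by rewrite cos_mulr2n cos2sin2; ring.
have : sin (x / 2) ^+ 2 <= (x / 2) ^+ 2.
  by rewrite -(real_normK (num_real (sin _))) -(real_normK (num_real (x/2))) ler_sqr ?nnegrE // normr_sin_le.
by nra.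
Qed.

(** The difference of the two sides vanishes at 0 and has derivative [x * sin x]. It is the
    numerator of the derivative of [x / sin x], which governs the sign of [calibration_derive]. *)
Lemma mulr_cos_le_sin (R : realType) (x : R) : 0 <= x <= pi -> x * cos x <= sin x.
Proof.
move=> /andP[x0 xpi].
have D (y : R) : is_derive y 1 (sin - id * cos : R -> R) (y * sin y).
  by apply: trigger_derive; rewrite /GRing.scale /=; ring.
have [c /andP[c0 cx]] := mean_value_segment x0 (fun y _ => D y).
rewrite !fctE sin0 mul0r !subr0 => E.
by rewrite -subr_ge0 E !mulr_ge0 ?sin_ge0_pi //; lra.
Qed.

(** * Unit directions and polar coordinates *)

Definition direction {R : realType} (a : R) : plane R := (cos a, sin a).

Definition det {R : realType} (a b : plane R) : R := a.1 * b.2 - a.2 * b.1.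

Lemma enormE (R : realType) (x : plane R) : enorm x ^+ 2 = dot x x.
Proof. by rewrite sqr_sqrtr // /dot; nra. Qed.

Lemma dot_ge0 (R : realType) (x : plane R) : 0 <= dot x x.
Proof. by rewrite /dot; nra. Qed.

Lemma enorm_ge0 (R : realType) (x : plane R) : 0 <= enorm x.
Proof. exact: sqrtr_ge0. Qed.

Lemma enorm_le (R : realType) (x : plane R) (r : R) : 0 <= r ->
  (enorm x <= r) = (dot x x <= r ^+ 2).
Proof.
by move=> r0; rewrite -enormE ler_sqr ?nnegrE ?enorm_ge0.
Qed.

Lemma direction_arg (R : realType) (x y : R) : x ^+ 2 + y ^+ 2 = 1 ->
  exists2 a, 0 <= a < 2 * pi & (cos a = x /\ sin a = y).
Proof.
move=> E; have x1 : -1 <= x <= 1 by nra.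
have c := acos_ge0 x1; have c' := acos_lepi x1.
have ck : cos (acos x) = x by rewrite acosK // in_itv.
have sk : sin (acos x) = Num.sqrt (y ^+ 2).
  by rewrite sin_acos //; congr Num.sqrt; lra.
rewrite sqrtr_sqr in sk.
have [y0|y0] := leP 0 y.
  exists (acos x); first by have := pi_gt0 R; lra.
  by rewrite sk ger0_norm.
have c0 : acos x != 0.
  by apply: contraTneq y0 => c0; move: sk; rewrite c0 sin0 => /esym/normr0P/eqP ->; rewrite ltxx.
exists (2 * pi - acos x); first by lra.
have -> : 2 * pi - acos x = - acos x + pi *+ 2 by rewrite mulr2n; lra.
by rewrite cosD2pi sinD2pi cosN sinN sk ler0_norm; lra.
Qed.

(** The window of angles starts anywhere, because the fan of triangles used for the area starts at
    an arbitrary contact angle. A rotation by [- a0] reduces to [direction_arg]. *)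
Lemma polar_decomposition (R : realType) (x : plane R) (a0 : R) :
  exists2 a, a0 <= a < a0 + 2 * pi & x = enorm x *: direction a.
Proof.
have [x0|x0] := eqVneq (enorm x) 0.
  exists a0; first by have := pi_gt0 R; lra.
  have := enormE x; rewrite x0 /dot; case: x {x0} => x y /= E.
  rewrite scale0r; congr pair; nra.
have r0 : 0 < enorm x by rewrite lt_def x0 enorm_ge0.
pose s := x.1 / enorm x * cos a0 + x.2 / enorm x * sin a0.
pose t := x.2 / enorm x * cos a0 - x.1 / enorm x * sin a0.
have C := cos2Dsin2 a0.
have E : (x.1 / enorm x) ^+ 2 + (x.2 / enorm x) ^+ 2 = 1.
  have := enormE x; rewrite /dot => H.
  by apply/eqP; rewrite !expr_div_n -mulrDl !expr2 -H -expr2 divff // expf_neq0.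
have [|a ai [ca sa]] := @direction_arg R s t.
  transitivity (((x.1 / enorm x) ^+ 2 + (x.2 / enorm x) ^+ 2) * (cos a0 ^+ 2 + sin a0 ^+ 2)).
    by rewrite /s /t; ring.
  by rewrite E C mulr1.
exists (a0 + a); first by lra.
rewrite /direction cosD sinD ca sa /s /t.
have -> : cos a0 * (x.1 / enorm x * cos a0 + x.2 / enorm x * sin a0) -
   sin a0 * (x.2 / enorm x * cos a0 - x.1 / enorm x * sin a0) = x.1 / enorm x * (cos a0 ^+ 2 + sin a0 ^+ 2) by ring.
have -> : sin a0 * (x.1 / enorm x * cos a0 + x.2 / enorm x * sin a0) +
    cos a0 * (x.2 / enorm x * cos a0 - x.1 / enorm x * sin a0) = x.2 / enorm x * (cos a0 ^+ 2 + sin a0 ^+ 2) by ring.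
by rewrite C !mulr1 [LHS]surjective_pairing; congr pair; rewrite /GRing.scale /= mulrC divfK.
Qed.

(** * Sums over equally spaced directions *)

Lemma periodic_sum_shift (V : zmodType) (a : nat -> V) (N : nat) (j : nat) :
  (forall m, a (m + N)%N = a m) -> \sum_(m < N) a (m + j)%N = \sum_(m < N) a m.
Proof.
move=> P; elim: j => [|j IH]; first by apply: eq_bigr => i _; rewrite addn0.
rewrite -IH; case: N P {IH} => [|N] P; first by rewrite !big_ord0.
rewrite big_ord_recr [RHS]big_ord_recl /= addrC; congr (_ + _).
  by rewrite add0n -(P j); congr a; lia.
by apply: eq_bigr => i _; congr a; rewrite /bump /=; lia.
Qed.

Lemma sum_cos_arith (R : realType) (n : nat) (d : R) :
  2 * sin (d / 2) * \sum_(m < n) cos (m%:R * d) = sin ((n%:R - 1 / 2) * d) + sin (d / 2).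
Proof.
elim: n => [|n IH].
  by rewrite big_ord0 mulr0 (_ : _ * d = - (d / 2)) ?sinN; lra.
rewrite big_ord_recr /= mulrDr IH.
have -> : (n.+1%:R - 1 / 2) * d = n%:R * d + d / 2 by rewrite -natr1; lra.
have -> : (n%:R - 1 / 2) * d = n%:R * d - d / 2 by lra.
by rewrite sinB sinD; ring.
Qed.

Lemma sum_sin_arith (R : realType) (n : nat) (d : R) :
  2 * sin (d / 2) * \sum_(m < n) sin (m%:R * d) = cos (d / 2) - cos ((n%:R - 1 / 2) * d).
Proof.
elim: n => [|n IH].
  by rewrite big_ord0 mulr0 (_ : (_ - _) * d = - (d / 2)) ?cosN; lra.
rewrite big_ord_recr /= mulrDr IH.
have -> : (n.+1%:R - 1 / 2) * d = n%:R * d + d / 2 by rewrite -natr1; lra.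
have -> : (n%:R - 1 / 2) * d = n%:R * d - d / 2 by lra.
by rewrite cosB cosD; ring.
Qed.

(** Discrete form of the fact that the integral of |cos| over a period is 4. As [L * d = pi / 2],
    the sum splits into four quarters, which reduce alternately to sums of cosines and of sines over
    the first quarter. *)
Lemma sum_norm_cos_grid (R : realType) (L : nat) (d : R) : (0 < L)%N -> d = pi / (2 * L%:R) ->
  sin (d / 2) * \sum_(m < 4 * L) `|cos (m%:R * d)| = 2 * cos (d / 2).
Proof.
move=> L0 dE; have L0' : 0 < L%:R :> R by rewrite ltr0n.
have pi0 := pi_gt0 R.
have Ld : L%:R * d = pi / 2 by rewrite dE; field; lra.
have d0 : 0 < d by rewrite dE divr_gt0 //; lra.
pose a (k : nat) : R := `|cos (k%:R * d)|.
have S0 : \sum_(m < L) a m = \sum_(m < L) cos (m%:R * d).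
  apply: eq_bigr => m _; rewrite /a ger0_norm //.
  apply: cos_ge0_pihalf; rewrite -Ld; apply/andP; split.
    by apply: (@le_trans _ _ 0); [nra|rewrite mulr_ge0 ?ler0n // ltW].
  by rewrite ler_pM2r // ler_nat ltnW.
have S1 : \sum_(m < L) a (m + L)%N = \sum_(m < L) sin (m%:R * d).
  apply: eq_bigr => m _; rewrite /a natrD mulrDl Ld cosDpihalf normrN ger0_norm //.
  apply: sin_ge0_pi; apply/andP; split; first by rewrite mulr_ge0 ?ler0n // ltW.
  have : m%:R * d <= L%:R * d by rewrite ler_pM2r // ler_nat ltnW.
  by rewrite Ld; lra.
have P : forall k, a (k + 2 * L)%N = a k.
  move=> k; rewrite /a natrD mulrDl.
  have -> : (2 * L)%:R * d = pi by rewrite natrM -mulrA Ld; lra.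
  by rewrite cosDpi normrN.
have E : \sum_(m < 4 * L) a m = 2 * (\sum_(m < L) cos (m%:R * d) + \sum_(m < L) sin (m%:R * d)).
  rewrite -S0 -S1.
  have split2 n k : \sum_(m < n + k) a m = \sum_(m < n) a m + \sum_(m < k) a (m + n)%N.
    by rewrite big_split_ord /=; congr (_ + _); apply: eq_bigr => i _; rewrite addnC.
  have -> : (4 * L = (L + L) + (L + L))%N by lia.
  rewrite split2 (split2 L L).
  have -> : \sum_(m < L + L) a (m + (L + L))%N = \sum_(m < L + L) a m.
    by apply: eq_bigr => i _; rewrite -[RHS]P; congr a; lia.
  by rewrite (split2 L L); ring.
rewrite -/(a _) E.
have := sum_cos_arith L d; have := sum_sin_arith L d.
have -> : (L%:R - 1 / 2) * d = pi / 2 - d / 2 by rewrite mulrBl Ld; lra.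
rewrite sinB cosB sin_pihalf cos_pihalf; lra.
Qed.

Definition grid {R : realType} (N m : nat) : plane R := direction (m%:R * (2 * pi / N%:R)).

Lemma grid_periodic (R : realType) (N m : nat) : (0 < N)%N -> @grid R N (m + N) = grid N m.
Proof.
move=> N0; rewrite /grid natrD mulrDl.
have -> : N%:R * (2 * pi / N%:R) = pi *+ 2 :> R.
  by field; rewrite pnatr_eq0 -lt0n.
by rewrite /direction cosD2pi sinD2pi.
Qed.

Lemma dot_direction_sub (R : realType) (a b : R) : dot (direction a) (direction b) = cos (a - b).
Proof. by rewrite /dot /= cosB. Qed.

(* The 4L directions see the length of e up to a relative error O(1/L): the sum
   is a rotation of the one for e parallel to the first direction, up to an
   angle at most [2 pi / (4 L)]. *)
Lemma sum_norm_dot_grid (R : realType) (L : nat) (e : plane R) (d : R) : (0 < L)%N ->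
  d = 2 * pi / (4 * L)%:R ->
  enorm e * (2 * cos (d / 2)) <=
   sin (d / 2) * \sum_(m < 4 * L) `|dot e (grid (4 * L) m)| + enorm e * (2 * pi * sin (d / 2)).
Proof.
move=> L0 dN; have L0' : 0 < L%:R :> R by rewrite ltr0n.
have pi0 := pi_gt0 R; set N := (4 * L)%N.
have N0 : 0 < N%:R :> R by rewrite ltr0n muln_gt0.
have Nd : N%:R * d = 2 * pi by rewrite dN -/N; field; lra.
have dE : d = pi / (2 * L%:R) by rewrite dN natrM; field; lra.
have d0 : 0 < d by rewrite dN divr_gt0 //; lra.
have s0 : 0 <= sin (d / 2).
  have : 1 <= L%:R :> R by rewrite ler1n.
  have : d * (2 * L%:R) = pi by rewrite dE; field; lra.
  by move=> *; apply: sin_ge0_pi; nra.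
have [a /andP[a0 a1] eE] := polar_decomposition e 0.
pose j := Num.truncn (a / d).
have ad0 : 0 <= a / d by rewrite divr_ge0 // ltW.
have /andP[j1 j2] := truncn_itv ad0.
rewrite -/j ler_pdivlMr // in j1; rewrite -/j ltr_pdivrMr // -natr1 in j2.
pose b := a - j%:R * d.
have -> : \sum_(m < N) `|dot e (grid N m)| = enorm e * \sum_(m < N) `|cos (m%:R * d - b)|.
  pose f m : R := `|cos (m%:R * d - a)|.
  have -> : \sum_(m < N) `|cos (m%:R * d - b)| = \sum_(m < N) f (m + j)%N.
    by apply: eq_bigr => m _; rewrite /f /b natrD; congr (`|cos _|); ring.
  rewrite periodic_sum_shift; last first.
    move=> m; rewrite /f natrD mulrDl Nd -addrA [2 * pi + _]addrC addrA.
    by rewrite (_ : 2 * pi = pi *+ 2) ?cosD2pi // mulr2n; lra.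
  rewrite mulr_sumr; apply: eq_bigr => m _.
  rewrite /f -cosN opprB -dot_direction_sub -[X in X * _]ger0_norm ?enorm_ge0 // -normrM.
  congr `|_|; rewrite {1}eE /dot /= /GRing.scale /=.
  by rewrite /grid /= -/N -dN; ring.
(* The residual angle [b] lies in [[0, d)], so each term moves by at most [d] and the whole sum by
   at most [N * d = 2 * pi]. *)
have B m : `|cos (m%:R * d)| - d <= `|cos (m%:R * d - b)|.
  have : `|cos (m%:R * d) - cos (m%:R * d - b)| <= d.
    have -> : cos (m%:R * d) - cos (m%:R * d - b) =
        - 2 * sin (m%:R * d - b / 2) * sin (b / 2).
      have -> : m%:R * d = (m%:R * d - b / 2) + b / 2 by lra.
      have -> : m%:R * d - b / 2 + b / 2 - b = (m%:R * d - b / 2) - b / 2 by lra.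
      by rewrite addrK cosB cosD; ring.
    rewrite !normrM normrN (ger0_norm (_ : 0 <= 2)) //.
    have := normr_sin_le (b / 2); rewrite (ger0_norm (_ : 0 <= b / 2)); last by rewrite /b; lra.
    have := sin_max (m%:R * d - b / 2); have := normr_ge0 (sin (m%:R * d - b / 2)).
    have := normr_ge0 (sin (b / 2)); have : b <= d by rewrite /b; lra.
    by nra.
  have := lerB_dist (cos (m%:R * d)) (cos (m%:R * d - b)); lra.
have {}B : \sum_(m < N) `|cos (m%:R * d)| - 2 * pi <= \sum_(m < N) `|cos (m%:R * d - b)|.
  apply: le_trans (ler_sum _ (fun (m : 'I_N) _ => B m)).
  by rewrite sumrB sumr_const card_ord -[d *+ N]mulr_natl Nd.
have := sum_norm_cos_grid L0 dE; rewrite -/N => <-.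
have e0 := enorm_ge0 e; have es := mulr_ge0 e0 s0.
by have := ler_wpM2l es B; lra.
Qed.

(** * The length of a convex polygon and its support numbers *)

Definition convex_order {R : realType} (n : nat) (p : nat -> plane R) : Prop :=
  forall i j k, (i < j)%N -> (j < k)%N -> (k < n)%N -> 0 < orient (p i) (p j) (p k).

Lemma orient_cycle (R : realType) (a b c : plane R) : orient a b c = orient b c a.
Proof. by rewrite /orient /=; ring. Qed.

Lemma convex_order_rotate (R : realType) (n m : nat) (p : nat -> plane R) :
  (m < n)%N -> convex_order n p -> convex_order n (fun i => p ((m + i) %% n)%N).
Proof.
move=> mn cp i j k ij jk kn.
have M (x : nat) : (x < n)%N -> ((m + x) %% n = if m + x < n then m + x else m + x - n)%N.
  move=> xn; case: ltnP => H; first exact: modn_small.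
  by rewrite -{1}(subnK H) modnDr modn_small; lia.
have [jn iln] : (j < n)%N /\ (i < n)%N by lia.
rewrite (M i) // (M j) // (M k) // => {M}.
case: (ltnP (m + i) n) => Hi; case: (ltnP (m + j) n) => Hj; case: (ltnP (m + k) n) => Hk.
all: try lia.
- by apply: cp; lia.
- by rewrite 2!orient_cycle; apply: cp; lia.
- by rewrite orient_cycle; apply: cp; lia.
- by apply: cp; lia.
Qed.

(* The diagonals [a c] and [b d] of a convex quadrilateral cross, so a linear
   form cannot be smaller at [a] and [c] than at [b] and [d]. *)
Lemma crossing_diagonals (R : realType) (a b c d u : plane R) :
  0 < orient a b c -> 0 < orient a b d -> 0 < orient a c d -> 0 < orient b c d ->
  dot a u <= dot c u -> dot c u < dot b u -> dot c u < dot d u -> False.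
Proof.
move=> abc abd acd bcd ac cb cd.
have E : orient b c d * (dot a u - dot c u) =
         orient a c d * (dot b u - dot c u) + orient a b c * (dot d u - dot c u).
  by rewrite /orient /dot /=; ring.
have : 0 < orient a c d * (dot b u - dot c u) by rewrite mulr_gt0 // subr_gt0.
have : 0 < orient a b c * (dot d u - dot c u) by rewrite mulr_gt0 // subr_gt0.
have : 0 <= orient b c d * (dot c u - dot a u) by apply: mulr_ge0; [exact: ltW|rewrite subr_ge0].
by lra.
Qed.

Lemma sum_norm_unimodal (R : realType) (a : nat -> R) (M n : nat) : (M <= n)%N ->
  (forall i, (i < M)%N -> a i <= a i.+1) ->
  (forall i, (M <= i < n)%N -> a i.+1 <= a i) ->
  \sum_(i < n) `|a i.+1 - a i| = 2 * a M - a 0%N - a n.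
Proof.
move=> Mn up dn.
have H1 k : (k <= M)%N -> \sum_(i < k) `|a i.+1 - a i| = a k - a 0%N.
  elim: k => [|k IH] kM; first by rewrite big_ord0 subrr.
  by rewrite big_ord_recr /= IH 1?ltnW // ger0_norm ?subr_ge0 ?up //; ring.
have H2 k : (M + k <= n)%N -> \sum_(i < M + k) `|a i.+1 - a i| = 2 * a M - a 0%N - a (M + k)%N.
  elim: k => [|k IH] kM; first by rewrite addn0 H1 //; ring.
  rewrite addnS big_ord_recr /= IH; last by lia.
  by rewrite ler0_norm ?subr_le0 ?dn //; [ring|lia].
by have := H2 (n - M)%N; rewrite subnKC // => /(_ (leqnn _)).
Qed.

(** Started at a vertex minimising the linear form, the values along a convex polygon rise to the
    maximum and then fall, so the total variation is twice the range. A wrong step would give two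
    crossing diagonals with the form smaller at both ends of one of them than at both ends of the
    other. *)
Lemma convex_order_variation (R : realType) (n : nat) (p : nat -> plane R) (u : plane R) (lo hi : R) :
  (0 < n)%N -> convex_order n p ->
  (forall i, (i < n)%N -> lo <= dot (p i) u <= hi) ->
  \sum_(i < n) `|dot (p (i.+1 %% n)%N - p i) u| <= 2 * (hi - lo).
Proof.
move=> n0 cp B.
pose i0 := Ordinal n0.
pose m := [arg min_(i < i0) dot (p i) u]%O.
have mmin i : (i < n)%N -> dot (p m) u <= dot (p i) u.
  by move=> ilt; rewrite /m; case: arg_minP => // j _ /(_ (Ordinal ilt) isT).
pose q i := p ((m + i) %% n)%N.
have cq : convex_order n q by exact: convex_order_rotate.
pose a i := dot (q i) u.
have qn i : (q (i + n) = q i)%N by rewrite /q addnA modnDr.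
have -> : \sum_(i < n) `|dot (p (i.+1 %% n)%N - p i) u| = \sum_(i < n) `|a i.+1 - a i|.
  pose f i := `|dot (p (i.+1 %% n)%N) u - dot (p (i %% n)%N) u|.
  transitivity (\sum_(i < n) f (i + m)%N).
    rewrite periodic_sum_shift; last first.
      by move=> i; rewrite /f -addSn !modnDr.
    by apply: eq_bigr => i _; rewrite /f [in X in _ = `|_ - dot (p X) u|]modn_small //; congr `|_|;
      rewrite /dot /=; ring.
  by apply: eq_bigr => i _; rewrite /f /a /q addnS addnC.
have amin i : (i < n)%N -> a 0%N <= a i.
  by move=> iltn; rewrite /a /q addn0 modn_small // mmin // ltn_mod.
pose M := [arg max_(i > i0) a i]%O.
have amax i : (i < n)%N -> a i <= a M.
  by move=> ilt; rewrite /M; case: arg_maxP => // j _ /(_ (Ordinal ilt) isT).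
have an : a n = a 0%N by rewrite /a -{1}(add0n n) qn.
rewrite (@sum_norm_unimodal _ a M).
- rewrite an; have /andP[_] := B ((m + M) %% n)%N (ltn_pmod _ n0).
  have /andP[+ _] := B ((m + 0) %% n)%N (ltn_pmod _ n0).
  by rewrite -/(q _) -/(q M) -/(a _) -/(a M); lra.
- exact: ltnW.
- move=> i iM; have Mn := ltn_ord M.
  have [->|i1] := posnP i; first by apply: amin; lia.
  have [->|i2] := eqVneq i.+1 M; first by apply: amax; lia.
  rewrite leNgt; apply/negP => H.
  have [H1 H2 H3] : [/\ (i.+1 < M)%N, (i < n)%N & (i.+1 < n)%N] by split; lia.
  apply: (@crossing_diagonals R (q 0%N) (q i) (q i.+1) (q M) u); rewrite -?/(a _) //.
  all: try by apply: cq; lia.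
  + exact: amin.
  + by apply: lt_le_trans H _; apply: amax.
- move=> i /andP[Mi iltn].
  have [->|i1] := eqVneq i M; first by have [E|] := eqVneq M.+1 n; [rewrite E an amin|move=> ?; apply: amax; have := ltn_ord M; lia].
  have [E|i2] := eqVneq i.+1 n; first by rewrite E an amin.
  (* [crossing_diagonals] needs [q 0] and [q M] to be different vertices; a maximum at index 0,
     where the minimum is, makes the form constant. *)
  have [M0|M0] := posnP M.
    have a0 j : (j < n)%N -> a j = a 0%N.
      by move=> jn; apply/eqP; rewrite eq_le amin // andbT; have := amax j jn; rewrite M0.
    by rewrite !a0 //; lia.
  rewrite leNgt; apply/negP => H.
  have [H1 H2 H3] : [/\ (M < i)%N, (i < n)%N & (i.+1 < n)%N] by split; lia.
  apply: (@crossing_diagonals R (q 0%N) (q M) (q i) (q i.+1) u); rewrite -?/(a _) //.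
  all: try by apply: cq; lia.
  + exact: amin.
  + by apply: lt_le_trans H _; apply: amax.
Qed.

Lemma grid_antipodal (R : realType) (L m : nat) : (0 < L)%N ->
  @grid R (4 * L) (m + 2 * L) = - grid (4 * L) m.
Proof.
move=> L0; rewrite /grid natrD mulrDl !natrM.
have -> : 2 * L%:R * (2 * pi / (4 * L%:R)) = pi :> R.
  by field; rewrite pnatr_eq0 -lt0n.
by rewrite /direction cosDpi sinDpi.
Qed.

(** Cauchy's formula: once the sums over edges and directions are exchanged, direction [m]
    contributes at most twice the width [h m + h (m + 2 * L)], and a shift by half a turn identifies
    the sums of the two terms. *)
Lemma polygon_length_le_support (R : realType) (L n : nat) (p : nat -> plane R) (h : nat -> R) (d : R) :
  (0 < L)%N -> d = 2 * pi / (4 * L)%:R -> (0 < n)%N -> convex_order n p ->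
  (forall m, h (m + 4 * L)%N = h m) ->
  (forall i m, (i < n)%N -> dot (p i) (grid (4 * L) m) <= h m) ->
  2^-1 * polygon_length n p * (cos (d / 2) - pi * sin (d / 2)) <= sin (d / 2) * \sum_(m < 4 * L) h m.
Proof.
move=> L0 dN n0 cp hN hp; set N := (4 * L)%N in dN hN hp *.
have pi0 := pi_gt0 R.
have s0 : 0 <= sin (d / 2).
  have L1 : 1 <= L%:R :> R by rewrite ler1n.
  have : d * (4 * L%:R) = 2 * pi by rewrite dN natrM; field; lra.
  by move=> *; apply: sin_ge0_pi; nra.
have H1 : polygon_length n p * (2 * cos (d / 2) - 2 * pi * sin (d / 2)) <=
  sin (d / 2) * \sum_(m < N) \sum_(i < n) `|dot (p (i.+1 %% n)%N - p i) (grid N m)|.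
  rewrite exchange_big /= /polygon_length mulr_suml mulr_sumr; apply: ler_sum => i _.
  by have := sum_norm_dot_grid (p (i.+1 %% n)%N - p i) L0 dN; rewrite -/N; lra.
have H2 : \sum_(m < N) \sum_(i < n) `|dot (p (i.+1 %% n)%N - p i) (grid N m)| <=
   \sum_(m < N) (2 * h m + 2 * h (m + 2 * L)%N).
  apply: ler_sum => m _.
  have -> : 2 * h m + 2 * h (m + 2 * L)%N = 2 * (h m - (- h (m + 2 * L)%N)) by ring.
  apply: convex_order_variation => // i ilt; rewrite hp // andbT.
  by have := hp i (m + 2 * L)%N ilt; rewrite grid_antipodal // /dot /=; lra.
have H3 : \sum_(m < N) (2 * h m + 2 * h (m + 2 * L)%N) = 4 * \sum_(m < N) h m.
  rewrite big_split /= -!mulr_sumr periodic_sum_shift //; ring.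
by have := ler_wpM2l s0 H2; rewrite H3; lra.
Qed.

(** * Area of linear images, triangles and open sets *)

(** The same points as [plane R], with the measurable structure of the product instead of the
    topology. *)
Notation mplane R := (measurableTypeR R * measurableTypeR R)%type.

Lemma measurable_affine (R : realType) (k b : R) :
  measurable_fun [set: measurableTypeR R] ((fun y : R => k * y + b) : measurableTypeR R -> measurableTypeR R).
Proof.
apply: measurable_realfun.measurable_funD => //; exact: measurable_realfun.measurable_funM.
Qed.

(** By uniqueness of Lebesgue measure it suffices to compare both sides on half-open intervals. For
    [k < 0] the preimage is half-open at the other end, with the same length. *)
Lemma lebesgue_measure_affine_preimage (R : realType) (k b : R) (A : set R) :
  k != 0 -> measurable (A : set (measurableTypeR R)) ->
  (lebesgue_measure A = `|k|%:E * lebesgue_measure ((fun y => k * y + b)%R @^-1` A))%E.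
Proof.
move=> k0 mA.
have kn : (0 <= `|k|)%R by [].
pose f : measurableTypeR R -> measurableTypeR R := fun y => k * y + b.
have mf : measurable_fun [set: measurableTypeR R] f by exact: measurable_affine.
have [mu muE] : exists mu : {measure set (measurableTypeR R) -> \bar R},
    forall X, mu X = lebesgue_measure (f @^-1` X).
  by unshelve eexists; [refine (pushforward (@lebesgue_measure R) f : {measure set _ -> \bar R})|].
rewrite -muE -/(mscale (NngNum kn) mu A).
apply: lebesgue_measure_unique => //= _ [[a c]] _ <-.
rewrite /mscale muE /=.
have [k1|k1] := ltP 0 k.
  have -> : f @^-1` `]a, c] = `](a - b) / k, (c - b) / k]%classic.
    by apply/seteqP; split => x /=; rewrite !in_itv /= /f ltr_pdivrMr // ler_pdivlMr //; lra.
  rewrite !lebesgue_measure_itv /= !lte_fin ltr_pM2r ?invr_gt0 // ltrD2r.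
  case: ifP => _; last by rewrite mule0.
  by rewrite -!EFinB -EFinM; congr EFin; rewrite gtr0_norm //; field.
have {}k1 : k < 0 by rewrite lt_def k1 eq_sym k0.
have -> : f @^-1` `]a, c] = `[(c - b) / k, (a - b) / k[%classic.
  by apply/seteqP; split => x /=; rewrite !in_itv /= /f ltr_ndivlMr // ler_ndivrMr //; lra.
rewrite !lebesgue_measure_itv /= !lte_fin ltr_nM2r ?invr_lt0 // ltrD2r.
case: ifP => _; last by rewrite mule0.
by rewrite -!EFinB -EFinM; congr EFin; rewrite ltr0_norm //; field.
Qed.

Lemma product_lebesgueE (R : realType) (A : set (mplane R)) : measurable A ->
  (@lebesgue_measure R \x @lebesgue_measure R)%E A = (@lebesgue_measure R \x^ @lebesgue_measure R)%E A.
Proof. by apply: product_measure_unique => //= ? ? ? ?; rewrite product_measure2E. Qed.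

Lemma measurable_linear_form (R : realType) (a b : R) :
  measurable_fun [set: mplane R] (fun x : mplane R => a * x.1 + b * x.2 : measurableTypeR R).
Proof.
by apply: measurable_realfun.measurable_funD; apply: measurable_realfun.measurable_funM.
Qed.

Lemma measurable_linear_map (R : realType) (a b c d : R) :
  measurable_fun [set: mplane R] (fun x : mplane R => (a * x.1 + b * x.2, c * x.1 + d * x.2) : mplane R).
Proof. by apply/measurable_fun_pairP; split; exact: measurable_linear_form. Qed.

Lemma measurable_preimage_linear (R : realType) (a b c d : R) (A : set (mplane R)) : measurable A ->
  measurable ((fun x : mplane R => (a * x.1 + b * x.2, c * x.1 + d * x.2) : mplane R) @^-1` A).
Proof. by move=> mA; rewrite -[X in measurable X]setTI; exact: measurable_linear_map. Qed.

Lemma area_shear2 (R : realType) (c k : R) (A : set (mplane R)) : k != 0 -> measurable A ->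
  (area A = `|k|%:E * area ((fun x : plane R => (1 * x.1 + 0 * x.2, c * x.1 + k * x.2)%R) @^-1` A))%E.
Proof.
move=> k0 mA; rewrite /area /product_measure1.
have mB := measurable_preimage_linear 1 0 c k mA.
rewrite -ge0_integralZl //=; last exact: measurable_fun_xsection mB.
apply: eq_integral => x _ /=.
rewrite (lebesgue_measure_affine_preimage (c * x) k0); last exact: measurable_xsection.
congr (_ * lebesgue_measure _)%E; apply/seteqP; split => y;
  by rewrite /= /xsection /= !inE /= mul1r mul0r addr0 addrC.
Qed.

Lemma area_shear1 (R : realType) (c k : R) (A : set (mplane R)) : k != 0 -> measurable A ->
  (area A = `|k|%:E * area ((fun x : plane R => (k * x.1 + c * x.2, 0 * x.1 + 1 * x.2)%R) @^-1` A))%E.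
Proof.
move=> k0 mA; have mB := measurable_preimage_linear k c 0 1 mA.
rewrite /area !product_lebesgueE // /product_measure2.
rewrite -ge0_integralZl //=; last exact: measurable_fun_ysection mB.
apply: eq_integral => x _ /=.
rewrite (lebesgue_measure_affine_preimage (c * x) k0); last exact: measurable_ysection.
congr (_ * lebesgue_measure _)%E; apply/seteqP; split => y;
  by rewrite /= /ysection /= !inE /= mul1r mul0r add0r.
Qed.

(** For [d != 0] the matrix is a product of two maps that change one coordinate each, and each is
    handled by slicing. If [d = 0], adding the first column to the second puts [c] in the corner,
    which is nonzero since the determinant is. *)
Lemma area_linear_preimage (R : realType) (a b c d : R) (A : set (mplane R)) :
  a * d - b * c != 0 -> measurable A ->
  (area A = `|a * d - b * c|%:E * area ((fun x : plane R => (a * x.1 + b * x.2, c * x.1 + d * x.2)%R) @^-1` A))%E.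
Proof.
wlog d0 : b d / d != 0.
  move=> H D0 mA; have [d0|] := eqVneq d 0; last by move=> ?; exact: H.
  have c0 : c != 0 by apply: contraNneq D0 => ->; rewrite d0 !mulr0 subrr.
  have D : a * (c + d) - (a + b) * c = a * d - b * c by ring.
  have cd0 : c + d != 0 by rewrite d0 addr0.
  rewrite -{1}D (H (a + b) (c + d) cd0 _ mA); last by rewrite D.
  have mB := measurable_preimage_linear a (a + b) c (c + d) mA.
  rewrite D; congr (_ * _)%E; apply: etrans (area_shear1 (-1) (oner_neq0 R) mB) _.
  transitivity (area (((fun x : plane R => (a * x.1 + (a + b) * x.2, c * x.1 + (c + d) * x.2)%R) \o
    (fun x : plane R => (1 * x.1 + (-1) * x.2, 0 * x.1 + 1 * x.2)%R)) @^-1` A)).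
    by rewrite normr1 mul1e.
  rewrite [X in X @^-1` _](_ : _ = fun x : plane R => (a * x.1 + b * x.2, c * x.1 + d * x.2)) //.
  by apply/funext => x /=; congr pair; ring.
move=> D0 mA.
pose k := (a * d - b * c) / d.
have k0 : k != 0 by rewrite mulf_neq0 ?invr_eq0.
have mB := measurable_preimage_linear k (b / d) 0 1 mA.
rewrite (area_shear1 (b / d) k0 mA).
transitivity (`|k|%:E * (`|d|%:E * area (((fun x : plane R => (k * x.1 + b / d * x.2, 0 * x.1 + 1 * x.2)%R) \o
  (fun x : plane R => (1 * x.1 + 0 * x.2, c * x.1 + d * x.2)%R)) @^-1` A)))%E.
  congr (_ * _)%E; exact: (area_shear2 c d0 mB).
have kd : k * d = a * d - b * c by exact: divfK.
rewrite (muleA `|k|%:E) -EFinM -normrM kd; congr (_ * _)%E.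
rewrite [X in X @^-1` _](_ : _ = fun x : plane R => (a * x.1 + b * x.2, c * x.1 + d * x.2)) //.
by apply/funext => x /=; rewrite /k; congr pair; [field|ring].
Qed.

Lemma integral_onem01 (R : realType) :
  (\int[@lebesgue_measure R]_(x in `[0%R, 1%R]) (1 - x)%:E = (1 / 2)%:E)%E.
Proof.
have D (x : R) : is_derive x 1 (id - (2^-1 \*: (id * id)) : R -> R) (1 - x).
  by apply: trigger_derive; rewrite /GRing.scale /=; field.
have C (x : R) : {for x, continuous (id - (2^-1 \*: (id * id)) : R -> R)}.
  by apply/differentiable_continuous/derivable1_diffP; have [] := D x.
rewrite (@continuous_FTC2 _ _ (id - (2^-1 \*: (id * id)))) //.
- by rewrite -EFinB; congr EFin; rewrite !fctE /= /GRing.scale /=; field.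
- apply: continuous_subspaceT => x.
  by apply: cvgB; [exact: cvg_cst|exact: cvg_id].
- split.
  + by move=> x _; have [] := D x.
  + exact/cvg_at_right_filter/C.
  + exact/cvg_at_left_filter/C.
- by move=> x _; rewrite derive1E; have [_ ->] := D x.
Qed.

Definition corner_triangle {R : realType} : set (mplane R) :=
  [set x : plane R | [/\ 0 <= x.1, 0 < x.2 & x.1 + x.2 <= 1]].

Lemma measurable_corner_triangle (R : realType) : measurable (@corner_triangle R).
Proof.
have mH (a b : R) (i : interval R) : measurable [set x : mplane R | a * x.1 + b * x.2 \in i].
  by have := measurable_linear_form a b measurableT (measurable_itv i); rewrite setTI.
rewrite [corner_triangle](_ : _ = [set x : mplane R | (1 : R) * x.1 + (0 : R) * x.2 \in `[0%R, +oo[ ] `&`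
  ([set x : mplane R | (0 : R) * x.1 + (1 : R) * x.2 \in `]0%R, +oo[ ] `&`
   [set x : mplane R | (1 : R) * x.1 + (1 : R) * x.2 \in `]-oo, 1%R] ])).
  apply: measurableI; first exact: mH.
  apply: measurableI; exact: mH.
apply/seteqP; split => -[x y] /=; rewrite /corner_triangle /= !in_itv /= !mul1r !mul0r addr0 add0r !andbT.
  by case.
by case => ? [].
Qed.

Lemma area_corner_triangle (R : realType) : area (@corner_triangle R) = (1 / 2)%:E.
Proof.
rewrite /area /product_measure1 -integral_onem01 [RHS]integral_mkcond.
apply: eq_integral => x _ /=; rewrite patchE mem_setE in_itv /=.
case: ifP => [/andP[x0 x1]|x01].
  rewrite (_ : xsection _ x = `]0, 1 - x]%classic).
    by rewrite lebesgue_measure_itv /= lte_fin; case: ltP => [_|H]; rewrite ?sube0 //; congr EFin; lra.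
  apply/seteqP; split => y /=; rewrite in_itv /= /xsection /= inE /corner_triangle /=.
    by case=> *; lra.
  by move=> H; split; lra.
rewrite (_ : xsection _ x = set0) ?measure0 //.
apply/seteqP; split => y //=; rewrite /xsection /= !inE /corner_triangle /=.
by case=> *; move/negP: x01; apply; lra.
Qed.

(** The triangle with vertices 0, [a], [b] without its side from 0 to [b]: consecutive triangles of
    a fan are then exactly disjoint, and no null sets have to be discarded. *)
Definition half_open_triangle {R : realType} (a b : plane R) : set (mplane R) :=
  [set x : plane R | [/\ 0 <= det a x, 0 < det x b & det a x + det x b <= det a b]].

Lemma half_open_triangleE (R : realType) (a b : plane R) : 0 < det a b ->
  half_open_triangle a b =
  (fun x : plane R => (- a.2 / det a b * x.1 + a.1 / det a b * x.2,
                       b.2 / det a b * x.1 + - b.1 / det a b * x.2)) @^-1` corner_triangle.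
Proof.
move=> D0.
have E1 x : - a.2 / det a b * x.1 + a.1 / det a b * x.2 = det a x / det a b.
  by rewrite /det; field; rewrite -/(det a b) gt_eqF.
have E2 x : b.2 / det a b * x.1 + - b.1 / det a b * x.2 = det x b / det a b.
  by rewrite /det; field; rewrite -/(det a b) gt_eqF.
apply/seteqP; split => x; rewrite /corner_triangle /half_open_triangle /= E1 E2 -mulrDl.
  by case=> h1 h2 h3; split; rewrite ?divr_ge0 ?divr_gt0 ?ler_pdivrMr ?mul1r // ltW.
rewrite pmulr_lge0 ?pmulr_lgt0 ?invr_gt0 // ler_pdivrMr // mul1r.
by case.
Qed.

Lemma measurable_half_open_triangle (R : realType) (a b : plane R) : 0 < det a b ->
  measurable (half_open_triangle a b).
Proof.
move=> D0; rewrite half_open_triangleE //.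
exact: (measurable_preimage_linear (- a.2 / det a b) (a.1 / det a b) (b.2 / det a b) (- b.1 / det a b)
  (@measurable_corner_triangle R)).
Qed.

Lemma area_half_open_triangle (R : realType) (a b : plane R) : 0 < det a b ->
  area (half_open_triangle a b) = (det a b / 2)%:E.
Proof.
move=> D0; rewrite half_open_triangleE //.
have k0 : - a.2 / det a b * (- b.1 / det a b) - a.1 / det a b * (b.2 / det a b) = - (det a b)^-1.
  by rewrite /det; field; rewrite -/(det a b) gt_eqF.
have := @area_linear_preimage R (- a.2 / det a b) (a.1 / det a b) (b.2 / det a b) (- b.1 / det a b)
   _ _ (@measurable_corner_triangle R).
rewrite k0 oppr_eq0 invr_eq0 gt_eqF // => /(_ isT).
rewrite area_corner_triangle normrN gtr0_norm ?invr_gt0 //.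
move=> E; have := congr1 (fun z => (det a b)%:E * z)%E E.
rewrite muleA -!EFinM divff ?gt_eqF // mul1e => <-; congr EFin; lra.
Qed.

(** An open set is the union of the countably many rational boxes that it contains. *)
Lemma open_measurable_plane (R : realType) (A : set (plane R)) : open A -> measurable (A : set (mplane R)).
Proof.
move=> oA.
pose box (q : (rat * rat) * (rat * rat)) : set (mplane R) :=
  `]ratr q.1.1, ratr q.1.2[%classic `*` `]ratr q.2.1, ratr q.2.2[%classic.
pose B q : set (mplane R) := if `[< box q `<=` A >] then box q else set0.
have -> : A = \bigcup_q B q.
  apply/seteqP; split => [[x y] Axy|z [q _]]; last first.
    by rewrite /B; case: asboolP => // + Bz => /(_ _ Bz).
  have [[U V] [/= /nbhs_ballP [e /= e0 eU] /nbhs_ballP [f /= f0 fV]] UV] := open_nbhs_nbhs (conj oA Axy).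
  have [q1 /itvP q1e] := @rat_in_itvoo R (x - e) x ltac:(lra).
  have [q2 /itvP q2e] := @rat_in_itvoo R x (x + e) ltac:(lra).
  have [q3 /itvP q3e] := @rat_in_itvoo R (y - f) y ltac:(lra).
  have [q4 /itvP q4e] := @rat_in_itvoo R y (y + f) ltac:(lra).
  exists ((q1, q2), (q3, q4)) => //; rewrite /B; case: asboolP => [_|[]].
    by split => /=; rewrite in_itv /= ?q1e ?q2e ?q3e ?q4e.
  move=> [x' y'] [/= xI yI]; rewrite !in_itv /= in xI yI; apply: UV; split => /=.
    apply: eU; rewrite /ball /= ltr_norml; have := q1e; have := q2e; move=> H1 H2.
    have : x - e < ratr q1 by rewrite q1e. have : ratr q2 < x + e by rewrite q2e.
    by lra.
  apply: fV; rewrite /ball /= ltr_norml.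
  have : y - f < ratr q3 by rewrite q3e. have : ratr q4 < y + f by rewrite q4e.
  by lra.
apply: countable_bigcupT_measurable; first exact: countableP.
move=> q; rewrite /B; case: asboolP => _ //.
by apply: measurableX; exact: measurable_itv.
Qed.

Lemma closed_measurable_plane (R : realType) (A : set (plane R)) : closed A -> measurable (A : set (mplane R)).
Proof.
by move=> /closed_openC /open_measurable_plane /measurableC; rewrite setCK.
Qed.

(** * Fans of triangles around the origin *)

Lemma det_polar (R : realType) (r s a b : R) :
  det (r *: direction a) (s *: direction b) = r * s * sin (b - a).
Proof. by rewrite /det /= /GRing.scale /= sinB; ring. Qed.

Lemma sin_le0_piN (R : realType) (x : R) : - pi <= x <= 0 -> sin x <= 0.
Proof. by move=> H; rewrite -oppr_ge0 -sinN sin_ge0_pi; lra. Qed.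

Lemma sin_lt0_piN (R : realType) (x : R) : - pi < x < 0 -> sin x < 0.
Proof. by move=> H; rewrite -oppr_gt0 -sinN sin_gt0_pi; lra. Qed.

Lemma sin_add2pi (R : realType) (x : R) : sin (x + 2 * pi) = sin x.
Proof. by rewrite (_ : 2 * pi = pi *+ 2) ?sinD2pi // mulr2n; lra. Qed.

(** The signs of the two sines locate [p] only modulo [2 * pi]; the common window of length [2 * pi]
    removes the ambiguity. *)
Lemma mem_half_open_sector (R : realType) (a0 p a b : R) :
  a0 <= p < a0 + 2 * pi -> a0 <= a -> a <= b -> b < a + pi -> b <= a0 + 2 * pi ->
  0 <= sin (p - a) -> 0 < sin (b - p) -> a <= p < b.
Proof.
move=> /andP[p0 p1] a0a ab bpi b1 sa sb.
have pi0 := pi_gt0 R.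
have [ap|pa] := leP a p.
  rewrite ltNge /=; apply/negP => bp.
  have [H|H] := leP (p - a) pi.
    by have := @sin_le0_piN R (b - p); lra.
  have := @sin_lt0_piN R (p - a - 2 * pi).
  by rewrite -sin_add2pi subrK; lra.
have [H|H] := ltP (- pi) (p - a).
  by have := @sin_lt0_piN R (p - a); lra.
have := @sin_le0_piN R (b - p - 2 * pi).
by rewrite -sin_add2pi subrK; lra.
Qed.

Lemma half_open_triangle0 (R : realType) (a b : plane R) : det a b = 0 -> half_open_triangle a b = set0.
Proof. by move=> D; apply/seteqP; split => x //; case; rewrite D => *; lra. Qed.

(** The polar angle of a point of the triangle of index [m], taken in the window starting at [a 0],
    lies in [[a m, a m.+1)], and these intervals are disjoint. *)
Lemma trivIset_fan (R : realType) (N : nat) (x : nat -> plane R) (a r : nat -> R) :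
  (forall m, (m <= N)%N -> 0 < r m) ->
  (forall m, (m <= N)%N -> x m = r m *: direction (a m)) ->
  (forall m, (m < N)%N -> a m <= a m.+1 < a m + pi) ->
  a N = a 0%N + 2 * pi ->
  trivIset setT (fun m : 'I_N => half_open_triangle (x m) (x m.+1)).
Proof.
move=> r0 xE am aN.
have mono i j : (i <= j)%N -> (j <= N)%N -> a i <= a j.
  elim: j => [|j IH]; first by rewrite leqn0 => /eqP ->.
  rewrite leq_eqVlt => /predU1P[-> //|ij] jN.
  apply: le_trans (IH _ _) _ => //; first exact: ltnW.
  by have /andP[] := am j jN.
have loc (p s : R) (m : 'I_N) : a 0%N <= p < a 0%N + 2 * pi -> 0 <= s ->
    half_open_triangle (x m) (x m.+1) (s *: direction p) -> a m <= p < a m.+1.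
  move=> pI s0 [d1 d2 _]; have mN := ltn_ord m.
  have /andP[am1 am2] := am m mN.
  rewrite xE ?det_polar in d1; last exact: ltnW.
  rewrite xE // det_polar in d2.
  have rm := r0 m (ltnW mN); have rm1 := r0 m.+1 mN.
  have {}s0 : 0 < s by rewrite lt_def s0 andbT; apply: contraTneq d2 => ->; rewrite !mul0r ltxx.
  apply: mem_half_open_sector pI _ am1 am2 _ _ _.
  - by apply: mono => //; exact: ltnW.
  - by rewrite -aN; exact: mono.
  - by move: d1; rewrite pmulr_rge0 // mulr_gt0.
  - by move: d2; rewrite pmulr_rgt0 // mulr_gt0.
apply/trivIsetP => i j _ _ ij; apply/seteqP; split => // y [yi yj].
have [p pI yE] := polar_decomposition (y : plane R) (a 0%N).
rewrite yE in yi yj.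
have {}yi := loc _ _ _ pI (enorm_ge0 _) yi; have {}yj := loc _ _ _ pI (enorm_ge0 _) yj.
move: ij; rewrite -(inj_eq val_inj) /= neq_ltn => /orP[ij|ij].
  by have := mono i.+1 j ij (ltnW (ltn_ord j)); lra.
by have := mono j.+1 i ij (ltnW (ltn_ord i)); lra.
Qed.

(** Consecutive points may have the same polar angle, as when a vertex is the contact point of
    several directions. The determinant is then 0 and the half-open triangle is empty, so the
    formula persists. *)
Lemma area_ge_fan (R : realType) (N : nat) (x : nat -> plane R) (a r : nat -> R) (S : set (mplane R)) :
  measurable S ->
  (forall m, (m <= N)%N -> 0 < r m) ->
  (forall m, (m <= N)%N -> x m = r m *: direction (a m)) ->
  (forall m, (m < N)%N -> a m <= a m.+1 < a m + pi) ->
  a N = a 0%N + 2 * pi ->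
  (forall m, (m < N)%N -> half_open_triangle (x m) (x m.+1) `<=` S) ->
  ((\sum_(m < N) det (x m) (x m.+1) / 2)%:E <= area S)%E.
Proof.
move=> mS r0 xE am aN TS.
have D0 m : (m < N)%N -> 0 <= det (x m) (x m.+1).
  move=> mN; rewrite !xE //; last exact: ltnW.
  have rm := r0 m (ltnW mN); have rm1 := r0 m.+1 mN.
  rewrite det_polar; apply: mulr_ge0; first by rewrite ltW // mulr_gt0.
  by apply: sin_ge0_pi; have := am m mN; lra.
have mT (m : 'I_N) : measurable (half_open_triangle (x m) (x m.+1)).
  have := D0 m (ltn_ord m); rewrite le_eqVlt => /predU1P[/esym /half_open_triangle0 -> //|].
  exact: measurable_half_open_triangle.
have := measure_bigsetU_ord (@lebesgue_measure R \x @lebesgue_measure R)%E xpredT mT (trivIset_fan r0 xE am aN).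
rewrite (eq_bigr (fun m : 'I_N => (det (x m) (x m.+1) / 2)%:E)); last first.
  move=> m _; have := D0 m (ltn_ord m).
  rewrite le_eqVlt => /predU1P[/esym D|D]; last exact: area_half_open_triangle.
  by rewrite half_open_triangle0 // measure0 D mul0r.
rewrite sumEFin => <-; apply: le_measure; rewrite ?inE //.
  by apply: bigsetU_measurable => m _.
by rewrite -(bigcup_mkord N (fun m => half_open_triangle (x m) (x m.+1))) => y [m /= mN]; exact: TS.
Qed.

(** * The discrete functional *)

Lemma periodic_sumS (V : zmodType) (N : nat) (a : nat -> V) : (forall m, a (m + N)%N = a m) ->
  \sum_(m < N) a m.+1 = \sum_(m < N) a m.
Proof.
by move=> aN; rewrite -[RHS](@periodic_sum_shift _ a N 1) //; apply: eq_bigr => i _; rewrite addn1.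
Qed.

(* With f = h - 1/2, where h is the support function at N equally spaced
   directions, T = tan (pi / N) and s = sin (2 pi / N), this is half the
   perimeter minus the area of the circumscribed equiangular polygon. *)
Definition polygon_functional {R : realType} (N : nat) (s T : R) (f : nat -> R) : R :=
  T * \sum_(m < N) (1 / 4 - f m ^+ 2) + (2 * s)^-1 * \sum_(m < N) (f m.+1 - f m) ^+ 2.

(** As [T * s = 1 - c], the quadratic part has diagonal coefficient [c / s]. In this form a periodic
    [v] with [v m.+2 + v m = 2 * c * v m.+1] visibly pairs to zero with every periodic sequence,
    which gives the invariance under translations. *)
Lemma polygon_functionalE (R : realType) (N : nat) (c s T : R) (f : nat -> R) :
  s != 0 -> T * s = 1 - c -> (forall m, f (m + N)%N = f m) ->
  polygon_functional N s T f =
  T * \sum_(m < N) (1 / 4) + s^-1 * (c * \sum_(m < N) f m ^+ 2 - \sum_(m < N) f m * f m.+1).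
Proof.
move=> s0 Ts fN.
have T1 : T = s^-1 * (1 - c) by rewrite -Ts; field.
have S2 : \sum_(m < N) (f m.+1 - f m) ^+ 2 = 2 * \sum_(m < N) f m ^+ 2 - 2 * \sum_(m < N) f m * f m.+1.
  have E := @periodic_sumS R N (fun m => f m ^+ 2) (fun m => congr1 (fun x => x ^+ 2) (fN m)).
  rewrite (_ : \sum_(m < N) (f m.+1 - f m) ^+ 2 =
    \sum_(m < N) f m.+1 ^+ 2 + \sum_(m < N) f m ^+ 2 - 2 * \sum_(m < N) f m * f m.+1).
    by rewrite E; ring.
  by rewrite mulr_sumr -big_split /= -sumrB; apply: eq_bigr => m _; ring.
rewrite /polygon_functional S2 sumrB mulrBr {2}T1; field.
by apply/eqP => s0'; move/eqP: s0.
Qed.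

(* The circumscribed and the inscribed polygon differ by triangles with sides
   a_m, b_m along consecutive support lines. *)
Lemma contact_polygon_bound (R : realType) (N : nat) (c s T r : R) (h g : nat -> R) :
  0 < s -> c ^+ 2 + s ^+ 2 = 1 -> T * s = 1 - c -> 0 <= T <= 1 ->
  (forall m, h (m + N)%N = h m) -> (forall m, g (m + N)%N = g m) ->
  (forall m, 0 <= h m <= r) -> (forall m, - r <= g m <= r) ->
  (forall m, h m * c + g m * s <= h m.+1) ->
  (forall m, h m.+1 * c - g m.+1 * s <= h m) ->
  T * \sum_(m < N) h m -
    \sum_(m < N) ((h m * h m.+1 + g m * g m.+1) * s + (h m * g m.+1 - g m * h m.+1) * c) / 2 <=
  polygon_functional N s T (fun m => h m - 1 / 2) + 4 * r ^+ 2 * s * T * N%:R.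
Proof.
move=> s0 cs Ts /andP[T0 T1] hN gN hr gr H1 H2.
have s0' : s != 0 by rewrite gt_eqF.
have TE : T = s^-1 * (1 - c) by rewrite -Ts; field.
pose a m := (h m.+1 - h m * c) / s - g m.
pose b m := g m.+1 - (h m.+1 * c - h m) / s.
have a0 m : 0 <= a m by rewrite subr_ge0 ler_pdivlMr //; have := H1 m; lra.
have b0 m : 0 <= b m by rewrite subr_ge0 ler_pdivrMr //; have := H2 m; lra.
have r0 : 0 <= r by have := hr 0%N; lra.
have ab m : a m + b m = (h m + h m.+1) * T + (g m.+1 - g m) by rewrite /a /b TE; field.
have detE m : ((h m * h m.+1 + g m * g m.+1) * s + (h m * g m.+1 - g m * h m.+1) * c) / 2 =
   s^-1 * (h m * h m.+1) - s^-1 * c / 2 * (h m ^+ 2 + h m.+1 ^+ 2)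
   + (h m.+1 * g m.+1 - h m * g m) / 2 - s / 2 * (a m * b m).
  have -> : s ^-1 * (h m * h m.+1) = (c ^+ 2 + s ^+ 2) * (s^-1 * (h m * h m.+1)) by rewrite cs mul1r.
  have -> : h m.+1 * g m.+1 - h m * g m = (c ^+ 2 + s ^+ 2) * (h m.+1 * g m.+1 - h m * g m) by rewrite cs mul1r.
  have c2 : c ^+ 2 = 1 - s ^+ 2 by rewrite -cs addrK.
  rewrite /a /b; field: c2; exact: s0'.
pose f m := h m - 1 / 2.
have fN m : f (m + N)%N = f m by rewrite /f hN.
have -> : polygon_functional N s T f = T * \sum_(m < N) h m -
   \sum_(m < N) (s^-1 * (h m * h m.+1) - s^-1 * c / 2 * (h m ^+ 2 + h m.+1 ^+ 2)).
  rewrite (polygon_functionalE s0' Ts fN).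
  have E1 := @periodic_sumS R N (fun m => h m ^+ 2) (fun m => congr1 (fun x => x ^+ 2) (hN m)).
  have E2 := @periodic_sumS R N h hN.
  have F1 : \sum_(m < N) f m ^+ 2 = \sum_(m < N) h m ^+ 2 - \sum_(m < N) h m + \sum_(m < N) (1 / 4).
    by rewrite -sumrB -big_split; apply: eq_bigr => m _ /=; rewrite /f; field.
  have F2 : \sum_(m < N) f m * f m.+1 = \sum_(m < N) h m * h m.+1 - 2^-1 * \sum_(m < N) h m
      - 2^-1 * \sum_(m < N) h m.+1 + \sum_(m < N) (1 / 4).
    by rewrite !mulr_sumr -!sumrB -big_split; apply: eq_bigr => m _ /=; rewrite /f; field.
  rewrite F1 F2 E2 sumrB -!mulr_sumr big_split /= E1 TE; field.
  exact: s0'.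
have tel : \sum_(m < N) (h m.+1 * g m.+1 - h m * g m) = 0.
  rewrite sumrB (@periodic_sumS R N (fun m => h m * g m)) ?subrr // => m.
  by rewrite hN gN.
have -> : \sum_(m < N) ((h m * h m.+1 + g m * g m.+1) * s + (h m * g m.+1 - g m * h m.+1) * c) / 2 =
  \sum_(m < N) (s^-1 * (h m * h m.+1) - s^-1 * c / 2 * (h m ^+ 2 + h m.+1 ^+ 2)) - s / 2 * \sum_(m < N) a m * b m.
  rewrite (eq_bigr _ (fun (m : 'I_N) _ => detE m)) sumrB big_split /= -mulr_suml tel mul0r addr0.
  by rewrite mulr_sumr.
have E : \sum_(m < N) a m * b m <= \sum_(m < N) (4 * r * (a m + b m)).
  apply: ler_sum => m _.
  have : b m <= 4 * r by have := ab m; have := a0 m; have := hr m; have := hr m.+1; have := gr m; have := gr m.+1; nra.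
  by have := a0 m; have := b0 m; nra.
(* The differences of [g] telescope, so the sides [a m + b m] add up to [2 * T] times the sum of the
   [h m], as the perimeter of the circumscribed polygon does. *)
have F : \sum_(m < N) (4 * r * (a m + b m)) <= 8 * r ^+ 2 * T * N%:R.
  rewrite -mulr_sumr (eq_bigr _ (fun (m : 'I_N) _ => ab m)) big_split /= sumrB (@periodic_sumS R N g gN) subrr addr0.
  rewrite -mulr_suml big_split /= (@periodic_sumS R N h hN).
  have : \sum_(m < N) h m <= \sum_(m < N) r by apply: ler_sum => m _; have := hr m; lra.
  rewrite sumr_const card_ord -mulr_natr => H.
  have rT : 0 <= r * T by rewrite mulr_ge0.
  by have := ler_wpM2l rT H; lra.
have := le_trans E F => {E F}.
by have := s0; move: (\sum_(m < N) a m * b m) => x; nra.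
Qed.

(** * The calibration *)

(** Put rho = 1 / (2 cos w) and 1/2 + f = rho cos t, so that t is the angle between the normal and a
    vertex at distance rho. Equality for G = rho^2 sin^2 t is the linear equation - rho (k sin t)' =
    (rho cos t - rho^2 cos 2t) / 2 - C in t. It gives k = C t / (rho sin t) - 1/4 + f/2, up to a
    multiple of 1 / sin t that regularity at the vertex t = 0 excludes. At f = 0 one has t = w, and
    k(0) = 0 forces C = tan w / (8 w). *)
Definition calibration {R : realType} (w f : R) : R :=
  sin w / (4 * w) * (acos ((1 + 2 * f) * cos w) / sin (acos ((1 + 2 * f) * cos w))) - 1 / 4 + f / 2.

Definition calibration_derive {R : realType} (w f : R) : R :=
  let t := acos ((1 + 2 * f) * cos w) in
  1 / 2 - sin w * cos w / (2 * w) * ((sin t - t * cos t) / sin t ^+ 3).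

Lemma calibration0 (R : realType) (w : R) : 0 < w < pi / 2 -> calibration w 0 = 0.
Proof.
move=> wI; have sw : 0 < sin w by exact: sin_gt0_pihalf.
rewrite /calibration mulr0 addr0 mul1r cosK; last by rewrite in_itv /=; lra.
by field; rewrite !gt_eqF //; lra.
Qed.

Lemma acos_range (R : realType) (w f : R) : 0 < w < pi / 2 -> 0 <= f -> (1 + 2 * f) * cos w < 1 ->
  let t := acos ((1 + 2 * f) * cos w) in
  [/\ 0 < t, t <= pi, 0 < sin t, cos t = (1 + 2 * f) * cos w & 0 < cos t].
Proof.
move=> wI f0 H t.
have cw : 0 < cos w by apply: cos_gt0_pihalf; lra.
have th0 : 0 < (1 + 2 * f) * cos w by rewrite mulr_gt0 //; lra.
have ck : cos t = (1 + 2 * f) * cos w by rewrite acosK // in_itv /=; lra.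
have t0 : 0 < t by apply: acos_gt0; lra.
have tpi : t < pi by apply: acos_ltpi; lra.
by split; rewrite ?ck // ?ltW //; apply: sin_gt0_pi; rewrite t0.
Qed.

Lemma is_derive_calibration (R : realType) (w f : R) :
  0 < w < pi / 2 -> 0 <= f -> (1 + 2 * f) * cos w < 1 ->
  is_derive f 1 (calibration w) (calibration_derive w f).
Proof.
move=> wI f0 H.
have [t0 tpi st ck ct] := acos_range wI f0 H.
set t := acos _ in t0 tpi st ck ct.
pose u : R -> R := (cst (cos w) + (2 * cos w) \*: id).
have Du : is_derive f 1 u (2 * cos w).
  by apply: trigger_derive; rewrite /GRing.scale /=; ring.
have uE x : u x = (1 + 2 * x) * cos w by rewrite /u !fctE /= /GRing.scale /=; ring.
have Da : is_derive (u f) 1 (@acos R) (- (sin t)^-1).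
  have th : -1 < u f < 1 by rewrite uE -ck; lra.
  have := is_derive1_acos th; rewrite -sin_acos ?uE -/t //; rewrite -ck; lra.
have Dt := is_derive1_comp Da Du.
have tE : (@acos R \o u) f = t by rewrite /= uE.
have Dq : is_derive t 1 (id * (fun x => (sin x)^-1) : R -> R) ((sin t - t * cos t) / sin t ^+ 2).
  have st0 : sin t != 0 by exact: lt0r_neq0.
  by apply: trigger_derive; rewrite /GRing.scale /=; field.
rewrite -tE in Dq; have D := is_derive1_comp Dq Dt.
have : is_derive f 1 ((sin w / (4 * w)) \*: ((id * (fun x => (sin x)^-1)) \o (@acos R \o u)) - cst (1 / 4) + 2^-1 \*: id : R -> R)
   (calibration_derive w f).
  apply: trigger_derive; rewrite /GRing.scale /= /calibration_derive uE -/t.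
  by field; rewrite !gt_eqF //; lra.
congr (is_derive _ _ _ _); apply/funext => x; rewrite /calibration -uE !fctE /= /GRing.scale /=; ring.
Qed.

(** The quotient lies in [[0, 1]] and the factor before it in [[0, 1 / 2]]. Monotonicity makes the
    calibration nonnegative for [f >= 0]; the upper bound makes it Lipschitz, which absorbs the
    discretisation errors. *)
Lemma calibration_derive_bounds (R : realType) (w f : R) :
  0 < w < pi / 2 -> 0 <= f -> (1 + 2 * f) * cos w < 1 ->
  0 <= calibration_derive w f <= 1 / 2.
Proof.
move=> wI f0 H; have [t0 tpi st ck ct] := acos_range wI f0 H.
rewrite /calibration_derive; set t := acos _ in t0 tpi st ck ct *.
have cw : 0 < cos w by apply: cos_gt0_pihalf; lra.
have sw : 0 < sin w by exact: sin_gt0_pihalf.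
have q0 : 0 <= (sin t - t * cos t) / sin t ^+ 3.
  by apply: divr_ge0; [rewrite subr_ge0 mulr_cos_le_sin // ltW|exact/exprn_ge0/ltW].
have q1 : (sin t - t * cos t) / sin t ^+ 3 <= 1.
  rewrite ler_pdivrMr ?exprn_gt0 // mul1r.
  have := sin_le (ltW t0); have := cos_le1 t => c1 s1.
  have -> : sin t ^+ 3 = sin t * (1 - cos t ^+ 2) by rewrite -sin2cos2; ring.
  have : 0 <= (t - sin t) * cos t by apply: mulr_ge0; [rewrite subr_ge0|exact: ltW].
  have : 0 <= sin t * (cos t * (1 - cos t)) by apply: mulr_ge0; [exact: ltW|apply: mulr_ge0; [exact: ltW|rewrite subr_ge0]].
  by nra.
have B0 : 0 <= sin w * cos w / (2 * w) by apply: divr_ge0; [apply: mulr_ge0; exact: ltW|lra].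
have B1 : sin w * cos w / (2 * w) <= 1 / 2.
  rewrite ler_pdivrMr; last by lra.
  by have := @sin_le R w; have := cos_le1 w; nra.
set q := _ / _ ^+ 3 in q0 q1 *; set B := _ / (2 * w) in B0 B1 *.
by nra.
Qed.

(* The left-hand side is affine in G, with equality at the value of G for which
   the body turns around a vertex at distance [1 / (2 * cos w)] from the origin. *)
Lemma calibration_inequality (R : realType) (w f G : R) :
  0 < w < pi / 2 -> 0 <= f -> (1 + 2 * f) * cos w < 1 ->
  G <= (2 * cos w)^-1 ^+ 2 - (1 / 2 + f) ^+ 2 ->
  (G + 1 / 4 - f ^+ 2) / 2 - tan w / (8 * w) + calibration w f * (1 / 2 + f) <= calibration_derive w f * G.
Proof.
move=> wI f0 H HG; have [t0 tpi st ck ct] := acos_range wI f0 H.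
rewrite /calibration /calibration_derive; set t := acos _ in t0 tpi st ck ct *.
have cw : 0 < cos w by apply: cos_gt0_pihalf; lra.
have sw : 0 < sin w by exact: sin_gt0_pihalf.
have w0 : 0 < w by lra.
have fE : f = (cos t / cos w - 1) / 2 by rewrite ck; field; exact: lt0r_neq0.
have GE : (2 * cos w)^-1 ^+ 2 - (1 / 2 + f) ^+ 2 = sin t ^+ 2 / (4 * cos w ^+ 2).
  by rewrite sin2cos2 fE; field; exact: lt0r_neq0.
rewrite GE in HG; rewrite -subr_ge0.
have -> : (1 / 2 - sin w * cos w / (2 * w) * ((sin t - t * cos t) / sin t ^+ 3)) * G -
  ((G + 1 / 4 - f ^+ 2) / 2 - tan w / (8 * w) + (sin w / (4 * w) * (t / sin t) - 1 / 4 + f / 2) * (1 / 2 + f)) =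
  sin w * cos w / (2 * w) * ((sin t - t * cos t) / sin t ^+ 3) * (sin t ^+ 2 / (4 * cos w ^+ 2) - G).
  by rewrite /tan fE; field; rewrite !lt0r_neq0.
rewrite mulr_ge0 ?subr_ge0 // mulr_ge0 //.
  by apply: divr_ge0; [apply: mulr_ge0; exact: ltW|lra].
by apply: divr_ge0; [rewrite subr_ge0 mulr_cos_le_sin // ltW|exact/exprn_ge0/ltW].
Qed.

Lemma calibration_mvt (R : realType) (w x y : R) : 0 < w < pi / 2 ->
  0 <= x -> x <= y -> (1 + 2 * y) * cos w < 1 ->
  exists2 z, x <= z <= y & calibration w y - calibration w x = calibration_derive w z * (y - x).
Proof.
move=> wI x0 xy yw.
apply: (@mean_value_segment R (calibration w) (calibration_derive w) x y xy) => z /andP[xz zy].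
have cw : 0 < cos w by apply: cos_gt0_pihalf; lra.
by apply: is_derive_calibration => //; nra.
Qed.

Lemma calibration_incr (R : realType) (w x y : R) : 0 < w < pi / 2 ->
  0 <= x -> x <= y -> (1 + 2 * y) * cos w < 1 ->
  0 <= calibration w y - calibration w x <= (y - x) / 2.
Proof.
move=> wI x0 xy yw; have [z /andP[xz zy] ->] := calibration_mvt wI x0 xy yw.
have cw : 0 < cos w by apply: cos_gt0_pihalf; lra.
have : 0 <= calibration_derive w z <= 1 / 2 by apply: calibration_derive_bounds => //; nra.
by nra.
Qed.

Definition odd_calibration {R : realType} (w f : R) : R :=
  if 0 <= f then calibration w f else - calibration w (- f).

(** The left-hand side of [calibration_inequality], named in order to be evaluated at a point near
    the one where the inequality is applied. *)
Definition slope_bound {R : realType} (w G f : R) : R :=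
  (G + 1 / 4 - f ^+ 2) / 2 - tan w / (8 * w) + calibration w f * (1 / 2 + f).

Lemma calibration_range (R : realType) (w F : R) (wI : 0 < w < pi / 2) (F0 : 0 <= F <= 1 / 2)
  (Fw : (1 + 2 * F) * cos w < 1) (f : R) : 0 <= f <= F -> [/\ (1 + 2 * f) * cos w < 1 & 0 <= calibration w f <= 1 / 4].
Proof.
move=> fI; have cw : 0 < cos w by apply: cos_gt0_pihalf; lra.
have fw : (1 + 2 * f) * cos w < 1 by nra.
split=> //; have f0 : 0 <= f by lra.
by have := calibration_incr wI (lexx 0) f0 fw; rewrite calibration0 //; lra.
Qed.

Lemma slope_bound_lip (R : realType) (w F : R) (wI : 0 < w < pi / 2) (F0 : 0 <= F <= 1 / 2)
  (Fw : (1 + 2 * F) * cos w < 1) (G x y e : R) : 0 <= x <= F -> 0 <= y <= F -> `|x - y| <= e ->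
  slope_bound w G x <= slope_bound w G y + 2 * e.
Proof.
move=> xI yI; rewrite ler_norml => xy.
have [xw kx] := calibration_range wI F0 Fw xI; have [yw ky] := calibration_range wI F0 Fw yI.
have K : `|calibration w x - calibration w y| <= e / 2.
  have [xley|/ltW ylex] := leP x y.
    by have := @calibration_incr R w x y wI _ xley yw; rewrite ler_norml; lra.
  by have := @calibration_incr R w y x wI _ ylex xw; rewrite ler_norml; lra.
move: K; rewrite ler_norml /slope_bound; move: (calibration w x) (calibration w y) kx ky => p q kx ky K.
(* The square, the calibration and the factor [1 / 2 + f] contribute at most [e / 2], [e / 2] and
   [e]. *)
have H1 : `|(x - y) * (x + y)| <= e * 1.
  by rewrite normrM ler_pM // ler_norml; lra.
have H2 : `|(p - q) * (1 / 2 + x)| <= (e / 2) * 1.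
  by rewrite normrM ler_pM // ler_norml; lra.
have H3 : `|q * (x - y)| <= 1 * e.
  by rewrite normrM ler_pM // ler_norml; lra.
move: H1 H2 H3; rewrite !ler_norml; move: (tan w / _) => T; nra.
Qed.

(** The mean value theorem gives a point of [[x, y]], where the constraint on [G] is inherited from
    the larger end [y]. The reference point [z] is separate from [x] and [y], so that one bound at
    [|a|] serves both halves of a step that crosses 0. *)
Lemma calibration_slope (R : realType) (w F : R) (wI : 0 < w < pi / 2) (F0 : 0 <= F <= 1 / 2)
  (Fw : (1 + 2 * F) * cos w < 1) (G x y z e : R) : 0 <= x -> x <= y -> y <= F -> 0 <= z <= F ->
  `|x - z| <= e -> `|y - z| <= e ->
  G + (1 / 2 + y) ^+ 2 <= (2 * cos w)^-1 ^+ 2 ->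
  (y - x) * (slope_bound w G z - 2 * e) <= (calibration w y - calibration w x) * G.
Proof.
move=> x0 xy yF zI xz yz HG.
have yI : 0 <= y <= F by lra.
have [yw _] := calibration_range wI F0 Fw yI.
have [t /andP[xt ty] ->] := calibration_mvt wI x0 xy yw.
have tI : 0 <= t <= F by lra.
have [tw _] := calibration_range wI F0 Fw tI.
have HGt : G <= (2 * cos w)^-1 ^+ 2 - (1 / 2 + t) ^+ 2 by nra.
have t0 : 0 <= t by lra.
have := calibration_inequality wI t0 tw HGt; rewrite -/(slope_bound w G t).
have : `|z - t| <= e by move: xz yz; rewrite !ler_norml; lra.
move=> /(slope_bound_lip wI F0 Fw G zI tI) H1 H2.
have {}H1 : slope_bound w G z - 2 * e <= calibration_derive w t * G by lra.
have := ler_wpM2l (_ : 0 <= y - x) H1; rewrite subr_ge0 => /(_ xy); lra.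
Qed.

Lemma odd_calibration_slope (R : realType) (w F : R) (wI : 0 < w < pi / 2) (F0 : 0 <= F <= 1 / 2)
  (Fw : (1 + 2 * F) * cos w < 1) (G a b e : R) : `|a| <= F -> `|b| <= F -> `|b - a| <= e ->
  G + (1 / 2 + `|a|) ^+ 2 <= (2 * cos w)^-1 ^+ 2 ->
  G + (1 / 2 + `|b|) ^+ 2 <= (2 * cos w)^-1 ^+ 2 ->
  (b - a) ^+ 2 * (slope_bound w G `|a| - 2 * e) <= (b - a) * (odd_calibration w b - odd_calibration w a) * G.
Proof.
rewrite ler_norml !ler_norml => aF bF ab Ga Gb; rewrite /odd_calibration.
have S := @calibration_slope R w F wI F0 Fw G.
case: (leP 0 a) => a0; case: (leP 0 b) => b0;
  rewrite ?(ger0_norm a0) ?(ger0_norm b0) ?(ltr0_norm a0) ?(ltr0_norm b0) in Ga Gb *.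
- have [H|/ltW H] := leP a b.
    have := @S a b a e a0 H _ _ _ _ Gb; rewrite subrr normr0 ler_norml.
    by move=> H1; have {}H1 := H1 ltac:(lra) ltac:(lra) ltac:(lra) ltac:(lra); nra.
  have := @S b a a e b0 H _ _ _ _ Ga; rewrite subrr normr0 ler_norml.
  by move=> H1; have {}H1 := H1 ltac:(lra) ltac:(lra) ltac:(lra) ltac:(lra); nra.
(* The step crosses 0, where the calibration vanishes: it is cut there and both pieces are compared
   at [|a|]. *)
- have H1 := @S 0 a a e ltac:(lra) a0 ltac:(lra) ltac:(lra).
  have H2 := @S 0 (- b) a e ltac:(lra) ltac:(lra) ltac:(lra) ltac:(lra).
  rewrite !ler_norml calibration0 // in H1 H2.
  have {}H1 := H1 ltac:(lra) ltac:(lra) Ga; have {}H2 := H2 ltac:(lra) ltac:(lra) Gb.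
  by nra.
- have H1 := @S 0 (- a) (- a) e ltac:(lra) ltac:(lra) ltac:(lra) ltac:(lra).
  have H2 := @S 0 b (- a) e ltac:(lra) b0 ltac:(lra) ltac:(lra).
  rewrite !ler_norml calibration0 // in H1 H2.
  have {}H1 := H1 ltac:(lra) ltac:(lra) Ga; have {}H2 := H2 ltac:(lra) ltac:(lra) Gb.
  by nra.
- have [H|/ltW H] := leP a b.
    have := @S (- b) (- a) (- a) e _ _ _ _ _ _ Ga; rewrite subrr normr0 ler_norml.
    by move=> H1; have {}H1 := H1 ltac:(lra) ltac:(lra) ltac:(lra) ltac:(lra) ltac:(lra) ltac:(lra); nra.
  have := @S (- a) (- b) (- a) e _ _ _ _ _ _ Gb; rewrite subrr normr0 ler_norml.
  by move=> H1; have {}H1 := H1 ltac:(lra) ltac:(lra) ltac:(lra) ltac:(lra) ltac:(lra) ltac:(lra); nra.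
Qed.

Lemma odd_calibration_norm (R : realType) (w F : R) (wI : 0 < w < pi / 2) (F0 : 0 <= F <= 1 / 2)
  (Fw : (1 + 2 * F) * cos w < 1) (f : R) : `|f| <= F ->
  odd_calibration w f * f = calibration w `|f| * `|f| /\ `|odd_calibration w f| = calibration w `|f|.
Proof.
rewrite ler_norml /odd_calibration => fF; case: leP => f0.
  rewrite ger0_norm //; split=> //; rewrite ger0_norm //.
  by have [|_] := @calibration_range R w F wI F0 Fw f; lra.
rewrite ltr0_norm // normrN; split; first by ring.
by rewrite ger0_norm //; have [|_] := @calibration_range R w F wI F0 Fw (- f); lra.
Qed.

(** * The discrete calibration estimate *)

(** For [c = cos d] the combination [f m.+2 + f m - 2 * c * f m.+1] kills the sampled sines and
    cosines of step [d]: it is the discrete form of f'' + f. *)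
Lemma sum_by_parts (R : realType) (N : nat) (c : R) (f k : nat -> R) :
  (forall m, f (m + N)%N = f m) -> (forall m, k (m + N)%N = k m) ->
  \sum_(m < N) k m.+1 * (f m.+2 + f m - 2 * c * f m.+1) =
  2 * (1 - c) * \sum_(m < N) k m * f m - \sum_(m < N) (f m.+1 - f m) * (k m.+1 - k m).
Proof.
move=> fN kN.
have E1 := @periodic_sumS R N (fun m => k m * f m) ltac:(by move=> m /=; rewrite fN kN).
have E2 := @periodic_sumS R N (fun m => k m * (f m.+1 - f m)) ltac:(by move=> m /=; rewrite -addSn !fN kN).
rewrite -E1 mulr_sumr -sumrB.
transitivity (\sum_(m < N) (2 * (1 - c) * (k m.+1 * f m.+1) - (f m.+1 - f m) * (k m.+1 - k m)) +
  (\sum_(m < N) k m.+1 * (f m.+2 - f m.+1) - \sum_(m < N) k m * (f m.+1 - f m))).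
  by rewrite -sumrB -big_split; apply: eq_bigr => m _ /=; ring.
by rewrite E2 subrr addr0.
Qed.

(* The step of f is controlled by the position of the contact point, hence
   stays in the range where the calibration inequality holds. *)
Lemma step_range (R : realType) (c s T x y gx gy d : R) :
  0 < s -> c ^+ 2 + s ^+ 2 = 1 -> T * s = 1 - c -> 0 <= T <= 1 -> s <= 1 -> 0 <= c ->
  (1 / 2 + `|x|) ^+ 2 + gx ^+ 2 <= 1 / 3 -> (1 / 2 + `|y|) ^+ 2 + gy ^+ 2 <= 1 / 3 ->
  d = y - x ->
  gx * s - (1 / 2 + x) * (1 - c) <= d -> d <= gy * s + (1 / 2 + y) * (1 - c) ->
  [/\ `|d| <= 2 * s, d ^+ 2 / (2 * (1 - c)) + (1 / 2 + `|x|) ^+ 2 <= 1 / 3 + 8 * s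
    & d ^+ 2 / (2 * (1 - c)) + (1 / 2 + `|y|) ^+ 2 <= 1 / 3 + 8 * s].
Proof.
move=> s0 cs Ts T01 s1 c0 Hx Hy dE lo hi.
have c1 : 0 < 1 - c by nra.
have cT : 1 - c <= s by rewrite -Ts; nra.
have x0 := normr_ge0 x; have y0 := normr_ge0 y.
have xr : `|x| <= 1 / 2 by nra.
have yr : `|y| <= 1 / 2 by nra.
have gxr : -1 <= gx <= 1 by nra.
have gyr : -1 <= gy <= 1 by nra.
have xle : x <= `|x| := ler_norm x; have yle : y <= `|y| := ler_norm y.
have xge : - x <= `|x| by rewrite -normrN ler_norm.
have yge : - y <= `|y| by rewrite -normrN ler_norm.
have dr : - (2 * s) <= d <= 2 * s by apply/andP; split; nra.
have xy : `|x| - `|y| <= 2 * s.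
  by apply: le_trans (lerB_dist _ _) _; rewrite distrC -dE ler_norml.
have yx : `|y| - `|x| <= 2 * s.
  by apply: le_trans (lerB_dist _ _) _; rewrite -dE ler_norml.
(* The quotient is the discrete f'^2. Since [s ^+ 2 = (1 - c) * (1 + c)], it is at most [g ^+ 2] up
   to a multiple of [s]. *)
have key g : -1 <= g <= 1 -> d ^+ 2 <= (`|g| * s + (1 - c)) ^+ 2 -> d ^+ 2 / (2 * (1 - c)) <= g ^+ 2 + 2 * s.
  move=> gr H; rewrite ler_pdivrMr; last by lra.
  apply: le_trans H _; have g0 := normr_ge0 g.
  have g1 : `|g| <= 1 by rewrite ler_norml.
  rewrite -(real_normK (num_real g)).
  have s2 : s ^+ 2 = (1 - c) * (1 + c) by rewrite -[s ^+ 2](addKr (c ^+ 2)) cs; ring.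
  have -> : (`|g| * s + (1 - c)) ^+ 2 = (1 - c) * (`|g| ^+ 2 * (1 + c) + 2 * `|g| * s + (1 - c)).
    by transitivity (`|g| ^+ 2 * s ^+ 2 + 2 * `|g| * s * (1 - c) + (1 - c) ^+ 2); [ring|rewrite s2; ring].
  rewrite [leRHS]mulrC; have -> : 2 * (1 - c) * (`|g| ^+ 2 + 2 * s) = (1 - c) * (2 * `|g| ^+ 2 + 4 * s) by ring.
  rewrite ler_pM2l //.
  have : 0 <= `|g| ^+ 2 * (1 - c) by rewrite mulr_ge0 ?exprn_ge0 // ltW.
  have : `|g| * s <= 1 * s by rewrite ler_pM2r.
  by lra.
have sq (u v : R) : - v <= u -> u <= v -> u ^+ 2 <= v ^+ 2.
  by move=> h1 h2; rewrite -(real_normK (num_real u)) ler_sqr ?nnegrE // ?ler_norml; lra.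
(* An increasing step is controlled by the contact point at its end, a decreasing one by that at its
   start. Passing to the other end costs at most [6 * s], because the absolute values differ by at
   most [2 * s]. *)
have [d0|d0] := leP 0 d.
  have /key : -1 <= gy <= 1 by [].
  have H : d <= `|gy| * s + (1 - c).
    have : gy * s <= `|gy| * s by rewrite ler_pM2r // ler_norm.
    by nra.
  have H' : - (`|gy| * s + (1 - c)) <= d by have := normr_ge0 gy; nra.
  move=> /(_ (sq _ _ H' H)) G.
  have : (1 / 2 + `|x|) ^+ 2 <= (1 / 2 + `|y|) ^+ 2 + 6 * s by nra.
  by move=> ?; split; [rewrite ler_norml|lra|lra].
have /key : -1 <= gx <= 1 by [].
have H : - (`|gx| * s + (1 - c)) <= d.
  have : - gx * s <= `|gx| * s by rewrite ler_pM2r // -normrN ler_norm.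
  by nra.
have H' : d <= `|gx| * s + (1 - c) by have := normr_ge0 gx; nra.
move=> /(_ (sq _ _ H H')) G.
have : (1 / 2 + `|y|) ^+ 2 <= (1 / 2 + `|x|) ^+ 2 + 6 * s by nra.
by move=> ?; split; [rewrite ler_norml|lra|lra].
Qed.

(* Summation by parts against the calibration turns the lower bound on the
   second differences of f into an upper bound on the functional. *)
Lemma polygon_functional_le (R : realType) (w F : R) (N : nat) (c s T : R) (f g : nat -> R) :
  0 < w < pi / 2 -> 0 <= F <= 1 / 2 -> (1 + 2 * F) * cos w < 1 -> (1 / 2 + F) ^+ 2 = 1 / 3 ->
  0 < s -> c ^+ 2 + s ^+ 2 = 1 -> T * s = 1 - c -> 0 <= T <= 1 -> s <= 1 -> 0 <= c ->
  1 / 3 + 8 * s <= (2 * cos w)^-1 ^+ 2 ->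
  (forall m, f (m + N)%N = f m) ->
  (forall m, (1 / 2 + `|f m|) ^+ 2 + g m ^+ 2 <= 1 / 3) ->
  (forall m, g m * s - (1 / 2 + f m) * (1 - c) <= f m.+1 - f m) ->
  (forall m, f m.+1 - f m <= g m.+1 * s + (1 / 2 + f m.+1) * (1 - c)) ->
  (forall m, f m.+1 < 0 -> f m.+2 + f m - 2 * c * f m.+1 <= 1 - c) ->
  polygon_functional N s T f <= T * N%:R * (tan w / (4 * w) + 8 * s).
Proof.
move=> wI F0 Fw F13 s0 cs Ts /andP[T0 T1] s1 c0 sw fN fg lo hi neg.
have c1 : 0 < 1 - c by rewrite -Ts mulr_gt0 //; nra.
have fF m : `|f m| <= F by have := fg m; have := normr_ge0 (f m); have := sqr_ge0 (g m); nra.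
pose d m := f m.+1 - f m; pose G m := d m ^+ 2 / (2 * (1 - c)).
have st m : [/\ `|d m| <= 2 * s, G m + (1 / 2 + `|f m|) ^+ 2 <= (2 * cos w)^-1 ^+ 2
    & G m + (1 / 2 + `|f m.+1|) ^+ 2 <= (2 * cos w)^-1 ^+ 2].
  have [|h1 h2 h3] := step_range s0 cs Ts _ s1 c0 (fg m) (fg m.+1) (erefl (d m)) (lo m) (hi m).
    by rewrite T0.
  by split=> //; rewrite /G; lra.
pose k m := odd_calibration w (f m).
have kN m : k (m + N)%N = k m by rewrite /k fN.
pose Q m := `|k m| * (1 / 2 + `|f m|).
(* For [f m.+1 >= 0] this is convexity times a nonnegative number. For [f m.+1 < 0] the odd
   calibration is nonpositive and the reverse bound [neg] takes over. *)
have A m : - (1 - c) * `|k m.+1| <= k m.+1 * (f m.+2 + f m - 2 * c * f m.+1).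
  have low : - (1 - c) <= f m.+2 + f m - 2 * c * f m.+1 by have := hi m; have := lo m.+1; lra.
  have [f0|f0] := leP 0 (f m.+1).
    have k0 : 0 <= k m.+1.
      rewrite /k /odd_calibration f0; have := fF m.+1; rewrite ger0_norm // => fF1.
      by have [|_] := @calibration_range R w F wI F0 Fw (f m.+1); lra.
    by rewrite ger0_norm // mulrC ler_wpM2l.
  have k0 : k m.+1 <= 0.
    rewrite /k /odd_calibration; case: ifP => [|_]; first by lra.
    have := fF m.+1; rewrite ltr0_norm // => fF1.
    by have [|_] := @calibration_range R w F wI F0 Fw (- f m.+1); lra.
  by have := neg m f0; rewrite ler0_norm //; nra.
have B m : G m + 1 / 4 - f m ^+ 2 - tan w / (4 * w) - 8 * s + 2 * Q m <=
    d m * (k m.+1 - k m) / (1 - c).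
  have [h1 h2 h3] := st m.
  have E1 : Q m = calibration w `|f m| * (1 / 2 + `|f m|).
    by rewrite /Q /k (odd_calibration_norm wI F0 Fw (fF m)).2.
  have E2 : f m ^+ 2 = `|f m| ^+ 2 by rewrite real_normK ?num_real.
  have E3 : G m + 1 / 4 - f m ^+ 2 - tan w / (4 * w) - 8 * s + 2 * Q m =
      2 * (slope_bound w (G m) `|f m| - 2 * (2 * s)).
    rewrite E1 E2 /slope_bound; field; lra.
  (* [odd_calibration_slope] carries the factor [d m ^+ 2]; when it vanishes, the inequality is used
     directly with [G = 0]. *)
  rewrite E3; have [d0|d0] := eqVneq (d m) 0.
    have G0 : G m = 0 by rewrite /G d0 expr0n mul0r.
    have fm : 0 <= `|f m| <= F by rewrite normr_ge0 fF.
    have [fw _] := calibration_range wI F0 Fw fm.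
    have := @calibration_inequality R w `|f m| 0 wI (normr_ge0 _) fw.
    rewrite mulr0 -/(slope_bound w 0 `|f m|) d0 !mul0r G0; rewrite G0 in h2.
    by move=> H; have {}H := H ltac:(lra); lra.
  have d2 : 0 < d m ^+ 2 by rewrite exprn_even_gt0.
  have := odd_calibration_slope wI F0 Fw (fF m) (fF m.+1) h1 h2 h3.
  rewrite -/(d m) -/(k m) -/(k m.+1) => H.
  have {}H : d m ^+ 2 * (slope_bound w (G m) `|f m| - 2 * (2 * s)) <=
    d m ^+ 2 * (d m * (k m.+1 - k m) / (2 * (1 - c))).
    apply: le_trans H _; rewrite le_eqVlt; apply/orP; left; apply/eqP.
    by rewrite /G; field; lra.
  rewrite ler_pM2l // in H.
  have -> : d m * (k m.+1 - k m) / (1 - c) = 2 * (d m * (k m.+1 - k m) / (2 * (1 - c))) by field; lra.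
  by rewrite ler_pM2l.
have SA : - (1 - c) * \sum_(m < N) `|k m| <=
    2 * (1 - c) * \sum_(m < N) k m * f m - \sum_(m < N) d m * (k m.+1 - k m).
  rewrite -(sum_by_parts c fN kN) -(@periodic_sumS R N (fun m => `|k m|)); last by move=> m; rewrite kN.
  by rewrite mulr_sumr; apply: ler_sum => m _; exact: A.
(* Since [Q m] is half of [|k m|] plus [k m * f m], summation by parts bounds the right-hand sides
   by exactly the sum of the [2 * Q m], which then cancels. *)
have SB : \sum_(m < N) (G m + 1 / 4 - f m ^+ 2 - tan w / (4 * w) - 8 * s + 2 * Q m) <=
    2 * \sum_(m < N) Q m.
  apply: le_trans (ler_sum _ (fun (m : 'I_N) _ => B m)) _.
  rewrite -mulr_suml ler_pdivrMr //.
  have EQ : \sum_(m < N) Q m = 2^-1 * \sum_(m < N) `|k m| + \sum_(m < N) k m * f m.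
    rewrite mulr_sumr -big_split; apply: eq_bigr => m _ /=.
    rewrite /Q /k; have [-> ->] := odd_calibration_norm wI F0 Fw (fF m); ring.
  by rewrite EQ; lra.
have SC : \sum_(m < N) (G m + 1 / 4 - f m ^+ 2) <= N%:R * (tan w / (4 * w) + 8 * s).
  have : \sum_(m < N) (G m + 1 / 4 - f m ^+ 2 - tan w / (4 * w) - 8 * s + 2 * Q m) =
    \sum_(m < N) (G m + 1 / 4 - f m ^+ 2) - N%:R * (tan w / (4 * w) + 8 * s) + 2 * \sum_(m < N) Q m.
    have SN (x : R) : \sum_(m < N) x = N%:R * x by rewrite sumr_const card_ord mulr_natl.
    rewrite mulr_sumr -SN -sumrB -big_split.
    by apply: eq_bigr => m _ /=; ring.
  by lra.
have -> : polygon_functional N s T f = T * \sum_(m < N) (G m + 1 / 4 - f m ^+ 2).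
  rewrite /polygon_functional !mulr_sumr -big_split; apply: eq_bigr => m _ /=.
  rewrite /G -/(d m).
  have T0' : T != 0 by apply: contraTneq c1 => T0'; rewrite -Ts T0' mul0r ltxx.
  by rewrite -Ts; field; rewrite T0' lt0r_neq0.
by rewrite -mulrA ler_wpM2l.
Qed.

(** * Contact points and the bound for a fixed number of directions *)

Lemma grid_parameters (R : realType) (L : nat) (d : R) : (1 < L)%N -> d = 2 * pi / (4 * L)%:R ->
  let c := cos d in let s := sin d in let T := sin (d / 2) / cos (d / 2) in
  [/\ [/\ 0 < d, d <= 1, 0 < s, s <= d & s <= 1],
      [/\ c ^+ 2 + s ^+ 2 = 1, T * s = 1 - c, 0 <= T, T <= d & 1 / 2 <= c],
      0 < cos (d / 2) & T * (4 * L)%:R <= pi + d].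
Proof.
move=> L1 dE c s T.
have pi0 := pi_gt0 R; have pi4 : pi <= 4 :> R by have := pihalf_lt2 R; lra.
have L2 : 2 <= L%:R :> R by rewrite ler_nat.
have dL : d * (4 * L%:R) = 2 * pi by rewrite dE natrM; field; lra.
have d0 : 0 < d by rewrite dE divr_gt0 // ?natrM; lra.
have d1 : d <= 1 by nra.
have C := cos_ge d; have C2 := cos_ge (d / 2).
have s0 : 0 < s by apply: sin_gt0_pi; have := pi_ge2 R; lra.
have ch0 : 7 / 8 <= cos (d / 2) by nra.
have sh0 : 0 <= sin (d / 2) by apply: sin_ge0_pi; have := pi_ge2 R; lra.
have shd : sin (d / 2) <= d / 2 by apply: sin_le; lra.
have chp : 0 < cos (d / 2) by lra.
have TE : T * cos (d / 2) = sin (d / 2) by rewrite /T divfK // lt0r_neq0.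
have T0 : 0 <= T by rewrite divr_ge0 // ltW.
split=> //.
- by split=> //; [exact/sin_le/ltW|exact: sin_le1].
- split=> //.
  + by rewrite cos2Dsin2.
  + have E : d = (d / 2) *+ 2 by rewrite mulr2n; lra.
    rewrite /s /c {1 2}E sin_mulr2n cos_mulr2n -mulrnAr mulrA TE cos2sin2; ring.
  + by nra.
  + by rewrite /c; nra.
- rewrite natrM -(ler_pM2r chp) mulrAC TE.
  have : (pi + d) * (1 - (d / 2) ^+ 2 / 2) <= (pi + d) * cos (d / 2) by rewrite ler_pM2l //; lra.
  by nra.
Qed.

Lemma dot_direction_rotate (R : realType) (z : plane R) (a b : R) :
  dot z (direction (a + b)) = dot z (direction a) * cos b + det (direction a) z * sin b.
Proof. by rewrite /dot /det /= cosD sinD; ring. Qed.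

Lemma plane_frame (R : realType) (z : plane R) (a : R) :
  z = (dot z (direction a) * cos a - det (direction a) z * sin a,
       dot z (direction a) * sin a + det (direction a) z * cos a).
Proof.
have C := cos2Dsin2 a; rewrite [LHS]surjective_pairing; congr pair; rewrite /dot /det /=.
  by transitivity (z.1 * (cos a ^+ 2 + sin a ^+ 2)); [rewrite C mulr1|ring].
by transitivity (z.2 * (cos a ^+ 2 + sin a ^+ 2)); [rewrite C mulr1|ring].
Qed.

Lemma det_frames (R : realType) (y z : plane R) (a b : R) :
  let h := dot y (direction a) in let g := det (direction a) y in
  let h' := dot z (direction b) in let g' := det (direction b) z in
  det y z = (h * h' + g * g') * sin (b - a) + (h * g' - g * h') * cos (b - a).
Proof.
move=> h g h' g'; rewrite (plane_frame y a) (plane_frame z b) -/h -/g -/h' -/g' /det /= sinB cosB.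
ring.
Qed.

Lemma frame_polar (R : realType) (z : plane R) (a : R) : 0 < dot z (direction a) ->
  let h := dot z (direction a) in let g := det (direction a) z in
  let t := atan (g / h) in let r := h / cos t in
  [/\ 0 < r, h = r * cos t, g = r * sin t & z = r *: direction (a + t)].
Proof.
move=> h0 h g t r.
have ct : 0 < cos t by apply: cos_gt0_pihalf; rewrite atan_gtNpi2 atan_ltpi2.
have st : sin t = g / h * cos t by have := atanK (g / h); rewrite -/t /tan => <-; rewrite divfK ?lt0r_neq0.
split=> //; first exact: divr_gt0.
- by rewrite divfK ?lt0r_neq0.
- by rewrite st /r; field; rewrite !lt0r_neq0.
- rewrite (plane_frame z a) -/h -/g /direction cosD sinD st; congr pair; rewrite /GRing.scale /= /r;
  by field; rewrite !lt0r_neq0.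
Qed.

Lemma convex_setE (R : realType) (S : set (plane R)) : @convex_set R (plane R) S <->
  (forall x y (t : R), 0 <= t <= 1 -> S x -> S y -> S (t *: x + (1 - t) *: y)).
Proof.
split=> [cS x y t /andP[t0 t1] Sx Sy|cS x y l].
  by have := cS x y (Itv01 t0 t1); rewrite !inE => /(_ Sx Sy).
rewrite !inE => Sx Sy; rewrite /conv /=.
apply: cS => //.
by apply/andP; split.
Qed.

Lemma half_open_triangle_sub (R : realType) (S : set (plane R)) (a b : plane R) :
  @convex_set R (plane R) S -> S 0 -> S a -> S b -> half_open_triangle a b `<=` (S : set (mplane R)).
Proof.
move=> /convex_setE cS S0 Sa Sb x [d1 d2 d3].
have D0 : 0 < det a b by lra.
have e0 : 0 < det a x + det x b by lra.
pose v : R := (det a x + det x b) / det a b.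
have v01 : 0 <= v <= 1 by apply/andP; split; [apply: divr_ge0; lra|rewrite ler_pdivrMr //; lra].
pose t := det x b / (det a x + det x b).
have t01 : 0 <= t <= 1 by apply/andP; split; [apply: divr_ge0; lra|rewrite ler_pdivrMr //; lra].
have E1 : det x b * a.1 + det a x * b.1 = det a b * x.1 by rewrite /det; ring.
have E2 : det x b * a.2 + det a x * b.2 = det a b * x.2 by rewrite /det; ring.
have V (p q : R) : v * (t * p + (1 - t) * q) = (det x b * p + det a x * q) / det a b.
  by rewrite /v /t; field; rewrite !lt0r_neq0.
have := cS _ 0 v v01 (cS a b t t01 Sa Sb) S0.
congr S; rewrite scaler0 addr0 [RHS]surjective_pairing; congr pair; rewrite /GRing.scale /=.
  by rewrite V E1 mulrC mulKf ?lt0r_neq0.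
by rewrite V E2 mulrC mulKf ?lt0r_neq0.
Qed.

Lemma cos_gt0_gtNpihalf (R : realType) (x : R) : - (3 * (pi / 2)) <= x -> 0 < cos x -> - (pi / 2) < x.
Proof.
move=> x0 cx; rewrite ltNge; apply/negP => H.
have := @cos_ge0_pihalf R (x + pi); rewrite cosDpi; lra.
Qed.

(** Contact points turn in the same sense as the normals: [t] and [t'] are their polar angles
    measured from two consecutive directions. The sign of the sine is decisive once positivity of
    [cos (t - d)] confines the difference below [pi]. *)
Lemma contact_angle_step (R : realType) (d t t' r r' : R) :
  0 < d <= 1 -> - (pi / 2) < t < pi / 2 -> - (pi / 2) < t' < pi / 2 -> 0 < r -> 0 < r' ->
  0 < r * cos (t - d) -> 0 <= r * r' * sin (d + t' - t) -> t <= d + t' < t + pi.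
Proof.
move=> dI tI tI' r0 r0' c0 s0.
have p2 := pihalf_ge1 R.
have td : - (pi / 2) < t - d.
  by apply: cos_gt0_gtNpihalf; [lra|rewrite -(pmulr_rgt0 _ r0)].
rewrite pmulr_rge0 ?mulr_gt0 // in s0.
apply/andP; split; last by lra.
rewrite leNgt; apply/negP => H.
by have := @sin_lt0_piN R (d + t' - t); lra.
Qed.

(** Times [s], the determinant is a sum of two products, each of the slack of one support inequality
    and a nonnegative factor. *)
Lemma contact_det_ge0 (R : realType) (c s h g h' g' : R) :
  0 < s -> c ^+ 2 + s ^+ 2 = 1 -> 0 <= h -> 0 <= h * c + g * s ->
  h * c + g * s <= h' -> h' * c - g' * s <= h ->
  0 <= (h * h' + g * g') * s + (h * g' - g * h') * c.
Proof.
move=> s0 cs h0 p0 H1 H2; rewrite -(pmulr_rge0 _ s0).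
have -> : s * ((h * h' + g * g') * s + (h * g' - g * h') * c) =
  (g' * s - (h' * c - h)) * (h * c + g * s) + h * (h' * (c ^+ 2 + s ^+ 2) - (h * c + g * s)) by ring.
by rewrite cs mulr1 addr_ge0 // mulr_ge0 // subr_ge0 //; lra.
Qed.

(** [h m] and [g m] are the coordinates of a contact point in the frame of its normal, and [g] plays
    the role of h'. The inequalities say that each of two consecutive contact points lies below the
    support line of the other. *)
Lemma contact_steps (R : realType) (S : set (plane R)) (z : plane R -> plane R) (N : nat) (d : R) :
  d = 2 * pi / N%:R -> (forall u, S (z u)) -> (forall u x, S x -> dot x u <= dot (z u) u) ->
  let h m := dot (z (grid N m)) (grid N m) in let g m := det (grid N m) (z (grid N m)) in
  forall m, [/\ h m * cos d + g m * sin d <= h m.+1, h m.+1 * cos d - g m.+1 * sin d <= h m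
    & h m ^+ 2 + g m ^+ 2 = dot (z (grid N m)) (z (grid N m))].
Proof.
move=> dN Sz zmax h g m.
have gE k : @grid R N k = direction (k%:R * d) by rewrite /grid -dN.
have gS : @grid R N m.+1 = direction (m%:R * d + d) by rewrite /grid -dN -natr1 mulrDl mul1r.
have gS' : @grid R N m = direction (m.+1%:R * d + - d) by rewrite gE -natr1 mulrDl mul1r addrK.
split.
- have := zmax (grid N m.+1) _ (Sz (grid N m)); rewrite -/(h m.+1) gS dot_direction_rotate.
  by rewrite -gE.
- have := zmax (grid N m) _ (Sz (grid N m.+1)); rewrite -/(h m) gS' dot_direction_rotate.
  by rewrite -gE cosN sinN mulrN.
- have C := cos2Dsin2 (m%:R * d); rewrite /h /g gE; set y := z _.
  transitivity ((cos (m%:R * d) ^+ 2 + sin (m%:R * d) ^+ 2) * dot y y); last by rewrite C mul1r.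
  by rewrite /dot /det /=; ring.
Qed.

(** Cauchy's formula bounds the half length by [T] times the sum of the [h m], the fan of contact
    points bounds the area from below, and [contact_polygon_bound] compares the two. The factor
    [1 - pi * T] is the relative error of the first step. *)
Lemma half_length_le (R : realType) (S : set (plane R)) (r : R) (z : plane R -> plane R)
    (L n : nat) (p : nat -> plane R) (d : R) :
  let N := (4 * L)%N in let s := sin d in let T := sin (d / 2) / cos (d / 2) in
  let h m := dot (z (grid N m)) (grid N m) in
  closed S -> @convex_set R (plane R) S -> S 0 -> 0 <= r -> (forall x, S x -> dot x x <= r ^+ 2) ->
  (forall u, S (z u)) -> (forall u x, S x -> dot x u <= dot (z u) u) ->
  (forall m, 1 / 2 <= h m) ->
  (1 < L)%N -> d = 2 * pi / N%:R -> 4 * r * d < 1 ->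
  (0 < n)%N -> convex_order n p -> (forall i, (i < n)%N -> S (p i)) ->
  ((2^-1 * polygon_length n p * (1 - pi * T))%:E <=
   area S + (polygon_functional N s T (fun m => h m - 1 / 2) + 4 * r ^+ 2 * s * T * N%:R)%:E)%E.
Proof.
move=> N s T h clS cS S0 r0 Sr Sz zmax h12 L1 dN rd n0 cp Sp.
have L0 : (0 < L)%N by exact: ltnW.
have N0 : (0 < N)%N by rewrite muln_gt0.
have := grid_parameters L1 dN; rewrite -/s -/T; set c := cos d => -[[d0 d1 s0 sd s1] [cs Ts T0 Td c12] ch0 TN].
pose g m := det (grid N m) (z (grid N m)).
have gE m : @grid R N m = direction (m%:R * d) by rewrite /grid -/N -dN.
have hN m : h (m + N)%N = h m by rewrite /h grid_periodic.
have gN m : g (m + N)%N = g m by rewrite /g grid_periodic.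
have CS := contact_steps dN Sz zmax.
have H1 m : h m * c + g m * s <= h m.+1 by have [] := CS m.
have H2 m : h m.+1 * c - g m.+1 * s <= h m by have [] := CS m.
have hg m : h m ^+ 2 + g m ^+ 2 = dot (z (grid N m)) (z (grid N m)) by have [] := CS m.
have hr m : 0 <= h m <= r by have := h12 m; have := Sr _ (Sz (grid N m)); rewrite -hg; nra.
have gr m : - r <= g m <= r by have := h12 m; have := Sr _ (Sz (grid N m)); rewrite -hg; nra.
have D m : det (z (grid N m)) (z (grid N m.+1)) = (h m * h m.+1 + g m * g m.+1) * s + (h m * g m.+1 - g m * h m.+1) * c.
  rewrite (det_frames _ _ (m%:R * d) (m.+1%:R * d)) -!gE -/(h m) -/(h m.+1) -/(g m) -/(g m.+1).
  by rewrite (_ : m.+1%:R * d - m%:R * d = d) // -natr1; ring.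
(* Here [h m * c >= 1 / 4], while [4 * r * d < 1] keeps the second term above [- 1 / 4]. *)
have pos m : 0 < h m * c + g m * s by have := h12 m; have := gr m; nra.
pose t m := atan (g m / h m); pose rr m := h m / cos (t m).
have fr m : [/\ 0 < rr m, h m = rr m * cos (t m), g m = rr m * sin (t m)
     & z (grid N m) = rr m *: direction (m%:R * d + t m)].
  have := @frame_polar R (z (grid N m)) (m%:R * d); rewrite -!gE -/(h m) -/(g m); apply.
  by have := h12 m; lra.
have tI m : - (pi / 2) < t m < pi / 2 by rewrite atan_gtNpi2 atan_ltpi2.
have AR : ((\sum_(m < N) det (z (grid N m)) (z (grid N m.+1)) / 2)%:E <= area S)%E.
  apply: (@area_ge_fan R N (fun m => z (grid N m)) (fun m => m%:R * d + t m) rr).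
  - exact: closed_measurable_plane.
  - by move=> m _; have [] := fr m.
  - by move=> m _; have [] := fr m.
  - move=> m _; have [r1 h1 g1 _] := fr m; have [r2 h2 g2 _] := fr m.+1.
    have Dp : 0 <= rr m * rr m.+1 * sin (d + t m.+1 - t m).
      rewrite sinB cosD sinD -/c -/s.
      have hm0 : 0 <= h m by have := h12 m; lra.
      have := contact_det_ge0 s0 cs hm0 (ltW (pos m)) (H1 m) (H2 m).
      by rewrite h1 g1 h2 g2; congr (_ <= _); ring.
    have Cp : 0 < rr m * cos (t m - d).
      by have := pos m; rewrite cosB h1 g1 -/c -/s; congr (_ < _); ring.
    have dI : 0 < d <= 1 by rewrite d0.
    have := contact_angle_step dI (tI m) (tI m.+1) r1 r2 Cp Dp.
    by rewrite -natr1; lra.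
  - rewrite mul0r add0r /t -(add0n N) hN gN add0n addrC; congr (_ + _).
    by rewrite dN; field; rewrite pnatr_eq0 -lt0n.
  - by move=> m _; apply: half_open_triangle_sub.
have LE : 2^-1 * polygon_length n p * (1 - pi * T) <= T * \sum_(m < N) h m.
  have := polygon_length_le_support L0 dN n0 cp hN (fun i m ilt => zmax (grid N m) _ (Sp i ilt)).
  have TE : sin (d / 2) = T * cos (d / 2) by rewrite /T divfK ?lt0r_neq0.
  rewrite TE => H; rewrite -(ler_pM2r ch0); lra.
have T1 : 0 <= T <= 1 by rewrite T0 (le_trans Td).
have CB := contact_polygon_bound s0 cs Ts T1 hN gN hr gr H1 H2.
rewrite (eq_bigr _ (fun (m : 'I_N) _ => congr1 (fun x => x / 2) (D m))) in AR.
set A := \sum_(m < N) _ / 2 in AR CB.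
set E := _ + 4 * r ^+ 2 * s * T * N%:R in CB *.
apply: (@le_trans _ _ (A + E)%:E); first by rewrite lee_fin; lra.
by rewrite EFinD leeD2r.
Qed.

(** * Values at pi / 6 and the passage to the limit *)

Lemma le_of_invn_bound (R : realType) (x y K : R) (L0 : nat) :
  (forall L, (L0 < L)%N -> x <= y + K / L%:R) -> x <= y.
Proof.
move=> H; apply/ler_addgt0Pr => e e0.
pose L := maxn L0.+1 (Num.truncn (K / e)).+1.
have L1 : (L0 < L)%N by rewrite leq_maxl.
have L2 : K / e < L%:R.
  apply: lt_le_trans (truncnS_gt _) _; by rewrite ler_nat leq_maxr.
have Lp : 0 < L%:R :> R by rewrite ltr0n (leq_ltn_trans _ L1).
apply: le_trans (H L L1) _; rewrite lerD2l ler_pdivrMr // mulrC.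
by rewrite ltr_pdivrMr // in L2; exact: ltW.
Qed.

(** The triple-angle formula at [pi / 2 = 3 * (pi / 6)]. *)
Lemma cos_pi6 (R : realType) : cos (pi / 6) = Num.sqrt 3 / 2 :> R.
Proof.
have pi0 := pi_gt0 R.
have c0 : 0 < cos (pi / 6) :> R by apply: cos_gt0_pihalf; lra.
have E : cos (pi / 6) * (4 * cos (pi / 6) ^+ 2 - 3) = 0 :> R.
  rewrite -[RHS](@cos_pihalf R) (_ : pi / 2 = pi / 6 + (pi / 6) *+ 2); last by rewrite (mulr2n (pi / 6)); lra.
  rewrite cosD cos_mulr2n sin_mulr2n.
  have -> : sin (pi / 6) * ((cos (pi / 6) * sin (pi / 6)) *+ 2) = cos (pi / 6) * (sin (pi / 6) ^+ 2) *+ 2 :> R by ring.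
  by rewrite sin2cos2; ring.
have E2 : cos (pi / 6) ^+ 2 = 3 / 4 :> R.
  have /eqP := E; rewrite mulf_eq0 (gt_eqF c0) orFb => /eqP E'; lra.
have -> : cos (pi / 6) = Num.sqrt (cos (pi / 6) ^+ 2) :> R by rewrite sqrtr_sqr gtr0_norm.
rewrite E2 sqrtrM // (_ : 4^-1 = (2^-1) ^+ 2); last by field.
by rewrite sqrtr_sqr ger0_norm.
Qed.

Lemma sqrt3_sq (R : realType) : Num.sqrt 3 ^+ 2 = 3 :> R.
Proof. by rewrite sqr_sqrtr. Qed.

Lemma sin_pi6 (R : realType) : sin (pi / 6) = 1 / 2 :> R.
Proof.
have pi0 := pi_gt0 R.
have s0 : 0 < sin (pi / 6) :> R by apply: sin_gt0_pihalf; lra.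
have := sin2cos2 (pi / 6 : R); rewrite cos_pi6 expr_div_n sqrt3_sq; nra.
Qed.

Lemma cos_pi3 (R : realType) : cos (pi / 3) = 1 / 2 :> R.
Proof.
have -> : pi / 3 = (pi / 6) *+ 2 :> R by rewrite (mulr2n (pi / 6)); lra.
by rewrite cos_mulr2n cos_pi6 expr_div_n sqrt3_sq mulr2n; lra.
Qed.

Lemma sin_pi3 (R : realType) : sin (pi / 3) = Num.sqrt 3 / 2 :> R.
Proof.
have -> : pi / 3 = (pi / 6) *+ 2 :> R by rewrite (mulr2n (pi / 6)); lra.
by rewrite sin_mulr2n cos_pi6 sin_pi6 mulr2n; lra.
Qed.

(** At [e = 0] the left-hand side equals the claimed maximum. On the interval the derivative of the
    tangent is at most 2, and [pi <= 6 * w] removes the quotient. *)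
Lemma tan_near_pi6 (R : realType) (e : R) : 0 < e <= pi / 12 ->
  pi * (tan (pi / 6 + e) / (4 * (pi / 6 + e))) <= Num.sqrt 3 / 2 + 3 * e.
Proof.
move=> /andP[e0 e1]; have pi0 := pi_gt0 R; set w := pi / 6 + e.
have w1 : pi / 6 <= w by rewrite /w; lra.
have cpos x : pi / 6 <= x <= w -> 0 < cos x by move=> xI; apply: cos_gt0_pihalf; rewrite /w in xI; lra.
have [c cI E] := mean_value_segment w1 (fun x xI => is_derive_tan (lt0r_neq0 (cpos x xI))).
have t4 : tan c <= 1.
  rewrite -(@tan_piquarter R); have [->//|ne] := eqVneq c (pi / 4).
  apply/ltW; rewrite ltr_tan ?in_itv /=; rewrite /w in cI; [|lra|lra].
  by rewrite lt_neqAle ne; lra.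
have t0 : 0 <= tan c by rewrite divr_ge0 ?ltW ?cpos // sin_gt0_pihalf //; rewrite /w in cI; lra.
have D : cos c ^- 2 <= 2 by rewrite cos2_tan2 ?lt0r_neq0 ?cpos //; nra.
have t6 : tan (pi / 6) = Num.sqrt 3 / 3 :> R.
  rewrite /tan sin_pi6 cos_pi6; have := sqrt3_sq R => h; have s3 : Num.sqrt 3 != 0 :> R by rewrite sqrtr_eq0 -ltNge.
  by field: h.
have tw : tan w <= Num.sqrt 3 / 3 + 2 * e.
  have : cos c ^- 2 * (w - pi / 6) <= 2 * e by rewrite (_ : w - pi / 6 = e) ?ler_pM2r // /w addrC addKr.
  by rewrite -E t6; lra.
have twp : 0 <= tan w by rewrite divr_ge0 ?ltW ?cpos ?w1 ?lexx // sin_gt0_pihalf //; rewrite /w; lra.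
rewrite mulrA ler_pdivrMr; last by rewrite /w; lra.
have : pi * tan w <= 6 * w * tan w by rewrite ler_wpM2r // /w; lra.
have : 6 * w * tan w <= 6 * w * (Num.sqrt 3 / 3 + 2 * e) by rewrite ler_pM2l //; rewrite /w; lra.
by lra.
Qed.

Lemma area_bounded (R : realType) (S : set (plane R)) (r : R) : closed S ->
  (forall x, S x -> dot x x <= r ^+ 2) -> 0 <= r -> exists2 A : R, 0 <= A & area S = A%:E.
Proof.
move=> clS Sr r0.
have mS := closed_measurable_plane clS.
pose B : set (mplane R) := `[- r, r]%classic `*` `[- r, r]%classic.
have mB : measurable B by apply: measurableX; exact: measurable_itv.
have SB : (S : set (mplane R)) `<=` B.
  move=> x /Sr; rewrite /dot => H; split; rewrite /= in_itv /=; nra.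
have fB : (area B < +oo)%E.
  rewrite /area /B product_measure1E /=; [|exact: measurable_itv|exact: measurable_itv].
  rewrite !lebesgue_measure_itv /=.
  by case: ifP => _; rewrite ?mule0 // -EFinB -EFinM ltry.
have le : (area S <= area B)%E by apply: le_measure; rewrite ?inE.
have ge : (0 <= area S)%E by apply: measure_ge0.
exists (fine (area S)); first exact: fine_ge0.
by rewrite fineK // ge0_fin_numE // (le_lt_trans le).
Qed.

(** Two successive limits: [L] to infinity for fixed [w], then [w] to [pi / 6]. The threshold [L0]
    may depend on [w], since the room for the error of a step shrinks with [w - pi / 6]. *)
Lemma half_length_limit (R : realType) (S : set (plane R)) (r : R) (z : plane R -> plane R) :
  closed S -> @convex_set R (plane R) S -> S 0 -> 0 <= r -> (forall x, S x -> dot x x <= r ^+ 2) ->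
  (forall u, S (z u)) -> (forall u x, S x -> dot x u <= dot (z u) u) ->
  (forall a, 1 / 2 <= dot (z (direction a)) (direction a)) ->
  (forall w, pi / 6 < w <= pi / 4 -> exists L0, forall L d T, (L0 < L)%N -> d = 2 * pi / (4 * L)%:R ->
    T = sin (d / 2) / cos (d / 2) ->
    polygon_functional (4 * L) (sin d) T
      (fun m => dot (z (grid (4 * L) m)) (grid (4 * L) m) - 1 / 2) <=
    T * (4 * L)%:R * (tan w / (4 * w) + 8 * sin d)) ->
  forall n p, (0 < n)%N -> convex_order n p -> (forall i, (i < n)%N -> S (p i)) ->
  ((2^-1 * polygon_length n p)%:E <= area S + (Num.sqrt 3 / 2)%:E)%E.
Proof.
move=> clS cS S0 r0 Sr Sz zmax h12 Hf n p n0 cp Sp.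
have [A A0 AE] := area_bounded clS Sr r0.
rewrite AE -EFinD lee_fin; set l := _ * _.
have pi0 := pi_gt0 R; have pi4 : pi < 4 :> R by have := pihalf_lt2 R; lra.
have l0 : 0 <= l by rewrite mulr_ge0 // sumr_ge0 // => i _; exact: enorm_ge0.
apply/ler_addgt0Pr => e e0.
pose e' := Num.min (e / 3) (pi / 12).
have e'0 : 0 < e' by rewrite lt_min !divr_gt0.
have e'1 : e' <= pi / 12 by rewrite ge_min lexx orbT.
have e'2 : 3 * e' <= e by have : e' <= e / 3 by [rewrite ge_min lexx]; lra.
pose w := pi / 6 + e'.
have wI : pi / 6 < w <= pi / 4 by rewrite /w; lra.
have tw := tan_near_pi6 (_ : 0 < e' <= pi / 12); rewrite e'0 e'1 -/w in tw; have {}tw := tw isT.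
set V := tan w / (4 * w) in tw.
have V0 : 0 <= V.
  rewrite /V divr_ge0 //; last by lra.
  by rewrite /tan divr_ge0 // ltW // ?cos_gt0_pihalf ?sin_gt0_pihalf //; lra.
have [L0 HL0] := Hf w wI.
suff : l <= A + pi * V by lra.
(* The coefficients of [d] in the error terms [M1] to [M5]; as [d * L = pi / 2 < 2], the error is at
   most [2 * K / L]. *)
pose K := V + 40 + 20 * r ^+ 2 + 4 * l.
have K0 : 0 <= K by rewrite /K; have := sqr_ge0 r; lra.
apply: (@le_of_invn_bound R _ _ (2 * K) (maxn (maxn L0 1) (Num.truncn (8 * r)).+1)) => L.
rewrite !gtn_max => /andP[/andP[LL0 L1] Lr].
have Lp : 0 < L%:R :> R by rewrite ltr0n ltnW.
have {}Lr : 8 * r < L%:R by apply: lt_trans (truncnS_gt _) _; rewrite ltr_nat.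
pose d := 2 * pi / (4 * L)%:R : R.
have dE : d = 2 * pi / (4 * L)%:R by [].
have dL : d * L%:R = pi / 2 by rewrite dE natrM; field; exact: lt0r_neq0.
have := grid_parameters L1 dE => -[[d0 d1 s0 sd s1] [cs Ts T0 Td c12] ch0 TN].
have rd : 4 * r * d < 1.
  have : 4 * r * (d * L%:R) < L%:R by rewrite dL; nra.
  by rewrite -[4 * r * d < 1](ltr_pM2r Lp); lra.
have := half_length_le clS cS S0 r0 Sr Sz zmax (fun m => h12 _) L1 dE rd n0 cp Sp.
rewrite AE -EFinD lee_fin -/l; have := HL0 L d _ LL0 dE erefl; rewrite -/V.
set T := sin (d / 2) / cos (d / 2) in T0 Td TN Ts *; set s := sin d in s0 sd s1 cs Ts *.
set P := polygon_functional _ _ _ _; set N := (4 * L)%:R in TN *.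
move=> H1 H2.
have TN0 : 0 <= T * N by rewrite mulr_ge0 // ler0n.
have TN5 : T * N <= 5 by lra.
have M1 : T * N * V <= (pi + d) * V by rewrite ler_wpM2r.
have M2 : T * N * s <= 5 * d by apply: ler_pM => //; exact: ltW.
have M3 : l * T <= l * d by rewrite ler_wpM2l.
have M4 : T * N * s * r ^+ 2 <= 5 * d * r ^+ 2 by rewrite ler_wpM2r ?sqr_ge0.
have M5 : pi * (l * T) <= 4 * (l * d) by apply: ler_pM; [exact: ltW|exact: mulr_ge0|exact: ltW|].
have : l <= A + pi * V + d * K by rewrite /K; lra.
move=> H; apply: le_trans H _; rewrite lerD2l ler_pdivlMr // mulrAC dL.
by have := mulr_ge0 (ltW pi0) K0; nra.
Qed.

(** * The bound for bodies in the annulus *)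

Lemma contact_map (R : realType) (S : set (plane R)) : compact S -> S !=set0 ->
  exists2 z : plane R -> plane R, (forall u, S (z u)) & (forall u x, S x -> dot x u <= dot (z u) u).
Proof.
move=> cS S0.
have H u : exists y, S y /\ forall x, S x -> dot x u <= dot y u.
  have [|y yS ymax] := @compact_EVT_max (plane R) R (fun x => dot x u) S S0 cS.
    apply: continuous_subspaceT => x; rewrite /dot.
    apply: cvgD; apply: cvgM; [exact: cvg_fst|exact: cvg_cst|exact: cvg_snd|exact: cvg_cst].
  by exists y; split; [exact: set_mem|move=> x xS; apply: ymax; exact: mem_set].
have [z zP] := choice H.
by exists z => u; have [] := zP u.
Qed.

Lemma cos_lt_sqrt3 (R : realType) (w : R) : pi / 6 < w <= pi / 4 -> cos w < Num.sqrt 3 / 2.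
Proof.
by move=> wI; have pi0 := pi_gt0 R; rewrite -cos_pi6 ltr_cos ?in_itv /=; lra.
Qed.

(* The hypotheses of the discrete estimate hold for a body with contact points in
   the disk of radius [1 / sqrt 3] as soon as [sin d] is small. *)
Lemma polygon_functional_annulus (R : realType) (w : R) : pi / 6 < w <= pi / 4 ->
  exists L0, forall L d T (f g : nat -> R), (L0 < L)%N -> d = 2 * pi / (4 * L)%:R ->
    (forall m, f (m + 4 * L)%N = f m) ->
    (forall m, (1 / 2 + `|f m|) ^+ 2 + g m ^+ 2 <= 1 / 3) ->
    (forall m, (1 / 2 + f m) * cos d + g m * sin d <= 1 / 2 + f m.+1) ->
    (forall m, (1 / 2 + f m.+1) * cos d - g m.+1 * sin d <= 1 / 2 + f m) ->
    (forall m, f m.+1 < 0 -> f m.+2 + f m - 2 * cos d * f m.+1 <= 1 - cos d) ->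
    T = sin (d / 2) / cos (d / 2) ->
    polygon_functional (4 * L) (sin d) T f <= T * (4 * L)%:R * (tan w / (4 * w) + 8 * sin d).
Proof.
move=> wI; have pi0 := pi_gt0 R; have pi4 : pi < 4 :> R by have := pihalf_lt2 R; lra.
have cw := cos_lt_sqrt3 wI.
have cw0 : 0 < cos w by apply: cos_gt0_pihalf; lra.
have s3 := sqrt3_sq R; have s30 : 0 <= Num.sqrt 3 :> R by exact: sqrtr_ge0.
(* The largest value of h - 1/2 allowed by the outer disk. *)
pose F : R := Num.sqrt 3 / 3 - 1 / 2.
have F0 : 0 <= F <= 1 / 2 by rewrite /F; apply/andP; split; nra.
have F13 : (1 / 2 + F) ^+ 2 = 1 / 3 by rewrite /F addrC subrK expr_div_n s3; lra.
have Fw : (1 + 2 * F) * cos w < 1.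
  have -> : 1 + 2 * F = 2 * (Num.sqrt 3 / 3) by rewrite /F; lra.
  have : Num.sqrt 3 * cos w < Num.sqrt 3 * (Num.sqrt 3 / 2).
    by rewrite ltr_pM2l // lt_def s30 andbT; apply/eqP => s0; rewrite s0 in s3; lra.
  by rewrite mulrA -expr2 s3; lra.
(* The room gained by [w > pi / 6], into which the error [8 * sin d] of a step has to fit. *)
pose e : R := (2 * cos w)^-1 ^+ 2 - 1 / 3.
have e0 : 0 < e.
  rewrite /e subr_gt0 div1r exprVn ltf_pV2 ?posrE ?exprn_gt0 ?mulr_gt0 //.
  have : cos w ^+ 2 < (Num.sqrt 3 / 2) ^+ 2 by rewrite ltr_sqr ?nnegrE // ?ltW //; lra.
  rewrite expr_div_n s3 exprMn; lra.
pose L0 := maxn 1 (Num.truncn (16 / e)).+1.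
exists L0 => L d T f g; rewrite gtn_max => /andP[L1 Le] dE fN fg lo hi neg TE.
have Lp : 0 < L%:R :> R by rewrite ltr0n ltnW.
have {}Le : 16 / e < L%:R by apply: lt_trans (truncnS_gt _) _; rewrite ltr_nat.
have dL : d * L%:R = pi / 2 by rewrite dE natrM; field; exact: lt0r_neq0.
have := grid_parameters L1 dE; rewrite -TE => -[[d0 d1 s0 sd s1] [cs Ts T0 Td c12] ch0 TN].
apply: (@polygon_functional_le R w F (4 * L) (cos d) (sin d) T f g) => //.
- by lra.
- by rewrite T0 (le_trans Td).
- by lra.
- have : 8 * sin d <= e.
    rewrite ltr_pdivrMr // in Le.
    have : 16 * d <= 2 * e; last by lra.
    have : 16 * (d * L%:R) <= 2 * (L%:R * e) by rewrite dL; lra.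
    by rewrite -[16 * d <= _](ler_pM2r Lp); lra.
  by rewrite /e; lra.
- by move=> m; have := lo m; lra.
- by move=> m; have := hi m; lra.
Qed.

Lemma annulus_length_bound (R : realType) (S : set (plane R)) :
  bodies_in_annulus S ->
  forall n p, (0 < n)%N -> convex_order n p -> (forall i, (i < n)%N -> S (p i)) ->
  ((2^-1 * polygon_length n p)%:E <= area S + (Num.sqrt 3 / 2)%:E)%E.
Proof.
move=> [[cS kS _] dS Sd].
have s3 := sqrt3_sq R; have s30 : 0 <= Num.sqrt 3 :> R by exact: sqrtr_ge0.
have disk_dot (a : R) : disk (1 / 2) (2^-1 *: direction a : plane R).
  rewrite /disk /= enorm_le // /dot /= /GRing.scale /=.
  by have := cos2Dsin2 a; nra.
have S0 : S 0.
  by apply: dS; rewrite /disk /= enorm_le // /dot /= mulr0 addr0; lra.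
have Sr x : S x -> dot x x <= (Num.sqrt 3 / 3) ^+ 2.
  by move=> /Sd; rewrite /disk /= enorm_le // divr_ge0.
have [z Sz zmax] := contact_map cS (ex_intro _ _ S0).
have clS : closed S by apply: compact_closed => //; exact: norm_hausdorff.
have h12 a : 1 / 2 <= dot (z (direction a)) (direction a).
  apply: le_trans (zmax (direction a) _ (dS _ (disk_dot a))).
  by rewrite /dot /= /GRing.scale /=; have := cos2Dsin2 a; nra.
apply: (half_length_limit clS kS S0 _ Sr Sz zmax h12); first by rewrite divr_ge0.
move=> w wI; have [L0 H] := polygon_functional_annulus wI.
exists (maxn L0 1) => L d T; rewrite gtn_max => /andP[LL0 L1] dE TE.
have N0 : (0 < 4 * L)%N by rewrite muln_gt0 /= ltnW.
have CS := contact_steps dE Sz zmax.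
apply: (H L d T _ (fun m => det (grid (4 * L) m) (z (grid (4 * L) m)))) => //.
- by move=> m /=; rewrite grid_periodic.
- move=> m; rewrite ger0_norm; last by have := h12 (m%:R * (2 * pi / (4 * L)%:R)); rewrite /grid; lra.
  rewrite [1 / 2 + _]addrC subrK; have [_ _ ->] := CS m.
  by have := Sr _ (Sz (grid (4 * L) m)); rewrite expr_div_n s3; lra.
- by move=> m; have [+ _ _] := CS m; rewrite ![1 / 2 + _]addrC !subrK.
- by move=> m; have [_ + _] := CS m; rewrite ![1 / 2 + _]addrC !subrK.
(* The inner disk gives f >= 0, so the case of negative values is empty. *)
- by move=> m; have := h12 (m.+1%:R * (2 * pi / (4 * L)%:R)); rewrite -/(grid _ _) => ? ?; lra.
Qed.

(** * Jung's theorem in the plane *)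

(* Three vectors of the same length making pairwise angles smaller than 120
   degrees lie in an open half-plane; here [x] and [y] make the largest angle. *)
Lemma dot_sum_gt0 (R : realType) (rho : R) (x y z : plane R) :
  0 < rho -> dot x x = rho -> dot y y = rho -> dot z z = rho -> - rho < 2 * dot x y ->
  dot x y <= dot z x -> dot x y <= dot z y -> 0 < dot z (x + y).
Proof.
move=> r0 xx yy zz m0 zx zy.
have -> : dot z (x + y) = dot z x + dot z y by rewrite /dot /=; ring.
rewrite ltNge; apply/negP => H.
(* The Gram determinant of three vectors of the plane vanishes. *)
have G : dot z z * (dot x x * dot y y - dot x y ^+ 2) =
   dot y y * dot z x ^+ 2 + dot x x * dot z y ^+ 2 - 2 * dot x y * dot z x * dot z y.
  by rewrite /dot /=; ring.
rewrite xx yy zz in G; move: (dot x y) (dot z x) (dot z y) m0 zx zy H G => m p q m0 zx zy H G.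
pose a := p - m; pose b := q - m; pose u := a + b.
have a0 : 0 <= a by rewrite subr_ge0.
have b0 : 0 <= b by rewrite subr_ge0.
have um : u <= - 2 * m by rewrite /u /a /b; lra.
have E : rho * (rho - m) * (rho + m) =
   rho * u * (u + 2 * m) - 2 * m ^+ 2 * u + 2 * m ^+ 2 * (rho - m) - 2 * (rho + m) * (a * b).
  by rewrite /u /a /b; lra.
have h1 : 0 <= rho * u * (- 2 * m - u) by rewrite !mulr_ge0 //; [exact: ltW|exact: addr_ge0|lra].
have h2 : 0 <= m ^+ 2 * u by rewrite mulr_ge0 ?sqr_ge0 // addr_ge0.
have h3 : 0 <= (rho + m) * (a * b) by rewrite mulr_ge0 ?mulr_ge0 //; lra.
have h4 : 0 < (rho - m) * ((rho - m) * (rho + 2 * m)).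
  have [mr|] := ltP m rho; first by rewrite !mulr_gt0 //; lra.
  by have : 0 <= u by [exact: addr_ge0]; lra.
by lra.
Qed.

Lemma continuous_dist2 (R : realType) (a : plane R) : continuous (fun x : plane R => dot (x - a) (x - a)).
Proof.
move=> x; rewrite /dot /=.
by apply: cvgD; apply: cvgM; apply: cvgB; try exact: cvg_cst; try exact: cvg_fst; exact: cvg_snd.
Qed.

Lemma continuous_dot_sub (R : realType) (c : plane R) :
  continuous (fun w : plane R * plane R => dot (w.1 - c) (w.2 - c)).
Proof.
move=> w; rewrite /dot /=.
have c1 : (fun w : plane R * plane R => w.1) @ w --> w.1 by exact: cvg_fst.
have c2 : (fun w : plane R * plane R => w.2) @ w --> w.2 by exact: cvg_snd.
have f1 (v : plane R) : (fun x : plane R => x.1) @ v --> v.1 by exact: cvg_fst.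
have f2 (v : plane R) : (fun x : plane R => x.2) @ v --> v.2 by exact: cvg_snd.
by apply: cvgD; apply: cvgM; apply: cvgB; try exact: cvg_cst;
  [exact: (cvg_comp _ _ c1 (f1 _))|exact: (cvg_comp _ _ c2 (f1 _))
  |exact: (cvg_comp _ _ c1 (f2 _))|exact: (cvg_comp _ _ c2 (f2 _))].
Qed.

Lemma compact_dist2_max (R : realType) (K : set (plane R)) (c : plane R) : compact K -> K !=set0 ->
  exists2 y, K y & forall x, K x -> dot (x - c) (x - c) <= dot (y - c) (y - c).
Proof.
move=> cK K0.
have [|y yK ymax] := @compact_EVT_max (plane R) R (fun x => dot (x - c) (x - c)) K K0 cK.
  exact/continuous_subspaceT/continuous_dist2.
by exists y; [exact: set_mem|move=> x xS; apply: ymax; exact: mem_set].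
Qed.

Lemma lipschitz_within_continuous (R : realType) (B : set (plane R)) (f : plane R -> R) (M : R) :
  0 < M -> (forall x y, B x -> B y -> f x - f y <= M * (`|x.1 - y.1| + `|x.2 - y.2|)) ->
  {within B, continuous f}.
Proof.
move=> M0 fM; apply/subspace_continuousP => x Bx.
apply/cvgrPdist_lt => e e0.
have d0 : 0 < e / (2 * M) by rewrite divr_gt0 // mulr_gt0.
near=> y.
have By : B y by near: y; exact: withinT.
have : ball x (e / (2 * M)) y.
  near: y; apply: cvg_within; exact: nbhsx_ballx.
move=> [/= h1 h2].
rewrite /ball /= in h1 h2.
have H1 := fM x y Bx By; have H2 := fM y x By Bx.
rewrite [`|y.1 - _|]distrC [`|y.2 - _|]distrC in H2.
have : M * (`|x.1 - y.1| + `|x.2 - y.2|) < e.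
  have -> : e = M * (e / (2 * M) + e / (2 * M)) by field; lra.
  by rewrite ltr_pM2l // ltrD.
by move=> H3; change (`|f x - f y| < (e : R)); rewrite ltr_norml; lra.
Unshelve. all: by end_near. Qed.

(** The centre and squared radius of the smallest enclosing disk. The largest squared distance to
    [K] is minimised over a box; outside it, this distance is at least its value at the origin. *)
Lemma jung_minimal_center (R : realType) (K : set (plane R)) : compact K -> K !=set0 ->
  exists c : plane R, exists2 r : R,
    (forall x, K x -> dot (x - c) (x - c) <= r) &
    (forall c', exists2 x, K x & r <= dot (x - c') (x - c')).
Proof.
move=> cK K0.
have [y0 y0K y0max] := compact_dist2_max 0 cK K0.
pose M := dot (y0 - 0) (y0 - 0) + 1.
have y00 : 0 <= dot (y0 - 0) (y0 - 0) by rewrite /dot; nra.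
have M1 : 1 <= M by rewrite /M; lra.
have KM x : K x -> [/\ - M <= x.1 <= M, - M <= x.2 <= M & dot x x <= M].
  move=> /y0max; rewrite subr0 => H; have {}H : dot x x <= M by rewrite /M; lra.
  by split=> //; rewrite /dot in H; apply/andP; split; nra.
have H c : exists y, K y /\ forall x, K x -> dot (x - c) (x - c) <= dot (y - c) (y - c).
  by have [y yK ymax] := compact_dist2_max c cK K0; exists y.
have [y yP] := choice H.
pose f c := dot (y c - c) (y c - c).
pose B : set (plane R) := `[- (3 * M), 3 * M]%classic `*` `[- (3 * M), 3 * M]%classic.
have cB : compact B by apply: compact_setX; exact: segment_compact.
have B0 : B 0 by split; rewrite /= in_itv /=; lra.
have [|c cBc cmin] := @compact_EVT_min (plane R) R f B (ex_intro _ _ B0) cB.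
  (* Centres have coordinates bounded by [3 * M] and points of [K] by [M], so
     [|u + v - 2 * w| <= 8 * M] in the difference of two squares. *)
  apply: (@lipschitz_within_continuous R B f (8 * M)); first by lra.
  move=> a b [/= ha1 ha2] [/= hb1 hb2]; rewrite !in_itv /= in ha1 ha2 hb1 hb2.
  have [yaK _] := yP a; have [_ yb] := yP b; have [k1 k2 _] := KM _ yaK.
  have := yb _ yaK; rewrite -/(f b) => H1.
  have : f a - f b <= dot (y a - a) (y a - a) - dot (y a - b) (y a - b) by rewrite /f in H1 *; lra.
  move=> H2; apply: le_trans H2 _; rewrite /dot /=.
  move: (y a) k1 k2 => z k1 k2.
  have n1 := ler_norm (a.1 - b.1); have n1' := ler_norm (- (a.1 - b.1)).
  have n2 := ler_norm (a.2 - b.2); have n2' := ler_norm (- (a.2 - b.2)).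
  rewrite normrN in n1'; rewrite normrN in n2'.
  have P (u v w n : R) : - M <= w <= M -> -(3 * M) <= u <= 3 * M -> - (3 * M) <= v <= 3 * M ->
     u - v <= n -> - (u - v) <= n -> (w - u) * (w - u) - (w - v) * (w - v) <= 8 * M * n.
    move=> hw hu hv h1 h2.
    have -> : (w - u) * (w - u) - (w - v) * (w - v) = (u - v) * (u + v - 2 * w) by ring.
    have hs : `|u + v - 2 * w| <= 8 * M by rewrite ler_norml; lra.
    apply: le_trans (ler_norm _) _; rewrite normrM mulrC ler_pM // ler_norml; lra.
  have := P a.1 b.1 z.1 _ k1 ha1 hb1 n1 n1'; have := P a.2 b.2 z.2 _ k2 ha2 hb2 n2 n2'; lra.
exists c, (f c); first by move=> x xK; have [_] := yP c; apply.
move=> c'; exists (y c'); first by have [] := yP c'.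
rewrite -/(f c'); have [Bc'|nB] := pselect (B c'); first by apply: cmin; exact: mem_set.
apply: le_trans (cmin 0 (mem_set B0)) _.
have f0 : f 0 <= M by have [yK _] := yP 0; have [_ _] := KM _ yK; rewrite /f !subr0.
apply: le_trans f0 _; rewrite leNgt; apply/negP => fc'; apply: nB.
have [yK _] := yP c'; have [k1 k2 _] := KM _ yK; rewrite /f /dot /= in fc'.
have sq (u v : R) : u * u + v * v < M -> - M < u < M by move=> ?; apply/andP; split; nra.
have h1 := sq _ _ fc'; rewrite addrC in fc'; have h2 := sq _ _ fc'.
by split; rewrite /= in_itv /=; lra.
Qed.

(** If the squared radius exceeded 1/3, points of [K] on the bounding circle would make angles below
    120 degrees, as their distances are at most 1. They would lie in an open half-plane, given by
    the pair making the largest angle, and moving the centre into it would shrink the disk. *)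
Lemma jung_plane (R : realType) (K : set (plane R)) : compact K -> K !=set0 ->
  (forall x y, K x -> K y -> dot (x - y) (x - y) <= 1) ->
  exists c : plane R, forall x, K x -> dot (x - c) (x - c) <= 1 / 3.
Proof.
move=> cK K0 diam; have [c [r rmax rmin]] := jung_minimal_center cK K0.
exists c => x0 x0K; apply: le_trans (rmax _ x0K) _; rewrite leNgt; apply/negP => r3.
pose P := K `&` [set x | dot (x - c) (x - c) = r].
have cP : compact P.
  apply: compact_closedI => //.
  have -> : [set x : plane R | dot (x - c) (x - c) = r] = (fun x => dot (x - c) (x - c)) @^-1` [set r].
    by apply/seteqP; split.
  by apply: closed_comp; [move=> ? _; exact: continuous_dist2|exact: closed_eq].
have [p Kp pr] := rmin c.
have Pp : P p by split=> //=; apply/eqP; rewrite eq_le rmax.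
have [|||[x y] /set_mem [/= [Kx xr] [Ky yr]] xymin] := @compact_EVT_min (plane R * plane R)%type R
    (fun w => dot (w.1 - c) (w.2 - c)) (P `*` P).
- by exists (p, p).
- exact: compact_setX.
- exact/continuous_subspaceT/continuous_dot_sub.
have {}xymin z t : P z -> P t -> dot (x - c) (y - c) <= dot (z - c) (t - c).
  by move=> Pz Pt; have := xymin (z, t); apply; exact: mem_set.
set m := dot (x - c) (y - c) in xymin.
have mr : - r < 2 * m.
  have := diam _ _ Kx Ky.
  have -> : dot (x - y) (x - y) = dot (x - c) (x - c) + dot (y - c) (y - c) - 2 * m.
    by rewrite /m /dot /=; ring.
  by rewrite xr yr; lra.
pose v := (x - c) + (y - c).
have r0 : 0 < r by lra.
have Pv z : P z -> 0 < dot (z - c) v.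
  move=> Pz; have Py : P y by []. have Px : P x by [].
  by apply: (@dot_sum_gt0 R r) => //; [case: Pz|exact: xymin|exact: xymin].
(* Positive on [K]: a point is on the circle, hence on the good side of the half-plane, or strictly
   inside the disk. Its minimum makes this uniform. *)
pose F z := Num.max (dot (z - c) v) (r - dot (z - c) (z - c)).
have cF : continuous F.
  pose F1 (z : plane R) : R^o := dot (z - c) v.
  pose F2 (z : plane R) : R^o := r - dot (z - c) (z - c).
  have c1 : continuous F1.
    by move=> z; rewrite /F1 /dot /=; apply: cvgD; apply: cvgM; try exact: cvg_cst; apply: cvgB;
      try exact: cvg_cst; [exact: cvg_fst|exact: cvg_snd].
  have c2 : continuous F2.
    by move=> z; apply: cvgB; [exact: cvg_cst|exact: continuous_dist2].
  by move=> z; exact: (continuous_max (c1 z) (c2 z)).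
have [|z0 /set_mem z0K Fmin] := @compact_EVT_min (plane R) R F K K0 cK.
  exact: continuous_subspaceT.
set e := F z0 in Fmin.
have e0 : 0 < e.
  rewrite /e /F lt_max; have [//|z0v] := ltP 0 (dot (z0 - c) v).
  rewrite orFb subr_gt0 lt_neqAle rmax // andbT; apply/eqP => z0r.
  by have := Pv z0 (conj z0K z0r); rewrite ltNge z0v.
(* Moving the centre by [t *: v] raises a squared distance by at most [8 * r * t], less than the
   margin [e]; on the side of [v] the linear gain [2 * t * e] beats the quadratic term. *)
pose t : R := Num.min 1 (e / (9 * r)).
have t0 : 0 < t by rewrite lt_min ltr01 divr_gt0 //; lra.
have t1 : t <= 1 by rewrite ge_min lexx.
have te : 9 * r * t <= e.
  have : t <= e / (9 * r) by rewrite ge_min lexx orbT.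
  by rewrite ler_pdivlMr; lra.
have [z zK] := rmin (c + t *: v).
have -> : dot (z - (c + t *: v)) (z - (c + t *: v)) =
    dot (z - c) (z - c) - 2 * t * dot (z - c) v + t ^+ 2 * dot v v.
  by rewrite /dot /= /GRing.scale /=; ring.
have vv : dot v v = 2 * r + 2 * m.
  have -> : dot v v = dot (x - c) (x - c) + dot (y - c) (y - c) + 2 * m.
    by rewrite /m /v /dot /=; ring.
  by rewrite xr yr; lra.
have mr2 : m <= r.
  have : 0 <= dot ((x - c) - (y - c)) ((x - c) - (y - c)) by exact: dot_ge0.
  have -> : dot ((x - c) - (y - c)) ((x - c) - (y - c)) = dot (x - c) (x - c) + dot (y - c) (y - c) - 2 * m.
    by rewrite /m /dot /=; ring.
  by rewrite xr yr; lra.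
have t2 : t ^+ 2 * dot v v <= 4 * r * t.
  have : t ^+ 2 * dot v v <= t * (4 * r) by apply: ler_pM; rewrite ?sqr_ge0 ?dot_ge0 ?vv //; nra.
  by lra.
have zr := rmax _ zK.
have zv : - (2 * r) <= dot (z - c) v.
  have : 0 <= dot (2 *: (z - c) + v) (2 *: (z - c) + v) by exact: dot_ge0.
  have -> : dot (2 *: (z - c) + v) (2 *: (z - c) + v) = 4 * dot (z - c) (z - c) + 4 * dot (z - c) v + dot v v.
    by rewrite /dot /= /GRing.scale /=; ring.
  by rewrite vv; lra.
have := Fmin z (mem_set zK); rewrite {1}/F le_max => /orP[h|h]; rewrite leNgt => /negP; apply.
  by have := ler_wpM2l (ltW t0) h; nra.
by have : - (2 * r) * t <= dot (z - c) v * t by [rewrite ler_wpM2r // ltW]; nra.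
Qed.

(** * Bodies of constant width and the hull of K and -K *)

Lemma dotC (R : realType) (x y : plane R) : dot x y = dot y x.
Proof. by rewrite /dot; ring. Qed.

Lemma dot_le0_eq0 (R : realType) (x : plane R) : dot x x <= 0 -> x = 0.
Proof.
rewrite /dot => H; have sq (a b : R) : a * a + b * b <= 0 -> a = 0.
  by move=> ?; apply/eqP; rewrite -sqrf_eq0 eq_le sqr_ge0 andbT; nra.
by rewrite [LHS]surjective_pairing (sq _ _ H); rewrite addrC in H; rewrite (sq _ _ H).
Qed.

Lemma enorm1_dot (R : realType) (u : plane R) : enorm u = 1 -> dot u u = 1.
Proof. by move=> u1; rewrite -enormE u1 expr1n. Qed.

Lemma direction_dot (R : realType) (a : R) : dot (direction a) (direction a) = 1.
Proof. by rewrite /dot /=; have := cos2Dsin2 a; rewrite !expr2. Qed.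

Lemma interior_direction (R : realType) (K : set (plane R)) (x u : plane R) : K° x -> dot u u = 1 ->
  exists2 t : R, 0 < t & K (x + t *: u).
Proof.
move=> [[U V] [/= /nbhs_ballP [e /= e0 eU] /nbhs_ballP [f /= f0 fV]] UV] u1.
have [u1r u2r] : -1 <= u.1 <= 1 /\ -1 <= u.2 <= 1.
  by move: u1; rewrite /dot => u1; split; apply/andP; split; nra.
pose t := Num.min e f / 2.
have m0 : 0 < Num.min e f by rewrite lt_min e0.
have te : 2 * t <= e by rewrite /t mulrC divfK // ge_min lexx.
have tf : 2 * t <= f by rewrite /t mulrC divfK // ge_min lexx orbT.
have t0 : 0 < t by rewrite divr_gt0.
exists t => //; apply: UV; split => /=; [apply: eU|apply: fV]; rewrite /ball /= ltr_norml /GRing.scale /=;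
  apply/andP; split; nra.
Qed.

Lemma interior_segment (R : realType) (K : set (plane R)) (u : plane R) : K° !=set0 -> dot u u = 1 ->
  exists x : plane R, exists2 t : R, 0 < t & K x /\ K (x + t *: u).
Proof.
move=> [x xK] u1; exists x; have [t t0 Kt] := interior_direction xK u1.
by exists t => //; split=> //; exact: interior_subset.
Qed.

Lemma constant_width_contact (R : realType) (K : set (plane R)) (z : plane R -> plane R) (u : plane R) :
  convex_body K -> constant_width 1 K ->
  (forall u, K (z u)) -> (forall u x, K x -> dot x u <= dot (z u) u) ->
  dot u u = 1 -> dot (z u - z (- u)) u = 1.
Proof.
move=> [_ _ iK] cw Kz zmax u1.
have nE x : dot x (- u) = - dot x u by rewrite /dot /=; ring.
have min x : K x -> dot u (z (- u)) <= dot u x.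
  by move=> /(zmax (- u)); rewrite !nE lerN2 ![dot u _]dotC.
have max x : K x -> dot u x <= dot u (z u) by move=> /(zmax u); rewrite ![dot u _]dotC.
(* [constant_width] speaks of distinct lines only; an interior point provides two points of [K] that
   separate the two support values. *)
have [x [t t0 [Kx Kxt]]] := interior_segment iK u1.
have lt : dot u (z (- u)) < dot u (z u).
  apply: le_lt_trans (min _ Kx) _; apply: lt_le_trans (max _ Kxt).
  have -> : dot u (x + t *: u) = dot u x + t * dot u u by rewrite /dot /= /GRing.scale /=; ring.
  by rewrite u1; lra.
have u1' : enorm u = 1 by rewrite /enorm u1 sqrtr1.
have := cw u (dot u (z u)) (dot u (z (- u))) u1'.
have h1 : dot u (z u) <> dot u (z (- u)) by move=> E; rewrite E ltxx in lt.
have h2 : supporting_line K u (dot u (z u)) by split; [exists (z u)|left].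
have h3 : supporting_line K u (dot u (z (- u))) by split; [exists (z (- u))|right].
move=> /(_ h1 h2 h3); rewrite gtr0_norm ?subr_gt0 // => <-.
by rewrite /dot /=; ring.
Qed.

Lemma constant_width_diam (R : realType) (K : set (plane R)) (z : plane R -> plane R) :
  convex_body K -> constant_width 1 K ->
  (forall u, K (z u)) -> (forall u x, K x -> dot x u <= dot (z u) u) ->
  forall x y, K x -> K y -> dot (x - y) (x - y) <= 1.
Proof.
move=> bK cw Kz zmax x y Kx Ky.
set D := enorm (x - y).
have DE : dot (x - y) (x - y) = D ^+ 2 by rewrite enormE.
have D0 : 0 <= D by exact: enorm_ge0.
rewrite DE; have [->|Dn] := eqVneq D 0; first by rewrite expr0n.
have Dp : 0 < D by rewrite lt_def Dn.
pose u := D^-1 *: (x - y).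
have u1 : dot u u = 1.
  have -> : dot u u = D^-1 ^+ 2 * dot (x - y) (x - y) by rewrite /u /dot /= /GRing.scale /=; ring.
  by rewrite DE -exprMn mulVf // expr1n.
have := constant_width_contact bK cw Kz zmax u1.
have nE w : dot w (- u) = - dot w u by rewrite /dot /=; ring.
have h1 := zmax u _ Kx; have := zmax (- u) _ Ky; rewrite !nE lerN2 => h2.
have -> : dot (z u - z (- u)) u = dot (z u) u - dot (z (- u)) u by rewrite /dot /=; ring.
have : dot x u - dot y u = D.
  have -> : dot x u - dot y u = D^-1 * dot (x - y) (x - y) by rewrite /u /dot /= /GRing.scale /=; ring.
  by rewrite DE expr2 mulKf.
by move=> h3 h4; have : D <= 1 by [lra]; nra.
Qed.

(** The chord joining opposite contact points has length at most 1 and component 1 along the unit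
    vector [u], so it is [u]. *)
Lemma constant_width_antipode (R : realType) (K : set (plane R)) (z : plane R -> plane R) (u : plane R) :
  convex_body K -> constant_width 1 K ->
  (forall u, K (z u)) -> (forall u x, K x -> dot x u <= dot (z u) u) ->
  dot u u = 1 -> z (- u) = z u - u.
Proof.
move=> bK cw Kz zmax u1.
have h1 := constant_width_contact bK cw Kz zmax u1.
have h2 := constant_width_diam bK cw Kz zmax (Kz u) (Kz (- u)).
set y := z u - z (- u) in h1 h2.
have : dot (y - u) (y - u) <= 0.
  have -> : dot (y - u) (y - u) = dot y y - 2 * dot y u + dot u u by rewrite /dot /=; ring.
  by rewrite h1 u1; lra.
move=> /dot_le0_eq0 /eqP; rewrite subr_eq0 => /eqP E.
have -> : z u - u = z u - y by rewrite E.
by rewrite /y opprB addrC subrK.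
Qed.

(** Since [K] is convex, combinations of one point of [K] and one of [- K] already form a convex
    set; it is a continuous image of the compact set of pairs and weights. *)
Lemma hull_antipodal (R : realType) (K : set (plane R)) : compact K -> @convex_set R (plane R) K -> K !=set0 ->
  [/\ compact (hull (K `|` (-%R @` K))), @convex_set R (plane R) (hull (K `|` (-%R @` K)))
    & forall x, hull (K `|` (-%R @` K)) x ->
      exists y w : plane R, exists t : R, [/\ K y, K w, 0 <= t <= 1 & x = t *: y - (1 - t) *: w]].
Proof.
move=> cK /convex_setE kK K0.
pose C : set (plane R) := [set x | exists y w : plane R, exists t : R,
   [/\ K y, K w, 0 <= t <= 1 & x = t *: y - (1 - t) *: w]].
have comb x y (a b : R) : K x -> K y -> 0 <= a -> 0 <= b -> exists2 v, K v & (a + b) *: v = a *: x + b *: y.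
  move=> Kx Ky a0 b0; have [ab|ab] := eqVneq (a + b) 0.
    have [-> ->] : a = 0 /\ b = 0 by split; lra.
    by exists x => //; rewrite addr0 !scale0r addr0.
  have abp : 0 < a + b by rewrite lt_def ab addr_ge0.
  exists ((a / (a + b)) *: x + (1 - a / (a + b)) *: y).
    apply: kK => //; apply/andP; split; first by rewrite divr_ge0 // ltW.
    by rewrite ler_pdivrMr //; lra.
  by rewrite scalerDr !scalerA; congr (_ *: _ + _ *: _); field.
have kC : @convex_set R (plane R) C.
  apply/convex_setE => x x' s /andP[s0 s1] [y [w [t [Ky Kw /andP[t0 t1] ->]]]] [y' [w' [t' [Ky' Kw' /andP[t0' t1'] ->]]]].
  have [|| v Kv vE] := comb y y' (s * t) ((1 - s) * t') Ky Ky'; try by apply: mulr_ge0; lra.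
  have [|| v' Kv' vE'] := comb w w' (s * (1 - t)) ((1 - s) * (1 - t')) Kw Kw'; try by apply: mulr_ge0; lra.
  exists v, v', (s * t + (1 - s) * t'); split=> //.
    by apply/andP; split; nra.
  rewrite vE (_ : 1 - (s * t + (1 - s) * t') = s * (1 - t) + (1 - s) * (1 - t')); last by ring.
  rewrite vE' !scalerBr !scalerA opprD; set A := (s * t) *: y; set B := _ *: y'.
  by rewrite addrACA.
have KC : K `|` (-%R @` K) `<=` C.
  have [k Kk] := K0; move=> x [Kx|[y Ky <-]].
    by exists x, k, 1; rewrite subrr scale0r subr0 scale1r; split=> //; lra.
  by exists k, y, 0; rewrite scale0r sub0r subr0 scale1r; split=> //; lra.
have hC : hull (K `|` (-%R @` K)) = C.
  apply/seteqP; split; first by apply: smallest_sub.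
  move=> x [y [w [t [Ky Kw tI ->]]]] B [/convex_setE kB KB].
  rewrite -scalerN; apply: kB => //; apply: KB; first by left.
  by right; exists w.
rewrite hC; split=> //.
pose f (q : (plane R * plane R) * R^o) : plane R := q.2 *: q.1.1 - (1 - q.2) *: q.1.2.
have -> : C = f @` ((K `*` K) `*` `[0, 1]%classic).
  apply/seteqP; split.
    move=> x [y [w [t [Ky Kw tI ->]]]]; exists ((y, w), t); last by [].
    by split; [split|rewrite /= in_itv].
  move=> x [[[y w] t] [[/= Ky Kw] tI] <-]; by exists y, w, t.
apply: continuous_compact; last by apply: compact_setX; [exact: compact_setX|exact: segment_compact].
apply: continuous_subspaceT => q.
have c1 : (fun q : (plane R * plane R) * R^o => q.1) @ q --> q.1 by exact: cvg_fst.
have c2 : (fun q : (plane R * plane R) * R^o => q.2) @ q --> q.2 by exact: cvg_snd.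
have d1 : (fun q : plane R * plane R => q.1) @ q.1 --> q.1.1 by exact: cvg_fst.
have d2 : (fun q : plane R * plane R => q.2) @ q.1 --> q.1.2 by exact: cvg_snd.
have one : (fun _ : (plane R * plane R) * R^o => 1 : R^o) @ q --> (1 : R^o) by exact: cvg_cst.
exact: (cvgB (cvgZ c2 (cvg_comp _ _ c1 d1)) (cvgZ (cvgB one c2) (cvg_comp _ _ c1 d2))).
Qed.

(* [v] is the trace of a translation, a solution of the discrete analogue of v'' + v = 0. *)
Lemma polygon_functional_translate (R : realType) (N : nat) (c s T : R) (f v : nat -> R) :
  s != 0 -> T * s = 1 - c -> (forall m, f (m + N)%N = f m) -> (forall m, v (m + N)%N = v m) ->
  (forall m, v m.+2 + v m = 2 * c * v m.+1) ->
  polygon_functional N s T (fun m => f m + v m) = polygon_functional N s T f.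
Proof.
move=> s0 Ts fN vN vv.
rewrite (polygon_functionalE s0 Ts fN) (polygon_functionalE s0 Ts) => [|m]; last by rewrite fN vN.
congr (_ + _ * _).
have S1 := @periodic_sumS R N (fun m => f m * v m) ltac:(by move=> m /=; rewrite fN vN).
have S2 := @periodic_sumS R N (fun m => f m * v m.+1) ltac:(by move=> m /=; rewrite -addSn fN vN).
have S3 := @periodic_sumS R N (fun m => v m * v m) ltac:(by move=> m /=; rewrite vN).
have S4 := @periodic_sumS R N (fun m => v m * v m.+1) ltac:(by move=> m /=; rewrite -addSn !vN).
have Efv : 2 * c * \sum_(m < N) f m.+1 * v m.+1 = \sum_(m < N) f m.+1 * v m.+2 + \sum_(m < N) f m.+1 * v m.
  by rewrite mulr_sumr -big_split; apply: eq_bigr => m _ /=; rewrite -mulrDr vv; ring.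
have Evv : 2 * c * \sum_(m < N) v m.+1 * v m.+1 = \sum_(m < N) v m.+1 * v m.+2 + \sum_(m < N) v m * v m.+1.
  by rewrite mulr_sumr -big_split; apply: eq_bigr => m _ /=; rewrite [v m * _]mulrC -mulrDr vv; ring.
rewrite S1 S2 in Efv; rewrite S3 S4 in Evv.
have -> : \sum_(m < N) (f m + v m) ^+ 2 = \sum_(m < N) f m ^+ 2 + 2 * \sum_(m < N) f m * v m + \sum_(m < N) v m * v m.
  by rewrite mulr_sumr -!big_split; apply: eq_bigr => m _ /=; ring.
have -> : \sum_(m < N) (f m + v m) * (f m.+1 + v m.+1) = \sum_(m < N) f m * f m.+1 +
    \sum_(m < N) f m * v m.+1 + \sum_(m < N) f m.+1 * v m + \sum_(m < N) v m * v m.+1.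
  by rewrite -!big_split; apply: eq_bigr => m _ /=; ring.
by lra.
Qed.

Lemma polygon_functional_norm (R : realType) (N : nat) (s T : R) (f : nat -> R) : 0 < s ->
  polygon_functional N s T (fun m => `|f m|) <= polygon_functional N s T f.
Proof.
move=> s0; rewrite /polygon_functional lerD //.
  rewrite le_eqVlt; apply/orP; left; apply/eqP; congr (_ * _).
  by apply: eq_bigr => m _; rewrite real_normK ?num_real.
apply: ler_wpM2l; first by rewrite invr_ge0 mulr_ge0 // ltW.
apply: ler_sum => m _.
have H := ler_dist_dist (f m.+1) (f m).
by rewrite -(real_normK (num_real (`|_| - _))) -(real_normK (num_real (f m.+1 - f m))) ler_sqr ?nnegrE.
Qed.

Lemma constant_width_length_bound (R : realType) (K : set (plane R)) :
  convex_body K -> constant_width 1 K ->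
  forall n p, (0 < n)%N -> convex_order n p ->
  (forall i, (i < n)%N -> hull (K `|` (-%R @` K)) (p i)) ->
  ((2^-1 * polygon_length n p)%:E <= area (hull (K `|` (-%R @` K))) + (Num.sqrt 3 / 2)%:E)%E.
Proof.
move=> bK cw; have [cK kK [k0 /interior_subset Kk0]] := bK.
have K0 : K !=set0 by exists k0.
have [cS kS Sdec] := hull_antipodal cK kK K0.
set S := hull _ in cS kS Sdec *.
have [z Kz zmax] := contact_map cK K0.
have clS : closed S by apply: compact_closed => //; exact: norm_hausdorff.
have KS x : K x -> S x by move=> Kx B [_ KB]; apply: KB; left.
have NS x : K x -> S (- x) by move=> Kx B [_ KB]; apply: KB; right; exists x.
have nE (x u : plane R) : dot x (- u) = - dot x u by rewrite /dot /=; ring.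
have nE' (x u : plane R) : dot (- x) u = - dot x u by rewrite /dot /=; ring.
have S0 : S 0.
  have /convex_setE := kS => /(_ k0 (- k0) (1 / 2) _ (KS _ Kk0) (NS _ Kk0)).
  have h : 0 <= (1 / 2 : R) <= 1 by lra.
  by move=> /(_ h); rewrite scalerN -scalerBl (_ : 1 / 2 - _ = 0) ?scale0r //; lra.
(* The higher of the contact points of [K] and of [- K] is a contact point of the hull. *)
pose zS u := if 0 <= dot (z u) u - dot (z (- u)) (- u) then z u else - z (- u).
have SzS u : S (zS u) by rewrite /zS; case: ifP => _; [exact: KS|exact: NS].
have zSmax u x : S x -> dot x u <= dot (zS u) u.
  move=> /Sdec [y [w [t [Ky Kw /andP[t0 t1] ->]]]].
  have -> : dot (t *: y - (1 - t) *: w) u = t * dot y u + (1 - t) * dot w (- u).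
    by rewrite /dot /= /GRing.scale /=; ring.
  have h1 := zmax u _ Ky; have h2 := zmax (- u) _ Kw.
  have h1' := ler_wpM2l t0 h1; have h2' : (1 - t) * dot w (- u) <= (1 - t) * dot (z (- u)) (- u).
    by rewrite ler_wpM2l // subr_ge0.
  rewrite /zS; case: ifP => [h|/negbT]; first by nra.
  by rewrite -ltNge => h; rewrite nE' -nE; nra.
pose f u := dot (z u) u - 1 / 2.
have anti u : dot u u = 1 -> z (- u) = z u - u by move=> u1; exact: (constant_width_antipode bK cw Kz zmax u1).
have fN u : dot u u = 1 -> f (- u) = - f u.
  move=> u1; rewrite /f anti // nE.
  have -> : dot (z u - u) u = dot (z u) u - dot u u by rewrite /dot /=; ring.
  by rewrite u1; lra.
have zSf u : dot u u = 1 -> dot (zS u) u - 1 / 2 = `|f u|.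
  move=> u1; have := fN u u1; rewrite /zS /f; case: ifP => [h|/negbT].
    by move=> E; rewrite ger0_norm //; lra.
  by rewrite -ltNge => h E; rewrite nE' -nE ltr0_norm; lra.
have [rb Krb rmax] := compact_dist2_max 0 cS (ex_intro _ _ S0).
pose r : R := dot (rb - 0) (rb - 0) + 1.
have r0 : 0 <= dot (rb - 0) (rb - 0) by exact: dot_ge0.
have Sr x : S x -> dot x x <= r ^+ 2 by move=> /rmax; rewrite subr0 /r => ?; nra.
have h12 a : 1 / 2 <= dot (zS (direction a)) (direction a).
  by have := zSf _ (direction_dot a); have := normr_ge0 (f (direction a)); lra.
apply: (half_length_limit clS kS S0 _ Sr SzS zSmax h12); first by rewrite /r; lra.
move=> w wI; have [L0 H] := polygon_functional_annulus wI.
exists (maxn L0 1) => L d T; rewrite gtn_max => /andP[LL0 L1] dE TE.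
set N := (4 * L)%N in dE *.
have N0 : (0 < N)%N by rewrite muln_gt0 /= ltnW.
have [c cmax] := jung_plane cK K0 (constant_width_diam bK cw Kz zmax).
have := grid_parameters L1 dE; rewrite -TE => -[[d0 d1 s0 sd s1] [cs Ts T0 Td c12] ch0 TN].
have g1 m : dot (grid N m) (grid N m) = 1 :> R by exact: direction_dot.
pose fm m := f (grid N m).
have -> : polygon_functional N (sin d) T (fun m => dot (zS (grid N m)) (grid N m) - 1 / 2) =
    polygon_functional N (sin d) T (fun m => `|fm m|).
  by congr (polygon_functional _ _ _ _); apply/funext => m; exact: zSf.
apply: le_trans (polygon_functional_norm N T fm s0) _.
(* Change of the support function when the centre given by Jung's theorem is moved to the origin. *)
pose v m := - dot c (grid N m).
have fmN m : fm (m + N)%N = fm m by rewrite /fm grid_periodic.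
have vN m : v (m + N)%N = v m by rewrite /v grid_periodic.
have vv m : v m.+2 + v m = 2 * cos d * v m.+1.
  have E k : @grid R N k = direction (k%:R * d) by rewrite /grid -dE.
  have E2 : @grid R N m.+2 = direction (m.+1%:R * d + d) by rewrite E -[m.+2%:R]natr1 mulrDl mul1r.
  have E0 : @grid R N m = direction (m.+1%:R * d + - d) by rewrite E -natr1 mulrDl mul1r addrK.
  by rewrite /v E2 E0 !dot_direction_rotate -E cosN sinN; ring.
rewrite -(polygon_functional_translate (lt0r_neq0 s0) Ts fmN vN vv).
pose K' : set (plane R) := [set x | K (x + c)].
pose z' u := z u - c.
have Kz' u : K' (z' u) by rewrite /K' /z' /= subrK.
have zmax' u x : K' x -> dot x u <= dot (z' u) u.
  move=> /(zmax u); rewrite /z'.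
  have -> : dot (x + c) u = dot x u + dot c u by rewrite /dot /=; ring.
  by have -> : dot (z u - c) u = dot (z u) u - dot c u by [rewrite /dot /=; ring]; lra.
have CS := contact_steps dE Kz' zmax'.
pose F m := fm m + v m.
have FE m : 1 / 2 + F m = dot (z' (grid N m)) (grid N m).
  by rewrite /F /fm /f /v /z' /dot /=; ring.
pose g m := det (grid N m) (z' (grid N m)).
have F2L m : F (m + 2 * L)%N = - F m.
  have L0' : (0 < L)%N by exact: ltnW.
  by rewrite /F /fm /v /N !grid_antipodal // fN ?g1 // nE; ring.
have lo m : (1 / 2 + F m) * cos d + g m * sin d <= 1 / 2 + F m.+1.
  by rewrite !FE; have [] := CS m.
have hi m : (1 / 2 + F m.+1) * cos d - g m.+1 * sin d <= 1 / 2 + F m.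
  by rewrite !FE; have [] := CS m.
have low m : - (1 - cos d) <= F m.+2 + F m - 2 * cos d * F m.+1.
  by have := lo m.+1; have := hi m; lra.
apply: (H L d T F g) => //.
- by move=> m; rewrite /F fmN vN.
- move=> m.
  have h1 : (1 / 2 + F m) ^+ 2 + g m ^+ 2 <= 1 / 3.
    by rewrite FE; have [_ _ ->] := CS m; exact: cmax.
  (* The opposite contact point is [z' - u], with coordinates [F m - 1 / 2] and [g m], and lies in
     the same disk. The two bounds together give the one with [|F m|]. *)
  have h2 : (1 / 2 - F m) ^+ 2 + g m ^+ 2 <= 1 / 3.
    have := cmax _ (Kz (- grid N m)); rewrite anti ?g1 //.
    have -> : z (grid N m) - grid N m - c = z' (grid N m) - grid N m by rewrite /z' addrAC.
    have -> : dot (z' (grid N m) - grid N m) (z' (grid N m) - grid N m) =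
       dot (z' (grid N m)) (z' (grid N m)) - 2 * dot (z' (grid N m)) (grid N m) + dot (grid N m) (grid N m).
      by rewrite /dot /=; ring.
    by have [_ _ <-] := CS m; rewrite -FE -/(g m) g1; lra.
  by have [F0|F0] := leP 0 (F m); [rewrite ger0_norm|rewrite ltr0_norm].
(* Half a turn changes the sign of [F], so convexity at the opposite direction is the required upper
   bound. *)
- move=> m _; have := low (m + 2 * L)%N.
  by rewrite -!addSn !F2L; lra.
Qed.

(** * The hexagon spanned by two consecutive vertices *)

(* [a] and [b] are consecutive vertices of a regular hexagon of circumradius
   [1 / sqrt 3], the other vertices being [b - a], [- a], [- b] and [a - b]. *)
Definition hexagon_frame {R : realType} (a b : plane R) : Prop :=
  [/\ dot a a = 1 / 3, dot b b = 1 / 3, dot a b = 1 / 6 & 0 < det a b].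

(** In the basis [a], [b] the lines carrying the sides are [p = 1], [q = 1], [p + q = 1] and their
    opposites, so membership becomes linear arithmetic. *)
Definition frame_hexagon {R : realType} (a b : plane R) : set (plane R) :=
  [set x | exists p q : R, [/\ x = p *: a + q *: b, -1 <= p <= 1, -1 <= q <= 1 & -1 <= p + q <= 1]].

Lemma frame_det (R : realType) (a b : plane R) : hexagon_frame a b -> det a b = Num.sqrt 3 / 6.
Proof.
move=> [aa bb ab D0].
have D2 : det a b ^+ 2 = 1 / 12.
  have -> : det a b ^+ 2 = dot a a * dot b b - dot a b ^+ 2 by rewrite /det /dot; ring.
  by rewrite aa bb ab; lra.
have s3 := sqrt3_sq R; have s30 : 0 <= Num.sqrt 3 :> R by exact: sqrtr_ge0.
have n1 := ltW D0; have n2 : 0 <= Num.sqrt 3 / 6 :> R by exact: divr_ge0.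
apply/eqP; rewrite -(@eqrXn2 _ 2) //.
by rewrite D2 expr_div_n s3; apply/eqP; field.
Qed.

Lemma frame_coord (R : realType) (a b x : plane R) : 0 < det a b ->
  x = (det x b / det a b) *: a + (det a x / det a b) *: b.
Proof.
move=> D0.
have E (p q u : R) : det x b * p + det a x * q = u * det a b -> u = det x b / det a b * p + det a x / det a b * q.
  by move=> E; rewrite -[LHS](mulfK (lt0r_neq0 D0)) -E; field; exact: lt0r_neq0.
rewrite [LHS]surjective_pairing; congr pair; apply: E; rewrite /det; ring.
Qed.

Lemma dot_comb (R : realType) (p q : R) (a b u : plane R) :
  dot (p *: a + q *: b) u = p * dot a u + q * dot b u.
Proof. by rewrite /dot /= /GRing.scale /=; ring. Qed.

Lemma plane_eq (R : realType) (x y : plane R) : (x.1 : R) = y.1 -> (x.2 : R) = y.2 -> x = y.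
Proof. by case: x y => x1 x2 [y1 y2] /= -> ->. Qed.

Lemma fstD_plane (R : realType) (x y : plane R) : (x + y).1 = x.1 + y.1 :> R.
Proof. by []. Qed.

Lemma sndD_plane (R : realType) (x y : plane R) : (x + y).2 = x.2 + y.2 :> R.
Proof. by []. Qed.

Lemma fstN_plane (R : realType) (x : plane R) : (- x).1 = - x.1 :> R.
Proof. by []. Qed.

Lemma sndN_plane (R : realType) (x : plane R) : (- x).2 = - x.2 :> R.
Proof. by []. Qed.

Lemma fstZ_plane (R : realType) (x : plane R) (t : R) : (t *: x).1 = t * x.1 :> R.
Proof. by []. Qed.

Lemma sndZ_plane (R : realType) (x : plane R) (t : R) : (t *: x).2 = t * x.2 :> R.
Proof. by []. Qed.

Definition plane_coordE {R : realType} :=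
  (@fstD_plane R, @sndD_plane R, @fstN_plane R, @sndN_plane R, @fstZ_plane R, @sndZ_plane R).

Lemma dotDr (R : realType) (x a b : plane R) : dot x (a + b) = dot x a + dot x b.
Proof. by rewrite /dot /=; ring. Qed.

Lemma dotNr (R : realType) (x a : plane R) : dot x (- a) = - dot x a.
Proof. by rewrite /dot /=; ring. Qed.

Lemma dotZr (R : realType) (t : R) (x a : plane R) : dot x (t *: a) = t * dot x a.
Proof. by rewrite /dot /= /GRing.scale /=; ring. Qed.

(* The three strips are bounded by the lines carrying opposite sides. *)
Lemma frame_hexagonP (R : realType) (a b x : plane R) : hexagon_frame a b ->
  `|dot x (a + b)| <= 1 / 2 -> `|dot x (2 *: b - a)| <= 1 / 2 -> `|dot x (b - 2 *: a)| <= 1 / 2 ->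
  frame_hexagon a b x.
Proof.
move=> [aa bb ab D0]; rewrite (frame_coord x D0).
move: (det x b / _) (det a x / _) => p q; rewrite !dot_comb.
rewrite !(dotDr, dotNr, dotZr) [dot b a]dotC aa bb ab.
rewrite !ler_norml => h1 h2 h3.
by exists p, q; split=> //; lra.
Qed.

Lemma convex_frame_hexagon (R : realType) (a b : plane R) : @convex_set R (plane R) (frame_hexagon a b).
Proof.
apply/convex_setE => x y t tI [p [q [-> pI qI pqI]]] [p' [q' [-> pI' qI' pqI']]].
have cv (u v : R) : -1 <= u <= 1 -> -1 <= v <= 1 -> -1 <= t * u + (1 - t) * v <= 1 by nra.
exists (t * p + (1 - t) * p'), (t * q + (1 - t) * q'); split; first last.
- by have := cv _ _ pqI pqI'; lra.
- exact: cv.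
- exact: cv.
by rewrite !scalerDr !scalerA addrACA -!scalerDl.
Qed.

(** The signs of [p], [q] and [p + q] select one of the six triangles joining 0 to a side. *)
Lemma frame_hexagon_sub (R : realType) (a b : plane R) (C : set (plane R)) : @convex_set R (plane R) C ->
  C a -> C b -> C (b - a) -> C (- a) -> C (- b) -> C (a - b) -> frame_hexagon a b `<=` C.
Proof.
move=> /convex_setE cC Ca Cb Cc Cna Cnb Cnc.
have C0 : C 0.
  have h : 0 <= (1 / 2 : R) <= 1 by lra.
  by have := cC _ _ _ h Ca Cna; rewrite scalerN -scalerBl (_ : 1 / 2 - _ = 0) ?scale0r //; lra.
have tri x y (p q : R) : C x -> C y -> 0 <= p -> 0 <= q -> p + q <= 1 -> C (p *: x + q *: y).
  move=> Cx Cy p0 q0 pq; have [E|ne] := eqVneq (p + q) 0.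
    have [-> ->] : p = 0 /\ q = 0 by split; lra.
    by rewrite !scale0r addr0.
  have pqp : 0 < p + q by rewrite lt_def ne addr_ge0.
  have h : 0 <= p / (p + q) <= 1.
    by apply/andP; split; [rewrite divr_ge0 // ltW|rewrite ler_pdivrMr //; lra].
  have h' : 0 <= p + q <= 1 by rewrite addr_ge0.
  have := cC _ _ _ h' (cC _ _ _ h Cx Cy) C0.
  rewrite scaler0 addr0 scalerDr !scalerA mulrC divfK // mulrBr mulr1 [(p + q) * _]mulrC divfK //.
  by rewrite (addrC p) addrK.
move=> x [p [q [-> pI qI pqI]]].
have [p0|p0] := leP 0 p; have [q0|q0] := leP 0 q.
- by apply: tri => //; lra.
- have [pq0|pq0] := leP 0 (p + q).
    rewrite (_ : _ + _ = (p + q) *: a + (- q) *: (a - b)); first by apply: tri => //; lra.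
    by apply: plane_eq; rewrite !plane_coordE; ring.
  rewrite (_ : _ + _ = p *: (a - b) + (- (p + q)) *: (- b)); first by apply: tri => //; lra.
  by apply: plane_eq; rewrite !plane_coordE; ring.
- have [pq0|pq0] := leP 0 (p + q).
    rewrite (_ : _ + _ = (- p) *: (b - a) + (p + q) *: b); first by apply: tri => //; lra.
    by apply: plane_eq; rewrite !plane_coordE; ring.
  rewrite (_ : _ + _ = q *: (b - a) + (- (p + q)) *: (- a)); first by apply: tri => //; lra.
  by apply: plane_eq; rewrite !plane_coordE; ring.
- rewrite (_ : _ + _ = (- p) *: (- a) + (- q) *: (- b)); first by apply: tri => //; lra.
  by rewrite !scalerN !scaleNr !opprK.
Qed.

Lemma frame_hexagon_vertices (R : realType) (a b : plane R) :
  [/\ frame_hexagon a b a, frame_hexagon a b b, frame_hexagon a b (b - a)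
    & [/\ frame_hexagon a b (- a), frame_hexagon a b (- b) & frame_hexagon a b (a - b)]].
Proof.
have V (p q : R) : -1 <= p <= 1 -> -1 <= q <= 1 -> -1 <= p + q <= 1 ->
    forall x, x = p *: a + q *: b -> frame_hexagon a b x.
  by move=> h1 h2 h3 x ->; exists p, q.
have Va := V 1 0 ltac:(lra) ltac:(lra) ltac:(lra); have Vna := V (-1) 0 ltac:(lra) ltac:(lra) ltac:(lra).
have Vb := V 0 1 ltac:(lra) ltac:(lra) ltac:(lra); have Vnb := V 0 (-1) ltac:(lra) ltac:(lra) ltac:(lra).
have Vc := V (-1) 1 ltac:(lra) ltac:(lra) ltac:(lra); have Vnc := V 1 (-1) ltac:(lra) ltac:(lra) ltac:(lra).
by split; [apply: Va|apply: Vb|apply: Vc|split; [apply: Vna|apply: Vnb|apply: Vnc]];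
  apply: plane_eq; rewrite !plane_coordE; ring.
Qed.

Lemma frame_hexagon_opp (R : realType) (a b x : plane R) : frame_hexagon a b x -> frame_hexagon a b (- x).
Proof.
move=> [p [q [-> pI qI pqI]]]; exists (- p), (- q); split; [by rewrite opprD !scaleNr|lra|lra|lra].
Qed.

(** * The Reuleaux triangle *)

Definition reuleaux {R : realType} (p q s : plane R) : set (plane R) :=
  [set x | [/\ dot (x - p) (x - p) <= 1, dot (x - q) (x - q) <= 1 & dot (x - s) (x - s) <= 1]].

Lemma dot_le1 (R : realType) (x y : plane R) : dot x x <= 1 -> dot y y <= 1 -> dot x y <= 1.
Proof.
move=> xx yy; have := dot_ge0 (x - y).
have -> : dot (x - y) (x - y) = dot x x + dot y y - 2 * dot x y by rewrite /dot /=; ring.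
by lra.
Qed.

(** For [u] in the cone of 60 degrees at the vertex [V], the point [V + u] is on the arc centred at
    [V], and the lines orthogonal to [u] through [V] and [V + u] enclose the triangle. *)
Lemma reuleaux_cone (R : realType) (V W W' u : plane R) (l m : R) :
  let d := W - V in let d' := W' - V in
  dot d d = 1 -> dot d' d' = 1 -> dot d d' = 1 / 2 -> 0 <= l -> 0 <= m ->
  u = l *: d + m *: d' -> dot u u = 1 ->
  [/\ reuleaux V W W' V, reuleaux V W W' (V + u)
    & forall x, reuleaux V W W' x -> 0 <= dot (x - V) u <= 1].
Proof.
move=> d d' dd dd' ddd l0 m0 uE u1.
have dE (x : plane R) : x - W = (x - V) - d by rewrite /d opprB addrA subrK.
have dE' (x : plane R) : x - W' = (x - V) - d' by rewrite /d' opprB addrA subrK.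
clearbody d d'.
have sq (y e : plane R) : dot (y - e) (y - e) = dot y y - 2 * dot y e + dot e e by rewrite /dot /=; ring.
have lm : l ^+ 2 + l * m + m ^+ 2 = 1.
  by rewrite -u1 uE dot_comb !(dotDr, dotZr) [dot d' d]dotC dd dd' ddd; field.
have lm1 : 1 <= l + m by rewrite leNgt; apply/negP => H; nra.
have lr : l <= 1 by rewrite leNgt; apply/negP => H; nra.
have mr : m <= 1 by rewrite leNgt; apply/negP => H; nra.
have ud : dot u d = l + m / 2 by rewrite uE dot_comb [dot d' d]dotC dd ddd; field.
have ud' : dot u d' = l / 2 + m by rewrite uE dot_comb dd' ddd; field.
split.
- split; [rewrite subrr|rewrite dE subrr|rewrite dE' subrr]; rewrite ?sq ?dd ?dd' /dot /=; lra.
- have -> : V + u = u + V by rewrite addrC.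
  by split; rewrite ?dE ?dE' addrK ?sq u1 // ?dd ?dd' ?ud ?ud'; lra.
- move=> x [h1 h2 h3]; apply/andP; split; last by apply: dot_le1 => //; rewrite u1.
  (* The unit disk around [W] gives [2 * dot (x - V) d >= dot (x - V) (x - V) >= 0], and likewise
     for [W']. *)
  rewrite dE sq dd in h2; rewrite dE' sq dd' in h3.
  have := dot_ge0 (x - V) => h0.
  rewrite uE dotDr !dotZr addr_ge0 // mulr_ge0 //; lra.
Qed.

Lemma reuleauxC (R : realType) (p q s : plane R) : reuleaux p q s = reuleaux q s p.
Proof. by apply/seteqP; split => x [h1 h2 h3]; split. Qed.

Lemma dist2_convex (R : realType) (p x y : plane R) (t r : R) : 0 <= t <= 1 ->
  dot (x - p) (x - p) <= r -> dot (y - p) (y - p) <= r ->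
  dot (t *: x + (1 - t) *: y - p) (t *: x + (1 - t) *: y - p) <= r.
Proof.
move=> /andP[t0 t1] hx hy.
have -> : dot (t *: x + (1 - t) *: y - p) (t *: x + (1 - t) *: y - p) =
  t * dot (x - p) (x - p) + (1 - t) * dot (y - p) (y - p) - t * (1 - t) * dot (x - y) (x - y).
  by rewrite /dot !plane_coordE; ring.
have := mulr_ge0 (mulr_ge0 t0 (_ : 0 <= 1 - t)) (dot_ge0 (x - y)); rewrite subr_ge0 => /(_ t1).
by nra.
Qed.

Lemma reuleaux_convex (R : realType) (p q s : plane R) : @convex_set R (plane R) (reuleaux p q s).
Proof.
by apply/convex_setE => x y t tI [h1 h2 h3] [k1 k2 k3]; split; apply: dist2_convex.
Qed.

Lemma reuleaux_compact (R : realType) (p q s : plane R) : compact (reuleaux p q s).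
Proof.
have cD (c : plane R) : closed [set x : plane R | dot (x - c) (x - c) <= 1].
  have -> : [set x : plane R | dot (x - c) (x - c) <= 1] = (fun x => dot (x - c) (x - c)) @^-1` [set y | y <= 1].
    by apply/seteqP; split.
  by apply: closed_comp; [move=> ? _; exact: continuous_dist2|exact: closed_le].
pose B : set (plane R) := `[p.1 - 1, p.1 + 1]%classic `*` `[p.2 - 1, p.2 + 1]%classic.
have cB : compact B by apply: compact_setX; exact: segment_compact.
apply: (subclosed_compact _ cB).
  have -> : reuleaux p q s = [set x | dot (x - p) (x - p) <= 1] `&`
     ([set x | dot (x - q) (x - q) <= 1] `&` [set x | dot (x - s) (x - s) <= 1]).
    by apply/seteqP; split => x; [case=> h1 h2 h3; split|case=> h1 [h2 h3]; split].
  by apply: closedI; [exact: cD|apply: closedI; exact: cD].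
have sq (u v : R) : u * u + v * v <= 1 -> -1 <= u <= 1 by move=> ?; apply/andP; split; nra.
move=> x [h _ _]; have h1 := sq _ _ h; rewrite /dot addrC in h; have h2 := sq _ _ h.
by rewrite !plane_coordE in h1 h2; split; rewrite /= in_itv /=; lra.
Qed.

Lemma reuleaux_interior (R : realType) (p q s : plane R) :
  dot p p = 1 / 3 -> dot q q = 1 / 3 -> dot s s = 1 / 3 -> (reuleaux p q s)° !=set0.
Proof.
move=> pp qq ss; exists 0; apply/nbhs_ballP; exists (1 / 4) => /=; first by lra.
move=> x [/= h1 h2]; rewrite /ball /= !sub0r !normrN !ltr_norml in h1 h2.
have xx : dot x x <= 1 / 8 by rewrite /dot; nra.
have D (c : plane R) : dot c c = 1 / 3 -> dot (x - c) (x - c) <= 1.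
  move=> cc; have := dot_ge0 (x + c).
  have -> : dot (x + c) (x + c) = dot x x + dot c c + 2 * dot x c by rewrite /dot /=; ring.
  have -> : dot (x - c) (x - c) = dot x x + dot c c - 2 * dot x c by rewrite /dot /=; ring.
  by rewrite cc; lra.
by split; apply: D.
Qed.

Lemma frame_dots (R : realType) (a b : plane R) : hexagon_frame a b ->
  let e1 := a + b in let e2 := 2 *: b - a in let e3 := b - 2 *: a in
  [/\ [/\ dot e1 e1 = 1, dot e2 e2 = 1 & dot e3 e3 = 1],
      [/\ dot e1 e2 = 1 / 2, dot e2 e3 = 1 / 2 & dot e1 e3 = - (1 / 2)],
      [/\ dot a e1 = 1 / 2, dot a e2 = 0 & dot a e3 = - (1 / 2)],
      [/\ dot b e1 = 1 / 2, dot b e2 = 1 / 2 & dot b e3 = 0] & 0 < det e1 e3].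
Proof.
move=> [aa bb ab D0] e1 e2 e3.
have ba : dot b a = 1 / 6 by rewrite dotC.
have DE : det e1 e3 = 3 * det a b by rewrite /e1 /e3 /det !plane_coordE; ring.
have E1 x : dot x e1 = dot x a + dot x b by rewrite dotDr.
have E2 x : dot x e2 = 2 * dot x b - dot x a by rewrite dotDr dotNr dotZr.
have E3 x : dot x e3 = dot x b - 2 * dot x a by rewrite dotDr dotNr dotZr.
have F1 x : dot e1 x = dot a x + dot b x by rewrite dotC E1 ![dot x _]dotC.
have F2 x : dot e2 x = 2 * dot b x - dot a x by rewrite dotC E2 ![dot x _]dotC.
have F3 x : dot e3 x = dot b x - 2 * dot a x by rewrite dotC E3 ![dot x _]dotC.
rewrite !(F1, F2, F3) !(E1, E2, E3) aa bb ab ba DE.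
by split; first [split; lra|lra].
Qed.

Definition frame_reuleaux {R : realType} (a b : plane R) : set (plane R) := reuleaux a (b - a) (- b).

(** The disjunction describes the cones at [- b], [a] and [b - a]; together with their opposites
    they cover all directions. *)
Lemma frame_reuleaux_support (R : realType) (a b u : plane R) (x y : R) : hexagon_frame a b ->
  u = x *: (a + b) + y *: (b - 2 *: a) -> dot u u = 1 ->
  [|| (0 <= y) && (y <= x), (0 <= y) && (x <= 0) | (y <= x) && (x <= 0)] ->
  exists V : plane R, [/\ frame_reuleaux a b V, frame_reuleaux a b (V + u)
    & forall z, frame_reuleaux a b z -> 0 <= dot (z - V) u <= 1].
Proof.
move=> fr uE u1; have := frame_dots fr => -[[d11 d22 d33] [d12 d23 d13] _ _ _].
have nn (e f : plane R) : dot (- e) (- f) = dot e f by rewrite /dot !plane_coordE; ring.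
have nl (e f : plane R) : dot (- e) f = - dot e f by rewrite dotC dotNr dotC.
have C3 (V W W' : plane R) : frame_reuleaux a b = reuleaux V W W' ->
  (exists l m : R, [/\ dot (W - V) (W - V) = 1, dot (W' - V) (W' - V) = 1,
    dot (W - V) (W' - V) = 1 / 2, 0 <= l /\ 0 <= m & u = l *: (W - V) + m *: (W' - V)]) ->
  exists V : plane R, [/\ frame_reuleaux a b V, frame_reuleaux a b (V + u)
    & forall z, frame_reuleaux a b z -> 0 <= dot (z - V) u <= 1].
  by move=> -> [l [m [h1 h2 h3 [h4 h5] h6]]]; exists V; exact: reuleaux_cone h6 u1.
have sp : a - - b = a + b by rewrite opprK.
have sq : b - a - - b = 2 *: b - a by apply: plane_eq; rewrite !plane_coordE; ring.
have pq : b - a - a = b - 2 *: a by apply: plane_eq; rewrite !plane_coordE; ring.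
have ps : - b - a = - (a + b) by apply: plane_eq; rewrite !plane_coordE; ring.
have qs : - b - (b - a) = - (2 *: b - a) by apply: plane_eq; rewrite !plane_coordE; ring.
have qp : a - (b - a) = - (b - 2 *: a) by apply: plane_eq; rewrite !plane_coordE; ring.
case/or3P => /andP[h1 h2].
- apply: (C3 (- b) a (b - a)); first by rewrite /frame_reuleaux reuleauxC reuleauxC.
  exists (x - y), y; rewrite sp sq d11 d22 d12 subr_ge0; split=> //.
  by rewrite uE; apply: plane_eq; rewrite !plane_coordE; ring.
- apply: (C3 a (b - a) (- b)) => //.
  exists y, (- x); rewrite pq ps nn d33 d11 dotNr dotC d13 opprK oppr_ge0; split=> //.
  by rewrite uE; apply: plane_eq; rewrite !plane_coordE; ring.
- apply: (C3 (b - a) (- b) a); first by rewrite /frame_reuleaux reuleauxC.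
  exists (- x), (x - y); rewrite qs qp !nn d22 d33 d23 oppr_ge0 subr_ge0; split=> //.
  by rewrite uE; apply: plane_eq; rewrite !plane_coordE; ring.
Qed.

Lemma frame_reuleaux_constant_width (R : realType) (a b : plane R) : hexagon_frame a b ->
  constant_width 1 (frame_reuleaux a b).
Proof.
move=> fr u c1 c2 /enorm1_dot u1 c12 [[x1 Kx1 x1E] s1] [[x2 Kx2 x2E] s2].
have [_ _ _ _ D0] := frame_dots fr.
have uE := frame_coord u D0; move: (det u _ / _) (det _ u / _) uE => x y uE.
suff [m [M [w [zm Kzm zmE] [zM KzM zME] B]]] : exists m M : R, [/\ M - m = 1,
   (exists2 z, frame_reuleaux a b z & dot u z = m), (exists2 z, frame_reuleaux a b z & dot u z = M)
   & forall z, frame_reuleaux a b z -> m <= dot u z <= M].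
  have V c z : frame_reuleaux a b z -> dot u z = c ->
     ((forall x, frame_reuleaux a b x -> dot u x <= c) \/ (forall x, frame_reuleaux a b x -> c <= dot u x)) ->
     c = m \/ c = M.
    move=> Kz zE [H|H]; have := B _ Kz; rewrite zE.
      by have := H _ KzM; rewrite zME => ? ?; right; lra.
    by have := H _ Kzm; rewrite zmE => ? ?; left; lra.
  have [c1E|c1E] := V _ _ Kx1 x1E s1; have [c2E|c2E] := V _ _ Kx2 x2E s2.
  - by case: c12; rewrite c1E c2E.
  - by rewrite c1E c2E ler0_norm; lra.
  - by rewrite c1E c2E ger0_norm; lra.
  - by case: c12; rewrite c1E c2E.
have P v t : u = t *: v -> t ^+ 2 = 1 -> (exists V : plane R, [/\ frame_reuleaux a b V, frame_reuleaux a b (V + v)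
    & forall z, frame_reuleaux a b z -> 0 <= dot (z - V) v <= 1]) ->
   dot v v = 1 -> exists V, [/\ frame_reuleaux a b V, frame_reuleaux a b (V + t *: u)
    & forall z, frame_reuleaux a b z -> 0 <= t * dot (z - V) u <= 1].
  move=> E t2 [V [h1 h2 h3]] _; exists V; rewrite E scalerA -expr2 t2 scale1r; split=> // z Kz.
  by rewrite dotZr mulrA -expr2 t2 mul1r; exact: h3.
have [t [t2 [V [KV KVu B]]]] : exists t : R, t ^+ 2 = 1 /\ exists V : plane R,
   [/\ frame_reuleaux a b V, frame_reuleaux a b (V + t *: u)
    & forall z, frame_reuleaux a b z -> 0 <= t * dot (z - V) u <= 1].
  have [c|c] := boolP [|| (0 <= y) && (y <= x), (0 <= y) && (x <= 0) | (y <= x) && (x <= 0)].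
    exists 1; split; first by rewrite expr1n.
    by apply: (P u 1) => //; [rewrite scale1r|rewrite expr1n|exact: frame_reuleaux_support uE u1 c].
  exists (-1); split; first by rewrite sqrrN expr1n.
  have nn (e : plane R) : dot (- e) (- e) = dot e e by rewrite /dot !plane_coordE; ring.
  apply: (P (- u) (-1)); [by rewrite scaleN1r opprK|by rewrite sqrrN expr1n| |by rewrite nn].
  apply: (@frame_reuleaux_support R a b (- u) (- x) (- y) fr); [|by rewrite nn|].
    by rewrite {1}uE opprD !scaleNr.
  rewrite !oppr_ge0 !oppr_le0 !lerN2; move: c; rewrite !negb_or !negb_and -!ltNge.
  by case/and3P=> /orP[/ltW h1|/ltW h1] /orP[/ltW h2|/ltW h2] /orP[/ltW h3|/ltW h3];
    rewrite ?h1 ?h2 ?h3 ?orbT //.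
have dE z : dot (z - V) u = dot u z - dot u V by rewrite dotC dotDr dotNr.
have dVu : dot u (V + t *: u) = dot u V + t by rewrite dotDr dotZr u1 mulr1.
have [t1|t1] : t = 1 \/ t = -1.
  move/eqP: t2; rewrite -subr_eq0 (_ : t ^+ 2 - 1 = (t - 1) * (t + 1)); last by ring.
  by rewrite mulf_eq0 => /orP[/eqP h|/eqP h]; [left|right]; lra.
- exists (dot u V), (dot u V + 1); split; first by ring.
  + by exists V.
  + by exists (V + t *: u) => //; rewrite dVu t1.
  + by move=> z /B; rewrite dE t1; lra.
- exists (dot u V - 1), (dot u V); split; first by ring.
  + by exists (V + t *: u) => //; rewrite dVu t1.
  + by exists V.
  + by move=> z /B; rewrite dE t1; lra.
Qed.

Lemma frame_vertices_dot (R : realType) (a b : plane R) : hexagon_frame a b ->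
  dot (b - a) (b - a) = 1 / 3 /\ dot (- b) (- b) = 1 / 3.
Proof.
move=> [aa bb ab _]; split.
  have -> : dot (b - a) (b - a) = dot b b - 2 * dot a b + dot a a by rewrite /dot !plane_coordE; ring.
  by rewrite aa bb ab; lra.
by rewrite dotNr dotC dotNr opprK.
Qed.

Lemma frame_reuleaux_body (R : realType) (a b : plane R) : hexagon_frame a b ->
  convex_body (frame_reuleaux a b).
Proof.
move=> fr; have [cc nb] := frame_vertices_dot fr; have [aa _ _ _] := fr.
by split; [exact: reuleaux_compact|exact: reuleaux_convex|exact: reuleaux_interior].
Qed.

(** For each unit normal of the hexagon, one vertex of the triangle is at height 1/2 and another at
    height -1/2; the unit disks around them bound the height on both sides. *)
Lemma frame_reuleaux_sub (R : realType) (a b x : plane R) : hexagon_frame a b ->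
  frame_reuleaux a b x -> frame_hexagon a b x.
Proof.
move=> fr [h1 h2 h3].
have := frame_dots fr => -[[d11 d22 d33] _ [a1 a2 a3] [b1 b2 b3] _].
have nl (e f : plane R) : dot (- e) f = - dot e f by rewrite dotC dotNr dotC.
have bl (e f g : plane R) : dot (e - f) g = dot e g - dot f g by rewrite dotC dotDr dotNr ![dot g _]dotC.
have key (c e : plane R) : dot (x - c) (x - c) <= 1 -> dot e e = 1 -> - 1 <= dot x e - dot c e <= 1.
  move=> hc ee; rewrite -bl; have := @dot_le1 R (x - c) e hc; have := @dot_le1 R (x - c) (- e) hc.
  by rewrite dotNr nl dotNr opprK ee => H1 H2; have := H1 (lexx _); have := H2 (lexx _); lra.
apply: frame_hexagonP => //; rewrite ler_norml.
- have := key _ _ h1 d11; have := key _ _ h3 d11; rewrite nl a1 b1; lra.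
- have := key _ _ h2 d22; have := key _ _ h3 d22; rewrite nl bl a2 b2; lra.
- have := key _ _ h2 d33; have := key _ _ h1 d33; rewrite bl a3 b3; lra.
Qed.

Lemma frame_hexagon_hull (R : realType) (a b : plane R) : hexagon_frame a b ->
  hull (frame_reuleaux a b `|` (-%R @` frame_reuleaux a b)) = frame_hexagon a b.
Proof.
move=> fr; have [[d11 d22 d33] _ _ _ _] := frame_dots fr.
have nn (e : plane R) : dot (- e) (- e) = dot e e by rewrite /dot !plane_coordE; ring.
have d0 : dot (0 : plane R) 0 <= 1 by rewrite /dot /= mulr0 addr0.
apply/seteqP; split.
  apply: smallest_sub; first exact: convex_frame_hexagon.
  move=> x [|[y Ky <-]]; first exact: frame_reuleaux_sub.
  exact/frame_hexagon_opp/frame_reuleaux_sub.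
have sp : a - - b = a + b by rewrite opprK.
have sq : b - a - - b = 2 *: b - a by apply: plane_eq; rewrite !plane_coordE; ring.
have pq : b - a - a = b - 2 *: a by apply: plane_eq; rewrite !plane_coordE; ring.
have ps : - b - a = - (a + b) by apply: plane_eq; rewrite !plane_coordE; ring.
have qs : - b - (b - a) = - (2 *: b - a) by apply: plane_eq; rewrite !plane_coordE; ring.
have qp : a - (b - a) = - (b - 2 *: a) by apply: plane_eq; rewrite !plane_coordE; ring.
have Ka : frame_reuleaux a b a by split; rewrite ?subrr ?qp ?sp ?nn ?d33 ?d11 //.
have Kc : frame_reuleaux a b (b - a) by split; rewrite ?subrr ?pq ?sq ?nn ?d33 ?d22 //.
have Kb : frame_reuleaux a b (- b) by split; rewrite ?subrr ?ps ?qs ?nn ?d22 ?d11 //.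
have I x : frame_reuleaux a b x -> hull (frame_reuleaux a b `|` (-%R @` frame_reuleaux a b)) x.
  by move=> Kx B [_ KB]; apply: KB; left.
have IN x : frame_reuleaux a b x -> hull (frame_reuleaux a b `|` (-%R @` frame_reuleaux a b)) (- x).
  by move=> Kx B [_ KB]; apply: KB; right; exists x.
have [cK kK _] := frame_reuleaux_body fr.
have [_ kS _] := hull_antipodal cK kK (ex_intro _ _ Ka).
apply: frame_hexagon_sub => //; try exact: I; try exact: IN.
- by have := IN _ Kb; rewrite opprK.
- by have := IN _ Kc; rewrite opprB.
Qed.

(** * The area of the hexagon *)

Definition parallelogram {R : realType} (u w : plane R) : set (mplane R) :=
  [set x : plane R | 0 <= det x w <= det u w /\ 0 <= det u x <= det u w].

Lemma parallelogramE (R : realType) (u w : plane R) : 0 < det u w ->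
  parallelogram u w =
  (fun x : plane R => (w.2 / det u w * x.1 + - w.1 / det u w * x.2,
                       - u.2 / det u w * x.1 + u.1 / det u w * x.2)) @^-1`
  ((`[0, 1]%classic `*` `[0, 1]%classic) : set (mplane R)).
Proof.
move=> D0.
have E1 x : w.2 / det u w * x.1 + - w.1 / det u w * x.2 = det x w / det u w.
  by rewrite /det; field; rewrite -/(det u w) gt_eqF.
have E2 x : - u.2 / det u w * x.1 + u.1 / det u w * x.2 = det u x / det u w.
  by rewrite /det; field; rewrite -/(det u w) gt_eqF.
have I (y : R) : (0 <= y / det u w <= 1) = (0 <= y <= det u w).
  by rewrite pmulr_lge0 ?invr_gt0 // ler_pdivrMr // mul1r.
by apply/seteqP; split => x; rewrite /parallelogram /= E1 E2 !in_itv /= !I.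
Qed.

Lemma measurable_parallelogram (R : realType) (u w : plane R) : 0 < det u w ->
  measurable (parallelogram u w).
Proof.
move=> D0; rewrite parallelogramE //.
have mS : measurable ((`[0, 1]%classic `*` `[0, 1]%classic) : set (mplane R)).
  by apply: measurableX; exact: measurable_itv.
exact: (measurable_preimage_linear (w.2 / det u w) (- w.1 / det u w) (- u.2 / det u w) (u.1 / det u w) mS).
Qed.

Lemma area_parallelogram (R : realType) (u w : plane R) : 0 < det u w ->
  area (parallelogram u w) = (det u w)%:E.
Proof.
move=> D0; rewrite parallelogramE //.
have mS : measurable ((`[0, 1]%classic `*` `[0, 1]%classic) : set (mplane R)).
  by apply: measurableX; exact: measurable_itv.
have k0 : w.2 / det u w * (u.1 / det u w) - - w.1 / det u w * (- u.2 / det u w) = (det u w)^-1.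
  by rewrite /det; field; rewrite -/(det u w) gt_eqF.
have aS : area ((`[0, 1]%classic `*` `[0, 1]%classic) : set (mplane R)) = 1%E.
  rewrite /area product_measure1E /=; [|exact: measurable_itv|exact: measurable_itv].
  by rewrite !lebesgue_measure_itv /= lte_fin ltr01 -EFinB subr0 mule1.
have := @area_linear_preimage R (w.2 / det u w) (- w.1 / det u w) (- u.2 / det u w) (u.1 / det u w) _ _ mS.
rewrite k0 invr_eq0 gt_eqF // => /(_ isT).
rewrite aS gtr0_norm ?invr_gt0 // => E; have := congr1 (fun z => (det u w)%:E * z)%E E.
by rewrite mule1 muleA -EFinM divff ?gt_eqF // mul1e.
Qed.

Lemma frame_hexagon_compact (R : realType) (a b : plane R) : hexagon_frame a b -> compact (frame_hexagon a b).
Proof.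
move=> fr; have [cK kK [x0 /interior_subset Kx0]] := frame_reuleaux_body fr.
have [+ _ _] := hull_antipodal cK kK (ex_intro _ _ Kx0).
by rewrite frame_hexagon_hull.
Qed.

Lemma closed_frame_hexagon (R : realType) (a b : plane R) : hexagon_frame a b -> closed (frame_hexagon a b).
Proof. by move=> fr; apply: compact_closed (frame_hexagon_compact fr); exact: norm_hausdorff. Qed.

Lemma area_setU_le (R : realType) (A B : set (mplane R)) : measurable A -> measurable B ->
  (area (A `|` B) <= area A + area B)%E.
Proof. by move=> mA mB; rewrite /area; exact: measureU2. Qed.

(** Three rhombi, spanned by the pairs among the alternate vertices [a], [b - a], [- b], cover the
    hexagon. An upper bound suffices for the functional to be large, so subadditivity replaces a
    computation of the overlaps. *)
Lemma area_frame_hexagon_le (R : realType) (a b : plane R) : hexagon_frame a b ->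
  (area (frame_hexagon a b) <= (Num.sqrt 3 / 2)%:E)%E.
Proof.
move=> fr; have DE := frame_det fr; have [_ _ _ D0] := fr.
have D1 : det a (b - a) = det a b by rewrite /det !plane_coordE; ring.
have D2 : det (b - a) (- b) = det a b by rewrite /det !plane_coordE; ring.
have D3 : det (- b) a = det a b by rewrite /det !plane_coordE; ring.
have mH := closed_measurable_plane (closed_frame_hexagon fr).
have m1 : measurable (parallelogram a (b - a)) by apply: measurable_parallelogram; rewrite D1.
have m2 : measurable (parallelogram (b - a) (- b)) by apply: measurable_parallelogram; rewrite D2.
have m3 : measurable (parallelogram (- b) a) by apply: measurable_parallelogram; rewrite D3.
have sub : (frame_hexagon a b : set (mplane R)) `<=`
    parallelogram a (b - a) `|` (parallelogram (b - a) (- b) `|` parallelogram (- b) a).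
  move=> x [p [q [-> pI qI pqI]]].
  have X y z (u : R) : det y z = u * det a b -> 0 <= u <= 1 -> 0 <= det y z <= det a b.
    by move=> -> /andP[u0 u1]; nra.
  have [H1|H1] := boolP ((0 <= q) && (0 <= p + q)).
    left; split; rewrite D1; [apply: (X _ _ (p + q))|apply: (X _ _ q)]; try lra;
      by rewrite /det !plane_coordE; ring.
  right; have [H2|H2] := boolP ((p <= 0) && (p + q <= 0)).
    left; split; rewrite D2; [apply: (X _ _ (- p))|apply: (X _ _ (- (p + q)))]; try lra;
      by rewrite /det !plane_coordE; ring.
  move: H1 H2; rewrite !negb_and -!ltNge => H1 H2.
  have H3 : q <= 0 /\ 0 <= p by case/orP: H1; case/orP: H2 => *; split; lra.
  right; split; rewrite D3; [apply: (X _ _ (- q))|apply: (X _ _ p)]; try lra;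
    by rewrite /det !plane_coordE; ring.
have A1 := area_parallelogram (_ : 0 < det a (b - a)); rewrite D1 in A1; have {}A1 := A1 D0.
have A2 := area_parallelogram (_ : 0 < det (b - a) (- b)); rewrite D2 in A2; have {}A2 := A2 D0.
have A3 := area_parallelogram (_ : 0 < det (- b) a); rewrite D3 in A3; have {}A3 := A3 D0.
move: m1 m2 m3 sub A1 A2 A3.
move: (parallelogram _ _) (parallelogram _ _) (parallelogram _ _) => P3 P2 P1 m1 m2 m3 sub A1 A2 A3.
have U : (area (P1 `|` (P2 `|` P3)) <= area P1 + (area P2 + area P3))%E.
  apply: le_trans (area_setU_le m1 (measurableU _ _ m2 m3)) _.
  by apply: leeD2l; exact: area_setU_le.
apply: le_trans (le_trans _ U) _.
  by apply: le_measure; rewrite ?inE //; apply: measurableU => //; exact: measurableU.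
by rewrite A1 A2 A3 -!EFinD lee_fin DE; lra.
Qed.

(** * Regular hexagons given by their vertices *)

Lemma hull_convex (R : realType) (A : set (plane R)) : @convex_set R (plane R) (hull A).
Proof.
by apply/convex_setE => x y t tI hx hy B [kB AB]; move/convex_setE: (kB); apply => //; [exact: hx|exact: hy].
Qed.

Lemma disk_convex (R : realType) (r : R) : 0 <= r -> @convex_set R (plane R) (disk r).
Proof.
move=> r0; apply/convex_setE => x y t tI; rewrite /disk /= !enorm_le // => hx hy.
by have := @dist2_convex R 0 x y t (r ^+ 2) tI; rewrite !subr0; apply.
Qed.

Lemma hexagon_vertexE (R : realType) (c : plane R) (r t : R) (k : nat) :
  hexagon_vertex c r t k = c + r *: direction (t + k%:R * (pi / 3)).
Proof. by []. Qed.

Lemma hexagon_vertex01 (R : realType) (r t : R) :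
  hexagon_vertex 0 r t 0 = r *: direction t /\ hexagon_vertex 0 r t 1 = r *: direction (t + pi / 3).
Proof. by rewrite !hexagon_vertexE !add0r mul0r addr0 (mul1r (pi / 3)). Qed.

(** Rotation by [pi / 3] has trace [2 * cos (pi / 3) = 1]; the recurrence yields all vertices from
    the first two. *)
Lemma direction_add_rec (R : realType) (x : R) :
  direction (x + pi / 3 + pi / 3) = direction (x + pi / 3) - direction x :> plane R.
Proof.
have s3 := sqrt3_sq R; apply: plane_eq; rewrite !plane_coordE /direction /= !(cosD, sinD) cos_pi3 sin_pi3.
  transitivity (cos x * (1 / 4 - Num.sqrt 3 ^+ 2 / 4) - sin x * (Num.sqrt 3 / 2)); first by field.
  by rewrite s3; field.
transitivity (sin x * (1 / 4 - Num.sqrt 3 ^+ 2 / 4) + cos x * (Num.sqrt 3 / 2)); first by field.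
by rewrite s3; field.
Qed.

Lemma hexagon_vertex_rec (R : realType) (r t : R) (k : nat) :
  hexagon_vertex 0 r t k.+2 = hexagon_vertex 0 r t k.+1 - hexagon_vertex 0 r t k.
Proof.
rewrite !hexagon_vertexE !add0r -scalerBr; congr (_ *: _).
rewrite (_ : t + k.+2%:R * (pi / 3) = t + k%:R * (pi / 3) + pi / 3 + pi / 3); last by rewrite -[k.+2%:R]natr1 -natr1; ring.
rewrite (_ : t + k.+1%:R * (pi / 3) = t + k%:R * (pi / 3) + pi / 3); last by rewrite -natr1; ring.
exact: direction_add_rec.
Qed.

Lemma hexagon_vertices (R : realType) (r t : R) :
  let a := hexagon_vertex 0 r t 0 in let b := hexagon_vertex 0 r t 1 in
  [/\ hexagon_vertex 0 r t 2 = b - a, hexagon_vertex 0 r t 3 = - a, hexagon_vertex 0 r t 4 = - b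
    & hexagon_vertex 0 r t 5 = a - b].
Proof.
move=> a b; have v2 : hexagon_vertex 0 r t 2 = b - a by rewrite hexagon_vertex_rec.
have v3 : hexagon_vertex 0 r t 3 = - a by rewrite hexagon_vertex_rec v2 addrAC subrr add0r.
have v4 : hexagon_vertex 0 r t 4 = - b by rewrite hexagon_vertex_rec v3 v2; apply: plane_eq; rewrite !plane_coordE; ring.
by split=> //; rewrite hexagon_vertex_rec v4 v3; apply: plane_eq; rewrite !plane_coordE; ring.
Qed.

Lemma hexagon_vertex_dot (R : realType) (r t : R) (k : nat) :
  dot (hexagon_vertex 0 r t k) (hexagon_vertex 0 r t k) = r ^+ 2.
Proof.
rewrite hexagon_vertexE add0r; set x := t + _.
transitivity (r ^+ 2 * (cos x ^+ 2 + sin x ^+ 2)); last by rewrite cos2Dsin2 mulr1.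
by rewrite /dot !plane_coordE /=; ring.
Qed.

Lemma hexagon_vertex_frame (R : realType) (r t : R) : r ^+ 2 = 1 / 3 ->
  hexagon_frame (hexagon_vertex 0 r t 0) (hexagon_vertex 0 r t 1).
Proof.
move=> r2; have [v0 v1] := hexagon_vertex01 r t.
split; rewrite ?hexagon_vertex_dot // v0 v1.
  have -> : dot (r *: direction t) (r *: direction (t + pi / 3)) = r ^+ 2 * dot (direction (t + pi / 3)) (direction t).
    by rewrite /dot !plane_coordE; ring.
  by rewrite dot_direction_sub (addrC t) addrK cos_pi3 r2; field.
rewrite det_polar (addrC t) addrK sin_pi3 -expr2 r2.
by rewrite mulr_gt0 // divr_gt0 // sqrtr_gt0.
Qed.

Lemma hexagon_frameE (R : realType) (r t : R) :
  hexagon 0 r t = frame_hexagon (hexagon_vertex 0 r t 0) (hexagon_vertex 0 r t 1).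
Proof.
have [v2 v3 v4 v5] := hexagon_vertices r t.
have [fa fb fc [fna fnb fnc]] := frame_hexagon_vertices (hexagon_vertex 0 r t 0) (hexagon_vertex 0 r t 1).
apply/seteqP; split.
  apply: smallest_sub; first exact: convex_frame_hexagon.
  move=> x [k /= k6 <-]; case: k k6 => [|[|[|[|[|[|//]]]]]] _ //; rewrite ?v2 ?v3 ?v4 ?v5 //.
have I k : (k < 6)%N -> hexagon 0 r t (hexagon_vertex 0 r t k) by move=> k6 B [_ AB]; apply: AB; exists k.
apply: frame_hexagon_sub; first exact: hull_convex.
- exact: I. - exact: I.
- by rewrite -v2; exact: I. - by rewrite -v3; exact: I.
- by rewrite -v4; exact: I. - by rewrite -v5; exact: I.
Qed.

(** Subtracting the equations of opposite vertices makes [c] orthogonal to two independent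
    directions. *)
Lemma regular_hexagon_centered (R : realType) (c : plane R) (r t rho : R) : 0 < r -> 0 < rho ->
  (forall k, (k < 6)%N -> enorm (hexagon_vertex c r t k) = rho) -> c = 0 /\ r = rho.
Proof.
move=> r0 rho0 H.
have D k : (k < 6)%N -> dot c c + 2 * r * dot c (direction (t + k%:R * (pi / 3))) + r ^+ 2 = rho ^+ 2.
  move=> k6; rewrite -(H k k6) enormE hexagon_vertexE; set x := t + _.
  have := direction_dot x; set u := direction x => u1.
  have -> : dot (c + r *: u) (c + r *: u) = dot c c + 2 * r * dot c u + r ^+ 2 * dot u u.
    by rewrite /dot !plane_coordE; ring.
  by rewrite u1 mulr1.
have e3 : direction (t + 3%:R * (pi / 3)) = - direction t :> plane R.
  by rewrite (_ : t + _ = t + pi) ?/direction ?cosDpi ?sinDpi //; field.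
have e4 : direction (t + 4%:R * (pi / 3)) = - direction (t + pi / 3) :> plane R.
  by rewrite (_ : t + _ = t + pi / 3 + pi) ?/direction ?cosDpi ?sinDpi //; field.
have := D 0%N isT; have := D 1%N isT; have := D 3%N isT; have := D 4%N isT.
rewrite e3 e4 mul0r addr0 mul1r !dotNr => h4 h3 h1 h0.
have c0 : dot c (direction t) = 0.
  by apply/eqP; rewrite -(mulrI_eq0 _ (lregP (lt0r_neq0 r0))); apply/eqP; lra.
have c1 : dot c (direction (t + pi / 3)) = 0.
  by apply/eqP; rewrite -(mulrI_eq0 _ (lregP (lt0r_neq0 r0))); apply/eqP; lra.
have g0 : det (direction t) c = 0.
  move: c1; rewrite dot_direction_rotate c0 mul0r add0r sin_pi3 => /eqP.
  rewrite mulf_eq0 => /orP[/eqP //|]; rewrite gt_eqF // divr_gt0 // sqrtr_gt0.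
have cE : c = 0 by rewrite (plane_frame c t) c0 g0 !mul0r subrr addr0.
split=> //; move: h0; rewrite cE /dot /= !mul0r !addr0 mulr0 !add0r => h0.
by apply/eqP; rewrite -(@eqrXn2 _ 2) ?ltW //; apply/eqP.
Qed.

Lemma sin_half_product (R : realType) (x y : R) :
  sin (2 * x) + sin (2 * y) - sin (2 * x + 2 * y) = 4 * sin x * sin y * sin (x + y).
Proof.
have E (z : R) : 2 * z = z *+ 2 by rewrite mulr2n; ring.
rewrite !E (sinD (x *+ 2)) (sinD x y) !sin_mulr2n !cos_mulr2n.
have := sin2cos2 x; have := sin2cos2 y; set sx := sin x; set sy := sin y; set cx := cos x; set cy := cos y.
move=> hy hx.
have -> : 4 * sx * sy * (sx * cy + cx * sy) = 4 * (sx ^+ 2) * sy * cy + 4 * sx * cx * sy ^+ 2 by ring.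
by rewrite hx hy; ring.
Qed.

(** In product form the sign is visible: for increasing angles within one turn, all half differences
    lie between 0 and [pi]. *)
Lemma orient_circle (R : realType) (r x y z : R) :
  orient (r *: direction x) (r *: direction y) (r *: direction z) =
  4 * r ^+ 2 * (sin ((y - x) / 2) * sin ((z - y) / 2) * sin ((z - x) / 2)).
Proof.
have H := sin_half_product ((y - x) / 2) ((z - y) / 2).
have e1 : 2 * ((y - x) / 2) = y - x by lra.
have e2 : 2 * ((z - y) / 2) = z - y by lra.
have e3 : (y - x) / 2 + (z - y) / 2 = (z - x) / 2 by lra.
have e4 : y - x + (z - y) = z - x by ring.
rewrite e1 e2 e3 e4 in H.
transitivity (r ^+ 2 * (sin (y - x) + sin (z - y) - sin (z - x))).
  by rewrite /orient !plane_coordE /= !sinB; ring.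
by rewrite H; ring.
Qed.

Lemma hexagon_convex_order (R : realType) (r t : R) : 0 < r -> convex_order 6 (hexagon_vertex 0 r t).
Proof.
move=> r0 i j k ij jk k6; rewrite !hexagon_vertexE !add0r orient_circle.
have pi0 := pi_gt0 R.
have S m n : (m < n)%N -> (n < 6)%N ->
   0 < sin ((t + n%:R * (pi / 3) - (t + m%:R * (pi / 3))) / 2).
  move=> mn n6.
  have -> : (t + n%:R * (pi / 3) - (t + m%:R * (pi / 3))) / 2 = (n - m)%N%:R * (pi / 6).
    by rewrite natrB ?(ltnW mn) //; field.
  apply: sin_gt0_pi; apply/andP; split; first by rewrite mulr_gt0 ?ltr0n ?subn_gt0 // divr_gt0.
  have : (n - m)%N%:R <= 5 :> R by rewrite (ler_nat _ _ 5); lia.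
  by nra.
by rewrite !mulr_gt0 ?exprn_gt0 ?S //; lia.
Qed.

(** By the recurrence, the difference of two consecutive vertices is itself a vertex, so each side
    has length [r]. *)
Lemma hexagon_polygon_length (R : realType) (r t : R) : 0 < r ->
  polygon_length 6 (hexagon_vertex 0 r t) = 6 * r.
Proof.
move=> r0; have P k : hexagon_vertex 0 r t (k %% 6) = hexagon_vertex 0 r t k.
  rewrite {2}(divn_eq k 6) addnC; elim: (k %/ 6)%N => [|q IH]; first by rewrite mul0n addn0.
  rewrite mulSn addnCA {}IH !hexagon_vertexE; congr (_ + _ *: _).
  move: (k %% 6 + q * 6)%N => m.
  have -> : t + (6 + m)%:R * (pi / 3) = t + m%:R * (pi / 3) + pi *+ 2.
    by rewrite (natrD _ 6) (mulr2n pi); field.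
  by rewrite /direction cosD2pi sinD2pi.
rewrite /polygon_length (eq_bigr (fun _ => r)) => [|i _].
  by rewrite sumr_const card_ord mulr_natl.
rewrite P -hexagon_vertex_rec; apply/eqP.
by rewrite -(@eqrXn2 _ 2) ?enorm_ge0 ?ltW // enormE hexagon_vertex_dot.
Qed.

(** * The two maximum problems *)

Lemma half_perimeter_minus_area_le (R : realType) (S : set (plane R)) : closed S ->
  (exists A : R, area S = A%:E) ->
  (forall n p, (0 < n)%N -> convex_order n p -> (forall i, (i < n)%N -> S (p i)) ->
    ((2^-1 * polygon_length n p)%:E <= area S + (Num.sqrt 3 / 2)%:E)%E) ->
  (half_perimeter_minus_area S <= (Num.sqrt 3 / 2)%:E)%E.
Proof.
move=> clS [A AE] H; rewrite /half_perimeter_minus_area AE.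
have : (perimeter S <= (2 * (A + Num.sqrt 3 / 2))%:E)%E.
  apply: ge_ereal_sup => _ [n [p [[n2 Sp cp] ->]]].
  have := H n p (ltn_trans (isT : 0 < 2)%N n2) cp.
  rewrite AE -EFinD !lee_fin => /(_ _) h; rewrite -ler_pdivrMl //; apply: h => i ilt.
  by have [+ _] := Sp i ilt; rewrite -(closure_id S).1.
move=> h; rewrite leeBlDr //; apply: (@le_trans _ _ (2^-1%:E * (2 * (A + Num.sqrt 3 / 2))%:E)%E).
  by rewrite lee_pmul2l // lte_fin invr_gt0.
by rewrite -EFinM -EFinD lee_fin mulKf // addrC.
Qed.

Lemma annulus_functional_le (R : realType) (S : set (plane R)) :
  bodies_in_annulus S -> (half_perimeter_minus_area S <= (Num.sqrt 3 / 2)%:E)%E.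
Proof.
move=> SA; have [[cS _ _] _ Sr] := SA.
have clS : closed S by apply: compact_closed cS; exact: norm_hausdorff.
have r0 : 0 <= Num.sqrt 3 / 3 :> R by rewrite divr_ge0 ?sqrtr_ge0.
apply: half_perimeter_minus_area_le => //; last exact: annulus_length_bound.
have [|A _ AE] := area_bounded clS _ r0; last by exists A.
by move=> x /Sr; rewrite /disk /= enorm_le.
Qed.

Lemma symmetrized_functional_le (R : realType) (S : set (plane R)) :
  symmetrized_constant_width S -> (half_perimeter_minus_area S <= (Num.sqrt 3 / 2)%:E)%E.
Proof.
move=> [K [bK wK ->]]; have [cK kK [x0 /interior_subset x0K]] := bK.
have [cS _ _] := hull_antipodal cK kK (ex_intro _ x0 x0K).
have clS : closed (hull (K `|` (-%R @` K))) by apply: compact_closed cS; exact: norm_hausdorff.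
apply: half_perimeter_minus_area_le => //; last exact: constant_width_length_bound.
have [|y _ ymax] := compact_dist2_max 0 cS.
  by exists x0 => B [_]; apply; left.
have [|A _ AE] := area_bounded clS _ (enorm_ge0 y); last by exists A.
by move=> x /ymax; rewrite !subr0 enormE.
Qed.

Lemma frame_hexagon_annulus (R : realType) (a b : plane R) : hexagon_frame a b ->
  bodies_in_annulus (frame_hexagon a b).
Proof.
move=> fr; have [[d11 d22 d33] _ _ _ _] := frame_dots fr.
have r0 : 0 <= Num.sqrt 3 / 3 :> R by rewrite divr_ge0 ?sqrtr_ge0.
split.
- split; [exact: frame_hexagon_compact|exact: convex_frame_hexagon|].
  have [_ _ [x xi]] := frame_reuleaux_body fr; exists x.
  by move: xi; apply: interiorS => y; exact: frame_reuleaux_sub.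
- move=> x; rewrite /disk /= enorm_le // => xx.
  have key (e : plane R) : dot e e = 1 -> `|dot x e| <= 1 / 2.
    move=> e1; rewrite -(@ler_pXn2r _ 2) ?nnegrE // real_normK ?num_real //.
    have : 0 <= det x e ^+ 2 by exact: sqr_ge0.
    move: xx e1; rewrite /dot /det; nra.
  by apply: frame_hexagonP => //; exact: key.
- have r2 : (Num.sqrt 3 / 3) ^+ 2 = 1 / 3 :> R by rewrite expr_div_n sqrt3_sq; field.
  have [cc nb] := frame_vertices_dot fr; have [aa bb _ _] := fr.
  have nn (e : plane R) : dot (- e) (- e) = dot e e by rewrite /dot !plane_coordE; ring.
  apply: frame_hexagon_sub; first exact: disk_convex.
  + by rewrite /disk /= enorm_le // r2 aa.
  + by rewrite /disk /= enorm_le // r2 bb.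
  + by rewrite /disk /= enorm_le // r2 cc.
  + by rewrite /disk /= enorm_le // r2 nn aa.
  + by rewrite /disk /= enorm_le // r2 nn bb.
  + by rewrite /disk /= enorm_le // r2 -opprB nn cc.
Qed.

Lemma frame_hexagon_symmetrized (R : realType) (a b : plane R) : hexagon_frame a b ->
  symmetrized_constant_width (frame_hexagon a b).
Proof.
move=> fr; exists (frame_reuleaux a b); split; first exact: frame_reuleaux_body.
  exact: frame_reuleaux_constant_width.
by rewrite frame_hexagon_hull.
Qed.

Lemma hexagon_functional_ge (R : realType) (r t : R) : r = Num.sqrt 3 / 3 ->
  ((Num.sqrt 3 / 2)%:E <= half_perimeter_minus_area (hexagon 0%R r t))%E.
Proof.
move=> rE; have r0 : 0 < r by rewrite rE divr_gt0 ?sqrtr_gt0.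
have r2 : r ^+ 2 = 1 / 3 by rewrite rE expr_div_n sqrt3_sq; field.
have fr := hexagon_vertex_frame t r2.
have [_ _ Hr] := frame_hexagon_annulus fr.
have V k : (k < 6)%N -> hexagon 0 r t (hexagon_vertex 0 r t k) by move=> k6 B [_]; apply; exists k.
rewrite /half_perimeter_minus_area.
have pE : ((6 * r)%:E <= perimeter (hexagon 0%R r t))%E.
  apply: ereal_sup_ubound; exists 6%N, (hexagon_vertex 0 r t); split; last by rewrite hexagon_polygon_length.
  split=> //; last first.
    by move=> i j k ij jk k6; exact: hexagon_convex_order.
  move=> i i6; split; first by apply: subset_closure; exact: V.
  (* An interior vertex could be pushed outwards within the hexagon and would leave the disk of
     radius [r]. *)
  rewrite hexagon_frameE => /(@interior_direction _ _ _ (direction (t + i%:R * (pi / 3)))) [|s s0 /Hr].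
    exact: direction_dot.
  rewrite hexagon_vertexE add0r -scalerDl /disk /= -rE enorm_le ?(ltW r0) //.
  have -> (c : R) (u : plane R) : dot (c *: u) (c *: u) = c ^+ 2 * dot u u by rewrite /dot !plane_coordE; ring.
  by rewrite direction_dot mulr1; nra.
have aE : (area (hexagon 0%R r t) <= (Num.sqrt 3 / 2)%:E)%E by rewrite hexagon_frameE; exact: area_frame_hexagon_le.
apply: (@le_trans _ _ ((2^-1)%:E * (6 * r)%:E - (Num.sqrt 3 / 2)%:E)%E).
  by rewrite -EFinM -EFinB lee_fin rE; lra.
by apply: leeB => //; rewrite lee_pmul2l // lte_fin invr_gt0.
Qed.

Lemma regular_hexagon_betweenE (R : realType) (H : set (plane R)) :
  regular_hexagon_between (1 / 2) (Num.sqrt 3 / 3) H ->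
  exists2 t : R, H = hexagon 0 (Num.sqrt 3 / 3) t &
    hexagon_frame (hexagon_vertex 0 (Num.sqrt 3 / 3) t 0) (hexagon_vertex 0 (Num.sqrt 3 / 3) t 1).
Proof.
move=> [c [r [t [r0 HE vr _ _]]]]; have rho0 : 0 < Num.sqrt 3 / 3 :> R by rewrite divr_gt0 ?sqrtr_gt0.
have [c0 rE] := regular_hexagon_centered r0 rho0 vr.
exists t; first by rewrite HE c0 rE.
by apply: hexagon_vertex_frame; rewrite expr_div_n sqrt3_sq; field.
Qed.

Lemma regular_hexagon_exists (R : realType) :
  regular_hexagon_between (1 / 2) (Num.sqrt 3 / 3) (hexagon (0 : plane R) (Num.sqrt 3 / 3) 0).
Proof.
have r0 : 0 < Num.sqrt 3 / 3 :> R by rewrite divr_gt0 ?sqrtr_gt0.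
have r2 : (Num.sqrt 3 / 3) ^+ 2 = 1 / 3 :> R by rewrite expr_div_n sqrt3_sq; field.
exists 0, (Num.sqrt 3 / 3), 0; split=> //.
- move=> k _; apply/eqP; rewrite -(@eqrXn2 _ 2) ?enorm_ge0 ?(ltW r0) //.
  by rewrite enormE hexagon_vertex_dot.
- by rewrite hexagon_frameE; have [] := frame_hexagon_annulus (hexagon_vertex_frame 0 r2).
move=> k _; set u := hexagon_vertex _ _ _ k; set w := hexagon_vertex _ _ _ _.
have hf : 0 <= (1 / 2 : R) <= 1 by lra.
(* The disk touches each side at its midpoint, whose squared norm is 1/4. *)
exists ((1 / 2 : R) *: u + (1 - 1 / 2 : R) *: w); split.
  by have /convex_setE := @hull_convex R [set u; w]; apply => // B [_]; apply; [left|right].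
rewrite /disk /= enorm_le; last by lra.
have uu : dot u u = 1 / 3 by rewrite hexagon_vertex_dot.
have ww : dot w w = 1 / 3 by rewrite hexagon_vertex_dot.
have dd : dot (w - u) (w - u) = 1 / 3 by rewrite -hexagon_vertex_rec hexagon_vertex_dot.
move: uu ww dd; rewrite /dot !plane_coordE; lra.
Qed.

Theorem mainTheorem4 (R : realType) :
  (exists H : set (plane R),
     regular_hexagon_between (1 / 2) (Num.sqrt 3 / 3) H) /\
  (forall H : set (plane R),
     regular_hexagon_between (1 / 2) (Num.sqrt 3 / 3) H ->
     [/\ maximizes half_perimeter_minus_area bodies_in_annulus H,
         half_perimeter_minus_area H = (Num.sqrt 3 / 2)%:E
       & maximizes half_perimeter_minus_area symmetrized_constant_width H]).
Proof.
split; first by exists (hexagon 0 (Num.sqrt 3 / 3) 0); exact: regular_hexagon_exists.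
move=> H /regular_hexagon_betweenE [t HE fr].
have HA : bodies_in_annulus H by rewrite HE hexagon_frameE; exact: frame_hexagon_annulus.
have JE : half_perimeter_minus_area H = (Num.sqrt 3 / 2)%:E.
  by apply/eqP; rewrite eq_le annulus_functional_le // HE hexagon_functional_ge.
split; [split; first exact: HA|exact: JE|split].
- by move=> S SA; rewrite JE; exact: annulus_functional_le.
- by rewrite HE hexagon_frameE; exact: frame_hexagon_symmetrized.
- by move=> S SA; rewrite JE; exact: symmetrized_functional_le.
Qed.
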